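(* There exists a distribution $\mathcal{D}$ over symmetric real $n\times n$ matrices such that, given $A\sim\mathcal{D}$ and $0<\varepsilon<1$, any randomized algorithm in the matrix-vector product model requires $\Omega\left(\log(n)/\varepsilon^{1/2}\right)$ matrix-vector products to output a unit vector $v$ such that, with probability at least $2/3$, \[ \left\|A\left(I-vv^\top\right)\right\|_{\mathrm{op}} \le (1+\varepsilon)\min_{\|u\|_2=1}\left\|A\left(I-uu^\top\right)\right\|_{\mathrm{op}}. \]
   Context: Matrix-vector product model: the algorithm accesses the input matrix $A$ only through adaptive queries; it chooses a query vector $v^1$ and receives $Av^1$, then chooses $v^2$ as any (possibly randomized) function of the previous queries and responses and receives $Av^2$, and so on. The complexity is the number of such products. $\|\cdot\|_{\mathrm{op}}$ denotes the spectral (operator) norm. *)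

(* Defs.v *)
From HB Require Import structures.
From mathcomp Require Import all_boot all_order all_algebra.
From mathcomp Require Import all_classical all_reals all_analysis.
Set Implicit Arguments. Unset Strict Implicit. Unset Printing Implicit Defensive.
Import Order.TTheory GRing.Theory Num.Theory.
Import numFieldNormedType.Exports.
Local Open Scope classical_set_scope.
Local Open Scope ring_scope.

Section Defs.
Variable R : realType.

Definition vnorm2 n (x : 'cV[R]_n) : R := Num.sqrt (\sum_i x i ord0 ^+ 2).

Definition opnorm n (M : 'M[R]_n) : R :=
  sup [set vnorm2 (M *m x) | x in [set x : 'cV[R]_n | vnorm2 x = 1]].

Definition proj_err n (A : 'M[R]_n) (v : 'cV[R]_n) : R :=
  opnorm (A *m (1%:M - v *m v^T)).

(* min over unit u of ||A (I - u u^T)||_op (the minimum is attained, by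
   compactness of the unit sphere, so it equals this infimum). *)
Definition opt_err n (A : 'M[R]_n) : R :=
  inf [set proj_err A u | u in [set u : 'cV[R]_n | vnorm2 u = 1]].

Definition mx_gen n : set (set 'M[R]_n) :=
  [set S | exists (i j : 'I_n) (B : set R),
     measurable B /\ S = (fun M : 'M[R]_n => M i j) @^-1` B].

Definition mxSpace n : measurableType _ :=
  @g_sigma_algebraType 'M[R]_n (@mx_gen n).

Definition sym_set n : set (mxSpace n) := [set M : 'M[R]_n | M^T = M].

(* Matrix-vector product model.  A (randomized) algorithm with k queries is
   given by a random seed w (drawn from its own probability space,
   independent of the input A), a query rule [query w rs] producing the next
   query vector from the list rs of responses received so far (earlier query
   vectors are themselves functions of w and earlier responses), and an
   output rule [out w rs] applied to the full list of k responses. *)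
Fixpoint responses n (q : seq 'cV[R]_n -> 'cV[R]_n) (A : 'M[R]_n) (k : nat)
  : seq 'cV[R]_n :=
  match k with
  | 0%N => [::]
  | k'.+1 => let rs := responses q A k' in rcons rs (A *m q rs)
  end.

Definition alg_output n (Om : Type) (query : Om -> seq 'cV[R]_n -> 'cV[R]_n)
  (out : Om -> seq 'cV[R]_n -> 'cV[R]_n) (k : nat) (A : 'M[R]_n) (w : Om)
  : 'cV[R]_n := out w (responses (query w) A k).

Definition good_event n (Om : Type) (query : Om -> seq 'cV[R]_n -> 'cV[R]_n)
  (out : Om -> seq 'cV[R]_n -> 'cV[R]_n) (k : nat) (eps : R)
  : set (mxSpace n * Om) :=
  [set p | let v := alg_output query out k p.1 p.2 in
           vnorm2 v = 1 /\ proj_err p.1 v <= (1 + eps) * opt_err p.1].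

(* "With probability at least 2/3" over A ~ D and the algorithm's randomness
   (product measure).  To avoid measurability side conditions on the
   algorithm, we ask for a measurable sub-event of the success event having
   probability >= 2/3 (inner probability); for measurable algorithms this is
   exactly Pr[success] >= 2/3. *)
Definition succeeds n (D : probability (mxSpace n) R) d (Om : measurableType d)
  (P : probability Om R) (query : Om -> seq 'cV[R]_n -> 'cV[R]_n)
  (out : Om -> seq 'cV[R]_n -> 'cV[R]_n) (k : nat) (eps : R) : Prop :=
  exists E : set (mxSpace n * Om), measurable E /\
    E `<=` good_event query out k eps /\
    ((2 / 3 : R)%:E <= (D \x P) E)%E.

End Defs.

(* Main.v *)
Require Import Defs.
From HB Require Import structures.
From mathcomp Require Import all_boot all_order all_algebra.
From mathcomp Require Import all_classical all_reals all_analysis.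
From mathcomp Require Import measurable_realfun ring lra.
Set Implicit Arguments. Unset Strict Implicit. Unset Printing Implicit Defensive.
Import Order.TTheory GRing.Theory Num.Theory.
Import numFieldNormedType.Exports.
Local Open Scope classical_set_scope.
Local Open Scope ring_scope.

(** The instance is A = G diag(d) G^T, with G an n x m standard Gaussian matrix
    and n much larger than m, so that G^T G is nearly a multiple of the identity.
    One entry of d equals lam >= 1 + 4 eps; the others are the extremal points of
    the Chebyshev polynomial T_L, each repeated b times, all in [-1, 1].  An
    accurate output v must have G^T v noticeably correlated with the axis of lam.

    Answering a query x amounts to revealing the row x^T G and then the column
    G (diag(d) G^T x).  By rotation invariance, what is not yet revealed stays
    Gaussian, so by Fubini each query costs one fresh Gaussian row z_j, whatever
    the algorithm: the final G^T v is always a combination of p_j(diag d) z_j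
    with deg p_j <= k+1.

    For such a vector, the b-fold repetition makes its squared norm at least
    about b times the sum of the p_j(node)^2, while its entry on the axis of lam is
    controlled by the p_j(lam)^2, hence, by the extremal property of T_L, by
    T_L(lam)^2 times the same sum.  As T_L(lam) <= exp(9 L sqrt(eps)), the
    correlation is too small unless L is of order log(n) / sqrt(eps). *)

(** * Affine substitutions for the Lebesgue measure *)

(** The query rule is an arbitrary function, possibly not measurable, so no conditional law of the
    transcript can be formed. The seed is therefore fixed first, and every bound in the recursion is
    proved for each fixed value of what has been revealed: the next query is then a fixed vector,
    and only the given success event and the final Gaussian event are measured.

    This is also why a query costs a row but no column. A revealed row enters the row space
    containing G^T v and must be averaged; a revealed column adds only its direction, already
    spanned by the rows and their images under diag(d), so the bound is uniform in its value.

    Concentration comes from second moments of Gram matrices and Markov's inequality. The price is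
    polynomial (b = a^4 and n about a^12 for an integer a), harmless since only log n matters. The
    failure budget is 1/9 for the Gram matrix of G, 1/9 for the blocks of the fresh rows and 1/9 for
    their entries on the axis of lam, so success has probability at most 1/3. *)

Section Lebesgue.
Context {R : realType}.
Local Open Scope ereal_scope.
Notation mu := (@lebesgue_measure R).

(** By uniqueness of the Lebesgue measure: the pushforward along the affine map, scaled by [|a|],
    agrees with it on half-open intervals. For [a < 0] the preimage is closed at the other end,
    which leaves its length unchanged. *)
Lemma lebesgue_measure_affine (a b : R) (A : set R) : a != 0%R -> measurable A ->
  mu ((fun x : R => a * x + b)%R @^-1` A) = (`|a|^-1)%:E * mu A.
Proof.
move=> a0 mA.
have mphi : measurable_fun setT (fun x : R => a * x + b)%R.
  by apply: measurable_funD => //; apply: measurable_funM.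
have a0' : (0 < `|a|)%R by rewrite normr_gt0.
pose phi := (fun x : R => a * x + b)%R : measurableTypeR R -> measurableTypeR R.
have mphi' : measurable_fun setT phi by exact: mphi.
pose nu0 := mscale (NngNum (normr_ge0 a)) (pushforward mu phi).
pose nu := nu0 mphi'.
have H : mu A = nu A.
  apply: (@lebesgue_measure_unique R nu) => // _ [[c d]] _ <-.
  rewrite /nu/= /mscale/= /pushforward.
  have [ap|an] := ltrP 0 a.
    rewrite (_ : phi @^-1` _ = `](c - b) / a, (d - b) / a]%classic)%R; last first.
      apply/seteqP; split => x /=; rewrite !in_itv/= /phi;
        by rewrite ltr_pdivrMr// ler_pdivlMr// ltrBlDr lerBrDr mulrC.
    rewrite !lebesgue_measure_itv/= !lte_fin ltr_pM2r ?invr_gt0// ltrBlDr subrK.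
    case: ifPn; rewrite ?mule0// => _.
    by rewrite gtr0_norm// -EFinM -!EFinB; congr EFin; field; rewrite gt_eqF.
  have {}an : (a < 0)%R by rewrite lt_neqAle a0.
  rewrite (_ : phi @^-1` _ = `[(d - b) / a, (c - b) / a[%classic)%R; last first.
    apply/seteqP; split => x /=; rewrite !in_itv/= /phi;
      by rewrite ltr_ndivlMr// ler_ndivrMr// ltrBlDr lerBrDr mulrC andbC.
  rewrite !lebesgue_measure_itv/= !lte_fin ltr_nM2r ?invr_lt0// ltrBlDr subrK.
  case: ifPn; rewrite ?mule0// => _.
  by rewrite ltr0_norm// -EFinM -!EFinB; congr EFin; field; rewrite lt_eqF.
rewrite H /nu/= /mscale/= /pushforward muleA -EFinM mulVf ?mul1e// gt_eqF//.
Qed.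

Lemma ge0_integral_affine (a b : R) (f : R -> \bar R) : a != 0%R ->
  measurable_fun setT f -> (forall x, 0 <= f x) ->
  \int[mu]_x f (a * x + b)%R = (`|a|^-1)%:E * \int[mu]_x f x.
Proof.
move=> a0 mf f0.
have mphi : measurable_fun setT (fun x : R => a * x + b)%R.
  by apply: measurable_funD => //; apply: measurable_funM.
have aV0 : (0 <= `|a|^-1)%R by rewrite invr_ge0.
transitivity (\int[mscale (NngNum aV0) mu]_x f x); last first.
  by rewrite ge0_integral_mscale.
pose phi := (fun x : R => a * x + b)%R : measurableTypeR R -> measurableTypeR R.
have mphi' : measurable_fun setT phi by exact: mphi.
rewrite -[LHS](@ge0_integral_pushforward _ _ _ _ _ phi mphi' mu setT f)//.
apply: eq_measure_integral => // A mA _.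
by rewrite /= /mscale/= /pushforward lebesgue_measure_affine.
Qed.

End Lebesgue.

(** * Rotation invariance of the planar Gaussian *)

Section Normal.
Context {R : realType}.
Local Open Scope ereal_scope.
Notation mu := (@lebesgue_measure R).
Notation RM := (measurableTypeR R).

Definition std_normal : probability RM R := normal_prob (0 : R) 1.

Notation pdf := (@normal_pdf R 0%R 1%R).

(** The Radon-Nikodym derivative of the normal law equals the density almost everywhere, since both
    have the same integral over every measurable set. *)
Lemma ge0_integral_std_normal (f : RM -> \bar R) : measurable_fun setT f ->
  (forall x, 0 <= f x) -> \int[std_normal]_x f x = \int[mu]_x (f x * (pdf x)%:E).
Proof.
move=> mf f0.
have dom := normal_prob_dominates (0 : R)%R 1%R.
rewrite -(Radon_Nikodym_SigmaFinite.change_of_variables dom)//.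
have mpdf : measurable_fun (setT : set RM) (fun x : RM => (pdf x)%:E).
  by apply/measurable_EFinP; exact: measurable_normal_pdf.
have mrn : measurable_fun (setT : set RM)
    (Radon_Nikodym_SigmaFinite.f (normal_prob (0 : R)%R 1%R) mu).
  exact: (measurable_int mu (Radon_Nikodym_SigmaFinite.f_integrable dom)).
apply: ae_eq_integral => //.
- exact: emeasurable_funM.
- exact: emeasurable_funM.
- apply: ae_eqe_mul2l.
  apply: integral_ae_eq => //=.
    exact: Radon_Nikodym_SigmaFinite.f_integrable.
  by move=> E _ mE; rewrite -Radon_Nikodym_SigmaFinite.f_integral.
Qed.

Lemma std_normal_pdfE x : pdf x = ((Num.sqrt (pi *+ 2))^-1 * expR (- x ^+ 2 / 2))%R.
Proof.
rewrite normal_pdfE ?oner_eq0// /normal_peak /normal_fun subr0 expr1n mul1r.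
by [].
Qed.

Lemma std_normal_pdf_isometry x y u v : (x ^+ 2 + y ^+ 2 = u ^+ 2 + v ^+ 2)%R ->
  (pdf x * pdf y = pdf u * pdf v)%R.
Proof.
move=> H; rewrite !std_normal_pdfE mulrACA [RHS]mulrACA -!expRD; congr (_ * expR _)%R.
by rewrite -!mulrDl -!opprD H.
Qed.

Lemma std_normalN (A : set RM) : measurable A -> std_normal ((-%R : R -> R) @^-1` A) = std_normal A.
Proof.
move=> mA.
have mA' : measurable ((-%R : RM -> RM) @^-1` A).
  rewrite -[X in measurable X]setTI.
  exact: (@oppr_measurable R setT).
have intE (B : set RM) : measurable B -> std_normal B = \int[std_normal]_x (\1_B x)%:E.
  by move=> mB; rewrite (@integral_indic _ _ _ std_normal setT)// setIT.
rewrite (intE _ mA') (intE _ mA).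
have mI (B : set RM) : measurable B -> measurable_fun (setT : set RM) (fun x => (\1_B x)%:E).
  by move=> mB; exact/measurable_EFinP/measurable_indic.
rewrite !ge0_integral_std_normal; last 4 first.
- exact: mI.
- by move=> x; rewrite lee_fin.
- exact: mI.
- by move=> x; rewrite lee_fin.
pose g x := (\1_A x)%:E * (pdf x)%:E.
have n1 : (-1 : R)%R != 0%R by rewrite oppr_eq0 oner_eq0.
have mg : measurable_fun (setT : set RM) g.
  apply: emeasurable_funM; first exact: mI.
  by apply/measurable_EFinP; exact: measurable_normal_pdf.
have g0 x : 0 <= g x by rewrite mule_ge0// lee_fin ?normal_pdf_ge0.
transitivity (\int[mu]_x g (-1 * x + 0)%R).
  apply: eq_integral => x _; rewrite /g mulN1r addr0 !std_normal_pdfE sqrrN.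
  by rewrite !indicE.
rewrite (@ge0_integral_affine R _ 0%R _ n1 mg g0).
by rewrite normrN1 invr1 mul1e.
Qed.

Lemma integral_std_normal_prod (E : set (RM * RM)) : measurable E ->
  (std_normal \x std_normal) E =
  \int[mu]_x \int[mu]_y ((\1_E (x, y) * (pdf x * pdf y))%:E).
Proof.
move=> mE; rewrite /product_measure1 /=.
rewrite ge0_integral_std_normal//; last first.
  exact: (measurable_fun_xsection std_normal).
apply: eq_integral => x _.
have mx : measurable (xsection E x) by exact: measurable_xsection.
have -> : std_normal (xsection E x) = \int[std_normal]_y (\1_(xsection E x) y)%:E.
  by rewrite (@integral_indic _ _ _ std_normal setT)// setIT.
have mi : measurable_fun (setT : set RM) (fun y => (\1_(xsection E x) y)%:E : \bar R).
  by apply/measurable_EFinP; exact: measurable_indic.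
have mp : measurable_fun (setT : set RM) (fun y => (pdf y)%:E).
  by apply/measurable_EFinP; exact: measurable_normal_pdf.
rewrite ge0_integral_std_normal; [|exact: mi|by move=> y; rewrite lee_fin].
rewrite -ge0_integralZr//; last 3 first.
- exact: emeasurable_funM.
- by move=> y _; rewrite mule_ge0// lee_fin ?normal_pdf_ge0.
- by rewrite lee_fin normal_pdf_ge0.
apply: eq_integral => y _; rewrite -!EFinM; congr EFin.
by rewrite !indicE mem_xsection -mulrA [(pdf y * _)%R]mulrC.
Qed.


(** A planar reflection rather than a rotation: on the circle [c ^+ 2 + s ^+ 2 = 1] it is symmetric
    and its own inverse, which makes the later orthogonality checks immediate. *)
Definition refl2 (c s : R) (p : RM * RM) : RM * RM :=
  (c * p.1 + s * p.2, s * p.1 - c * p.2)%R.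

Lemma measurable_refl2 c s : measurable_fun setT (refl2 c s).
Proof.
apply: measurable_fun_pair => /=.
- apply: (@measurable_funD _ (RM * RM)%type R setT (fun p => c * p.1)%R (fun p => s * p.2)%R);
    by apply: measurable_funM.
- apply: (@measurable_funB _ (RM * RM)%type R setT (fun p => s * p.1)%R (fun p => c * p.2)%R);
    by apply: measurable_funM.
Qed.

Lemma tonelli_swap (H : RM -> RM -> R) :
  measurable_fun (setT : set (RM * RM)) (fun p => (H p.1 p.2)%:E) ->
  (forall x u, 0 <= H x u)%R ->
  \int[mu]_x \int[mu]_u (H x u)%:E = \int[mu]_u \int[mu]_x (H x u)%:E.
Proof.
move=> mH H0.
have H0' (p : RM * RM) : 0 <= (H p.1 p.2)%:E by rewrite lee_fin.
exact: (@fubini_tonelli _ _ RM RM R mu mu (fun p => (H p.1 p.2)%:E) mH H0').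
Qed.

(** Two substitutions on the line replace a planar change of variables: [u = c x + s y] at fixed
    [x], then, after Tonelli, [v = s x - c y] at fixed [u]. Their factors [|s|^-1] and [|s|] cancel.
    Both divide by [s], hence [s != 0]. *)
Lemma std_normal_prod_refl2 (c s : R) (E : set (RM * RM)) : (c ^+ 2 + s ^+ 2 = 1)%R ->
  s != 0%R -> measurable E ->
  (std_normal \x std_normal) (refl2 c s @^-1` E) = (std_normal \x std_normal) E.
Proof.
move=> cs s0 mE.
have mE' : measurable (refl2 c s @^-1` E).
  by rewrite -[X in measurable X]setTI; exact: measurable_refl2.
rewrite (integral_std_normal_prod mE') (integral_std_normal_prod mE).
have mK : measurable_fun (setT : set (RM * RM))
    (fun p => \1_E p * (pdf p.1 * pdf p.2) : R)%R.
  apply: measurable_funM; first exact: measurable_indic.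
  apply: measurable_funM.
    apply: measurableT_comp; [exact: measurable_normal_pdf|exact: measurable_fst].
  apply: measurableT_comp; [exact: measurable_normal_pdf|exact: measurable_snd].
pose K (u v : R) := (\1_E (u, v) * (pdf u * pdf v) : R)%R.
have K0 u v : (0 <= K u v)%R by rewrite !mulr_ge0// normal_pdf_ge0.
have mlin (a b : R) : measurable_fun (setT : set (RM * RM)) (fun p => a * p.1 + b * p.2 : R)%R.
  apply: (@measurable_funD _ (RM * RM)%type R setT (fun p => a * p.1)%R (fun p => b * p.2)%R);
    by apply: measurable_funM.
have mKK (a b a' b' : R) : measurable_fun (setT : set (RM * RM))
    (fun p => (K (a * p.1 + b * p.2) (a' * p.1 + b' * p.2))%:E)%R.
  apply/measurable_EFinP.
  apply: (@measurableT_comp _ _ _ _ _ _ _ _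
    (fun p : RM * RM => ((a * p.1 + b * p.2)%R : RM, (a' * p.1 + b' * p.2)%R : RM)) mK).
  apply: measurable_fun_pair; exact: mlin.
(* The integrand in the mixed coordinates [(x, u)]: on the circle, [s x - c y] equals
   [s^-1 x - (c / s) u]. *)
pose H x u := K u (s^-1 * x + (- c / s) * u)%R.
have mH : measurable_fun (setT : set (RM * RM)) (fun p => (H p.1 p.2)%:E).
  have := mKK 0%R 1%R (s^-1)%R (- c / s)%R.
  by apply: eq_measurable_fun => p _; rewrite /H mul0r add0r mul1r.
have sn0 : (`|s| != 0)%R by rewrite normr_eq0.
transitivity (\int[mu]_x ((`|s|^-1)%:E * \int[mu]_u (H x u)%:E)).
  apply: eq_integral => x _.
  have mHx : measurable_fun (setT : set RM) (fun u => (H x u)%:E).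
    exact: (measurableT_comp mH (measurable_pair1 (x : RM))).
  have Hx0 u : 0 <= (H x u)%:E by rewrite lee_fin K0.
  rewrite -(@ge0_integral_affine R s (c * x)%R _ s0 mHx Hx0).
  apply: eq_integral => y _; congr EFin.
  have -> : (\1_(refl2 c s @^-1` E) (x, y) = \1_E (refl2 c s (x, y)) :> R)%R.
    by rewrite !indicE.
  rewrite /H /K.
  have -> : (s^-1 * x + - c / s * (s * y + c * x) = s * x - c * y)%R.
    have -> : (s^-1 * x = s^-1 * (c ^+ 2 + s ^+ 2) * x)%R by rewrite cs mulr1.
    by field.
  rewrite /refl2/= [(s * y + _)%R]addrC; congr (_ * _)%R.
  apply: std_normal_pdf_isometry.
  have -> : (x ^+ 2 + y ^+ 2 = (c ^+ 2 + s ^+ 2) * (x ^+ 2 + y ^+ 2))%R by rewrite cs mul1r.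
  ring.
have H0 (p : RM * RM) : 0 <= (H p.1 p.2)%:E by rewrite lee_fin K0.
have sV0 : 0 <= (`|s|^-1)%:E :> \bar R by rewrite lee_fin invr_ge0.
have mF : measurable_fun (setT : set RM) (fun x => \int[mu]_u (H x u)%:E).
  have F1 := @measurable_fun_fubini_tonelli_F _ _ RM RM R mu _ mH H0.
  exact F1.
have mG : measurable_fun (setT : set RM) (fun u => \int[mu]_x (H x u)%:E).
  have G1 := @measurable_fun_fubini_tonelli_G _ _ RM RM R mu _ mH H0.
  exact G1.
have F0 x : setT x -> 0 <= \int[mu]_u (H x u)%:E.
  by move=> _; apply: integral_ge0 => u _; rewrite lee_fin K0.
have G0 u : setT u -> 0 <= \int[mu]_x (H x u)%:E.
  by move=> _; apply: integral_ge0 => x _; rewrite lee_fin K0.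
rewrite (ge0_integralZl mu measurableT mF F0 sV0).
rewrite (tonelli_swap mH (fun x u => K0 _ _)).
rewrite -(ge0_integralZl mu measurableT mG G0 sV0).
apply: eq_integral => u _.
have sV : (s^-1 != 0)%R by rewrite invr_eq0.
have mKu : measurable_fun (setT : set RM) (fun v => (K u v)%:E).
  have := measurableT_comp (mKK 1 0 0 1)%R (measurable_pair1 (u : RM)).
  by apply: eq_measurable_fun => v _ /=; rewrite !mul0r !mul1r add0r addr0.
have K0' v : 0 <= (K u v)%:E by rewrite lee_fin K0.
have -> : \int[mu]_x (H x u)%:E = (`|s^-1|^-1)%:E * \int[mu]_v (K u v)%:E.
  exact: (@ge0_integral_affine R s^-1 (- c / s * u)%R _ sV mKu K0').
have E1 : (`|s|^-1 * `|s^-1|^-1 = 1 :> R)%R by rewrite normfV invrK mulVf.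
by rewrite muleA -EFinM E1 mul1e.
Qed.

End Normal.

(** * Gaussian matrices *)

Definition pushforward_prob d d' (T : measurableType d) (T' : measurableType d') (R : realType)
  (P : probability T R) (f : T -> T') (mf : measurable_fun setT f) :
  probability T' R := distribution P (mfun_Sub (mem_set mf)).

Lemma pushforward_probE d d' (T : measurableType d) (T' : measurableType d') (R : realType)
  (P : probability T R) (f : T -> T') (mf : measurable_fun setT f) (A : set T') :
  pushforward_prob P mf A = P (f @^-1` A).
Proof. by []. Qed.

Section MatrixSpace.
Context {R : realType}.
Notation RM := (measurableTypeR R).

(** For square shapes this generates the sigma-algebra underlying [mxSpace], so that maps built on
    rectangular matrices can land in the input space. *)
Definition rmx_gen p q : set (set 'M[R]_(p, q)) :=
  [set S | exists (i : 'I_p) (j : 'I_q) (B : set RM),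
     measurable B /\ S = (fun M : 'M[R]_(p, q) => M i j) @^-1` B].

Definition mxMeas p q : measurableType _ := @g_sigma_algebraType 'M[R]_(p, q) (@rmx_gen p q).

Lemma measurable_entry p q i j :
  measurable_fun setT (fun M : mxMeas p q => (M : 'M[R]_(p, q)) i j : RM).
Proof.
move=> _ B mB; rewrite setTI; apply: sub_sigma_algebra.
by exists i, j, B.
Qed.

Lemma measurable_to_mx p q d (T : measurableType d) (f : T -> mxMeas p q) :
  (forall i j, measurable_fun setT (fun x => (f x : 'M[R]_(p, q)) i j : RM)) ->
  measurable_fun setT f.
Proof.
move=> mf; apply: (@measurability _ _ T (mxMeas p q) setT f (@rmx_gen p q) erefl).
by move=> _ [_ [i [j [B [mB ->]]]] <-]; exact: (mf i j).
Qed.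

Definition mxbox p q (B : 'I_p -> 'I_q -> set RM) : set (mxMeas p q) :=
  [set M | forall i j, B i j ((M : 'M[R]_(p, q)) i j)].

Lemma measurable_mxbox p q (B : 'I_p -> 'I_q -> set RM) :
  (forall i j, measurable (B i j)) -> measurable (mxbox B).
Proof.
move=> mB.
rewrite (_ : mxbox B = \bigcap_(k in [set: 'I_p * 'I_q])
    ((fun M : mxMeas p q => (M : 'M[R]_(p, q)) k.1 k.2 : RM) @^-1` B k.1 k.2)); last first.
  apply/seteqP; split => [M MB [i j] _|M MB i j]; first exact: MB.
  exact: (MB (i, j) I).
apply: fin_bigcap_measurable => [|k _]; first exact: finite_finset.
rewrite -[X in measurable X]setTI.
exact: (measurable_entry k.1 k.2 measurableT (mB _ _)).
Qed.

(** Boxes form a generating pi-system. Identities between Gaussian laws are thereby reduced to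
    comparing products over entries. *)
Lemma mxMeas_measure_unique p q (m1 m2 : probability (mxMeas p q) R) :
  (forall B : 'I_p -> 'I_q -> set RM, (forall i j, measurable (B i j)) ->
    m1 (mxbox B) = m2 (mxbox B)) ->
  forall A, measurable A -> m1 A = m2 A.
Proof.
move=> m12.
pose G : set (set (mxMeas p q)) :=
  [set S | exists B : 'I_p -> 'I_q -> set RM, (forall i j, measurable (B i j)) /\ S = mxbox B].
have GT : G setT.
  by exists (fun _ _ => setT); split => //; apply/seteqP; split.
apply: (measure_unique G (fun=> setT)) => //.
- apply/seteqP; split.
    apply: smallest_sub; first exact: smallest_sigma_algebra.
    move=> _ [i [j [B [mB ->]]]]; apply: sub_sigma_algebra.
    exists (fun i' j' => if (i' == i) && (j' == j) then B else setT); split.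
      by move=> i' j'; case: ifP.
    apply/seteqP; split => [M MB i' j'|M /(_ i j)] /=; last by rewrite !eqxx.
    by case: ifP => // /andP[/eqP -> /eqP ->].
  apply: smallest_sub; first exact: sigma_algebra_measurable.
  by move=> _ [B [mB ->]]; exact: measurable_mxbox.
- move=> _ _ [B [mB ->]] [C [mC ->]]; exists (fun i j => B i j `&` C i j); split.
    by move=> i j; exact: measurableI.
  apply/seteqP; split => [M [MB MC] i j|M MBC]; first by split; [exact: MB|exact: MC].
  by split => i j; have [] := MBC i j.
- by apply/seteqP; split => // x _; exists 0%N.
- by move=> _ [B [mB ->]]; exact: m12.
- by move=> _; apply: le_lt_trans (ltry 1); exact: probability_le1.
Qed.

Lemma measurable_sumR d (T : measurableType d) (I : Type) (s : seq I) (P : pred I) (f : I -> T -> R) :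
  (forall i, P i -> measurable_fun setT (f i)) ->
  measurable_fun setT (fun x => \sum_(i <- s | P i) f i x).
Proof.
move=> mf; elim: s => [|i s IH].
  by under eq_fun do rewrite big_nil; exact: measurable_cst.
under eq_fun do rewrite big_cons.
case: (boolP (P i)) => // Pi.
by apply: measurable_funD => //; exact: mf.
Qed.

Definition consmx N (p : RM * mxMeas 1 N) : mxMeas 1 N.+1 :=
  row_mx (const_mx p.1 : 'M[R]_(1, 1)) (p.2 : 'M[R]_(1, N)).

Lemma consmx0 N (p : RM * mxMeas 1 N) i : (consmx p : 'M[R]_(1, N.+1)) i ord0 = p.1.
Proof.
rewrite (_ : ord0 = lshift N (ord0 : 'I_1)); last exact/val_inj.
by rewrite [LHS](@row_mxEl R 1 1 N) mxE.
Qed.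

Lemma consmxS N (p : RM * mxMeas 1 N) i j :
  (consmx p : 'M[R]_(1, N.+1)) i (lift ord0 j) = (p.2 : 'M[R]_(1, N)) i j.
Proof.
rewrite (_ : lift ord0 j = rshift 1 j); last exact/val_inj.
exact: (@row_mxEr R 1 1 N).
Qed.

Lemma measurable_consmx N : measurable_fun setT (@consmx N).
Proof.
apply: measurable_to_mx => i j.
case: (unliftP ord0 j) => [k|] ->.
  under eq_fun do rewrite consmxS.
  exact: (measurableT_comp (measurable_entry i k) measurable_snd).
under eq_fun do rewrite consmx0.
exact: measurable_fst.
Qed.

(** Iterated binary product measure; the recursion starts from width 0, where the matrix space is a
    single point. *)
Fixpoint gauss_row N : probability (mxMeas 1 N) R :=
  match N with
  | 0 => dirac ((0 : 'M[R]_(1, 0)) : mxMeas 1 0)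
  | N'.+1 => pushforward_prob (@std_normal R \x gauss_row N')%E (@measurable_consmx N')
  end.

Lemma gauss_row_box N (B : 'I_1 -> 'I_N -> set RM) : (forall i j, measurable (B i j)) ->
  gauss_row N (mxbox B) = (\prod_(j < N) std_normal (B ord0 j))%E.
Proof.
elim: N B => [|N IH] B mB.
  rewrite big_ord0 /= diracE mem_set//.
  by move=> i [].
have -> : gauss_row N.+1 (mxbox B) = (@std_normal R \x gauss_row N)%E (@consmx N @^-1` mxbox B) by [].
rewrite (_ : _ @^-1` _ = B ord0 ord0 `*` mxbox (fun i j => B i (lift ord0 j))).
  rewrite product_measure1E//; last by apply: measurable_mxbox.
  rewrite big_ord_recl; congr (_ * _)%E.
  exact: (IH (fun i j => B i (lift ord0 j))).
apply/seteqP; split => [[x M] /= H|[x M] [/= Bx BM] i j].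
  split => [|i j] /=; first by have := H ord0 ord0; rewrite consmx0.
  by have := H i (lift ord0 j); rewrite consmxS.
case: (unliftP ord0 j) => [k|] ->; first by rewrite consmxS; exact: BM.
by rewrite consmx0 (ord1 i).
Qed.

Lemma measurable_vec_mx p q : measurable_fun setT (vec_mx : mxMeas 1 (p * q) -> mxMeas p q).
Proof.
apply: measurable_to_mx => i j; under eq_fun do rewrite mxE.
exact: measurable_entry.
Qed.

Definition gauss_mx p q : probability (mxMeas p q) R := pushforward_prob (gauss_row (p * q)) (@measurable_vec_mx p q).

Lemma gauss_mx_box p q (B : 'I_p -> 'I_q -> set RM) : (forall i j, measurable (B i j)) ->
  gauss_mx p q (mxbox B) = (\prod_(i < p) \prod_(j < q) std_normal (B i j))%E.
Proof.
move=> mB; rewrite /gauss_mx pushforward_probE.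
(* [C] inverts [mxvec_index]: it sends a flat position back to its row and column. *)
pose C (k : 'I_(p * q)) : 'I_p * 'I_q := enum_val (cast_ord (esym (mxvec_cast p q)) k).
have CK i j : C (mxvec_index i j) = (i, j).
  by rewrite /C /mxvec_index cast_ordK enum_rankK.
rewrite (_ : _ @^-1` _ = mxbox (fun _ : 'I_1 => fun k => B (C k).1 (C k).2)).
  rewrite gauss_row_box; last by move=> *; exact: mB.
  rewrite pair_big /=.
  rewrite (reindex (uncurry (@mxvec_index p q))) /=.
    by apply: eq_bigr => -[i j] _ /=; rewrite CK.
  exact: curry_mxvec_bij.
apply/seteqP; split => [v /= H i k|v /= H i j].
  have /= := H (C k).1 (C k).2; rewrite mxE (ord1 i).
  case/mxvec_indexP: k => i0 j0; by rewrite CK.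
have := H ord0 (mxvec_index i j); by rewrite CK/= mxE.
Qed.

End MatrixSpace.

Section ProductInvariance.
Context {R : realType} d1 d2 (T1 : measurableType d1) (T2 : measurableType d2).
Context (P1 : probability T1 R) (P2 : probability T2 R).

Lemma product_map_invariant (f1 : T1 -> T1) (f2 : T2 -> T2) :
  measurable_fun setT f1 -> measurable_fun setT f2 ->
  (forall A, measurable A -> P1 (f1 @^-1` A) = P1 A) ->
  (forall A, measurable A -> P2 (f2 @^-1` A) = P2 A) ->
  forall E, measurable E ->
  (P1 \x P2)%E ((fun x => (f1 x.1, f2 x.2)) @^-1` E) = (P1 \x P2)%E E.
Proof.
move=> mf1 mf2 i1 i2 E mE.
have mf : measurable_fun setT (fun x : T1 * T2 => (f1 x.1, f2 x.2)).
  apply: measurable_fun_pair.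
    exact: (measurableT_comp mf1 measurable_fst).
  exact: (measurableT_comp mf2 measurable_snd).
rewrite -(pushforward_probE (P1 \x P2)%E mf E).
apply/esym; apply: product_measure_unique => // A B mA mB.
transitivity ((P1 \x P2)%E ((f1 @^-1` A) `*` (f2 @^-1` B))) => //.
rewrite product_measure1E.
- by congr (_ * _)%E; [exact: i1|exact: i2].
- by rewrite -[X in measurable X]setTI; exact: mf1.
- by rewrite -[X in measurable X]setTI; exact: mf2.
Qed.

End ProductInvariance.

Section GaussianMatrices.
Context {R : realType}.
Notation RM := (measurableTypeR R).
Notation mxMeas := (@mxMeas R).
Notation gauss_mx := (@gauss_mx R).

Section MeasurableMx.
Context d (T : measurableType d).

Lemma measurable_cst_mx p q (B : 'M[R]_(p, q)) : measurable_fun setT (fun _ : T => B : mxMeas p q).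
Proof. exact: measurable_cst. Qed.

Lemma measurable_mx_entry p q (f : T -> mxMeas p q) i j : measurable_fun setT f ->
  measurable_fun setT (fun x => (f x : 'M[R]_(p, q)) i j : RM).
Proof. by move=> mf; exact: (measurableT_comp (measurable_entry i j) mf). Qed.

Lemma measurable_addmx p q (f g : T -> mxMeas p q) :
  measurable_fun setT f -> measurable_fun setT g ->
  measurable_fun setT (fun x => (f x : 'M[R]_(p, q)) + (g x : 'M[R]_(p, q)) : mxMeas p q).
Proof.
move=> mf mg; apply: measurable_to_mx => i j; under eq_fun do rewrite mxE.
by apply: measurable_funD; exact: measurable_mx_entry.
Qed.

Lemma measurable_mulmx p q r (f : T -> mxMeas p q) (g : T -> mxMeas q r) :
  measurable_fun setT f -> measurable_fun setT g ->
  measurable_fun setT (fun x => (f x : 'M[R]_(p, q)) *m (g x : 'M[R]_(q, r)) : mxMeas p r).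
Proof.
move=> mf mg; apply: measurable_to_mx => i j; under eq_fun do rewrite mxE.
apply: measurable_sumR => k _.
by apply: measurable_funM; exact: measurable_mx_entry.
Qed.

Lemma measurable_trmx p q (f : T -> mxMeas p q) : measurable_fun setT f ->
  measurable_fun setT (fun x => (f x : 'M[R]_(p, q))^T : mxMeas q p).
Proof.
move=> mf; apply: measurable_to_mx => i j; under eq_fun do rewrite mxE.
exact: measurable_mx_entry.
Qed.

Lemma measurable_col_mx p1 p2 q (f : T -> mxMeas p1 q) (g : T -> mxMeas p2 q) :
  measurable_fun setT f -> measurable_fun setT g ->
  measurable_fun setT (fun x => col_mx (f x : 'M[R]_(p1, q)) (g x : 'M[R]_(p2, q)) : mxMeas (p1 + p2) q).
Proof.
move=> mf mg; apply: measurable_to_mx => i j; case: (split_ordP i) => k ->.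
  by under eq_fun do rewrite col_mxEu; exact: measurable_mx_entry.
by under eq_fun do rewrite col_mxEd; exact: measurable_mx_entry.
Qed.

Lemma measurable_row_mx p q1 q2 (f : T -> mxMeas p q1) (g : T -> mxMeas p q2) :
  measurable_fun setT f -> measurable_fun setT g ->
  measurable_fun setT (fun x => row_mx (f x : 'M[R]_(p, q1)) (g x : 'M[R]_(p, q2)) : mxMeas p (q1 + q2)).
Proof.
move=> mf mg; apply: measurable_to_mx => i j; case: (split_ordP j) => k ->.
  by under eq_fun do rewrite row_mxEl; exact: measurable_mx_entry.
by under eq_fun do rewrite row_mxEr; exact: measurable_mx_entry.
Qed.

End MeasurableMx.

Lemma measurable_mulmxl p q r (O : 'M[R]_(p, q)) :
  measurable_fun setT (fun G : mxMeas q r => O *m (G : 'M[R]_(q, r)) : mxMeas p r).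
Proof. by apply: measurable_mulmx; [exact: measurable_cst_mx|exact: measurable_id]. Qed.

Lemma measurable_mxpreimage d (T : measurableType d) p q (f : T -> mxMeas p q) A :
  measurable_fun setT f -> measurable A -> measurable (f @^-1` A).
Proof. by move=> mf mA; rewrite -[X in measurable X]setTI; exact: mf. Qed.

Lemma gauss_mx_trmx p q (A : set (mxMeas q p)) : measurable A ->
  gauss_mx p q ((fun G => (G : 'M[R]_(p, q))^T) @^-1` A) = gauss_mx q p A.
Proof.
move=> mA; have mt := measurable_trmx (@measurable_id _ (mxMeas p q) setT).
rewrite -(pushforward_probE (gauss_mx p q) mt A); apply: mxMeas_measure_unique => // B mB.
rewrite pushforward_probE (_ : _ @^-1` _ = mxbox (fun i j => B j i)); last first.
  apply/seteqP; split => [G /= H i j|G /= H i j]; first by have := H j i; rewrite mxE.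
  by rewrite mxE; exact: H.
by rewrite !gauss_mx_box// exchange_big.
Qed.

Lemma gauss_mx_col_mx p1 p2 q (A : set (mxMeas (p1 + p2) q)) : measurable A ->
  (gauss_mx p1 q \x gauss_mx p2 q)%E
    ((fun x => col_mx (x.1 : 'M[R]_(p1, q)) (x.2 : 'M[R]_(p2, q))) @^-1` A) =
  gauss_mx (p1 + p2) q A.
Proof.
move=> mA.
have mt := measurable_col_mx (@measurable_fst _ _ (mxMeas p1 q) (mxMeas p2 q))
  (@measurable_snd _ _ (mxMeas p1 q) (mxMeas p2 q)).
rewrite -(pushforward_probE (gauss_mx p1 q \x gauss_mx p2 q)%E mt A); apply: mxMeas_measure_unique => // B mB.
rewrite pushforward_probE (_ : _ @^-1` _ = mxbox (fun i j => B (lshift p2 i) j) `*`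
  mxbox (fun i j => B (rshift p1 i) j)); last first.
  apply/seteqP; split => [[G H] /= HB|[G H] /= [HG HH] i j].
    split => i j; first by have := HB (lshift p2 i) j; rewrite col_mxEu.
    by have := HB (rshift p1 i) j; rewrite col_mxEd.
  by case: (split_ordP i) => k ->; rewrite ?col_mxEu ?col_mxEd.
etransitivity; first by apply: product_measure1E; exact: measurable_mxbox.
by rewrite [RHS]gauss_mx_box// [RHS]big_split_ord/=; congr (_ * _)%E; exact: gauss_mx_box.
Qed.

Lemma gauss_mx_row_mx p q1 q2 (A : set (mxMeas p (q1 + q2))) : measurable A ->
  (gauss_mx p q1 \x gauss_mx p q2)%E
    ((fun x => row_mx (x.1 : 'M[R]_(p, q1)) (x.2 : 'M[R]_(p, q2))) @^-1` A) =
  gauss_mx p (q1 + q2) A.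
Proof.
move=> mA.
have mt := measurable_row_mx (@measurable_fst _ _ (mxMeas p q1) (mxMeas p q2))
  (@measurable_snd _ _ (mxMeas p q1) (mxMeas p q2)).
rewrite -(pushforward_probE (gauss_mx p q1 \x gauss_mx p q2)%E mt A); apply: mxMeas_measure_unique => // B mB.
rewrite pushforward_probE (_ : _ @^-1` _ = mxbox (fun i j => B i (lshift q2 j)) `*`
  mxbox (fun i j => B i (rshift q1 j))); last first.
  apply/seteqP; split => [[G H] /= HB|[G H] /= [HG HH] i j].
    split => i j; first by have := HB i (lshift q2 j); rewrite row_mxEl.
    by have := HB i (rshift q1 j); rewrite row_mxEr.
  by case: (split_ordP j) => k ->; rewrite ?row_mxEl ?row_mxEr.
etransitivity; first by apply: product_measure1E; exact: measurable_mxbox.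
rewrite [RHS]gauss_mx_box// [RHS](eq_bigr (fun i => (\prod_(j < q1) std_normal (B i (lshift q2 j)) *
  \prod_(j < q2) std_normal (B i (rshift q1 j)))%E)); last by move=> i _; rewrite big_split_ord.
by rewrite [RHS]big_split /=; congr (_ * _)%E; exact: gauss_mx_box.
Qed.

Definition gauss_inv p (O : 'M[R]_p) := forall q (A : set (mxMeas p q)), measurable A ->
  gauss_mx p q ((fun G => O *m (G : 'M[R]_(p, q))) @^-1` A) = gauss_mx p q A.

Lemma gauss_inv1 p : gauss_inv (1%:M : 'M[R]_p).
Proof.
move=> q A mA; congr (gauss_mx p q _).
by apply/seteqP; split => G /=; rewrite mul1mx.
Qed.

Lemma gauss_inv_mul p (O1 O2 : 'M[R]_p) : gauss_inv O1 -> gauss_inv O2 -> gauss_inv (O1 *m O2).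
Proof.
move=> i1 i2 q A mA.
rewrite -(i1 q A mA) -(i2 q ((fun G => O1 *m (G : 'M[R]_(p, q))) @^-1` A)); last first.
  exact: (measurable_mxpreimage (measurable_mulmxl _) mA).
congr (gauss_mx p q _).
by apply/seteqP; split => G /=; rewrite mulmxA.
Qed.

Lemma gauss_inv_inverse p (O1 O2 : 'M[R]_p) : O2 *m O1 = 1%:M -> gauss_inv O1 -> gauss_inv O2.
Proof.
move=> O21 i1 q A mA.
rewrite -(i1 q (_ @^-1` A)); last first.
  exact: (measurable_mxpreimage (measurable_mulmxl _) mA).
congr (gauss_mx p q _).
by apply/seteqP; split => G /=; rewrite mulmxA O21 mul1mx.
Qed.

(** The columns are independent and [O] acts on each of them separately, so invariance propagates
    one column at a time. *)
Lemma gauss_inv_col p (O : 'M[R]_p) :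
  (forall (A : set (mxMeas p 1)), measurable A ->
    gauss_mx p 1 ((fun G => O *m (G : 'M[R]_(p, 1))) @^-1` A) = gauss_mx p 1 A) -> gauss_inv O.
Proof.
move=> i1; elim=> [|q IH] A mA.
  have E G : O *m (G : 'M[R]_(p, 0)) = G by rewrite [LHS]thinmx0 [RHS]thinmx0.
  by congr (gauss_mx p 0 _); apply/seteqP; split => G /=; rewrite E.
have mA' := measurable_mxpreimage (measurable_mulmxl (r := 1 + q) O) mA.
rewrite -(@gauss_mx_row_mx p 1 q _ mA) -[LHS](@gauss_mx_row_mx p 1 q _ mA').
rewrite -[RHS](product_map_invariant (measurable_mulmxl O) (measurable_mulmxl O) i1 IH).
  congr (product_measure1 _ _ _); apply/seteqP; split => -[G1 G2] /=;
  by rewrite mul_mx_row.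
apply: measurable_mxpreimage mA.
exact: (measurable_row_mx (@measurable_fst _ _ (mxMeas p 1) (mxMeas p q))
  (@measurable_snd _ _ (mxMeas p 1) (mxMeas p q))).
Qed.

Lemma gauss_inv_block p1 p2 (O1 : 'M[R]_p1) (O2 : 'M[R]_p2) :
  gauss_inv O1 -> gauss_inv O2 -> gauss_inv (block_mx O1 0 0 O2).
Proof.
move=> i1 i2 q A mA.
have mA' := measurable_mxpreimage (measurable_mulmxl (r := q) (block_mx O1 0 0 O2)) mA.
rewrite -(gauss_mx_col_mx mA) -[LHS](gauss_mx_col_mx mA').
rewrite -[RHS](product_map_invariant (measurable_mulmxl O1) (measurable_mulmxl O2) (i1 q) (i2 q)).
  congr (product_measure1 _ _ _); apply/seteqP; split => -[G1 G2] /=;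
  by rewrite mul_block_col !mul0mx addr0 add0r.
apply: measurable_mxpreimage mA.
exact: (measurable_col_mx (@measurable_fst _ _ (mxMeas p1 q) (mxMeas p2 q))
  (@measurable_snd _ _ (mxMeas p1 q) (mxMeas p2 q))).
Qed.

End GaussianMatrices.

(** * Reflections preserve the Gaussian law *)

Section Orthogonal.
Context {R : realType}.
Notation RM := (measurableTypeR R).
Notation mxMeas := (@mxMeas R).
Notation gauss_mx := (@gauss_mx R).

Definition cmx1 (x : RM) : mxMeas 1 1 := const_mx x : 'M[R]_(1, 1).

Definition cmx2 (x : RM * RM) : mxMeas (1 + 1) 1 :=
  col_mx (const_mx x.1 : 'M[R]_(1, 1)) (const_mx x.2 : 'M[R]_(1, 1)).

Lemma measurable_cmx1 : measurable_fun setT cmx1.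
Proof.
apply: measurable_to_mx => i j; under eq_fun do rewrite mxE.
exact: measurable_id.
Qed.

Lemma measurable_cmx2 : measurable_fun setT cmx2.
Proof.
apply: (@measurable_col_mx _ _ _ 1 1 1).
  exact: (measurableT_comp measurable_cmx1 measurable_fst).
exact: (measurableT_comp measurable_cmx1 measurable_snd).
Qed.

Lemma gauss_mx11 (A : set (mxMeas 1 1)) : measurable A -> gauss_mx 1 1 A = std_normal (cmx1 @^-1` A).
Proof.
move=> mA; rewrite -(pushforward_probE _ measurable_cmx1); apply: mxMeas_measure_unique => // B mB.
rewrite gauss_mx_box// !big_ord1 pushforward_probE; congr (std_normal _).
apply/seteqP; split => [x /= Bx i j|x /= /(_ ord0 ord0)]; last by rewrite /cmx1 mxE.
by rewrite /cmx1 mxE (ord1 i) (ord1 j).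
Qed.

Lemma gauss_mx21 (A : set (mxMeas (1 + 1) 1)) : measurable A ->
  gauss_mx (1 + 1) 1 A = (@std_normal R \x @std_normal R)%E (cmx2 @^-1` A).
Proof.
move=> mA.
apply: (@mxMeas_measure_unique _ _ _ _ (pushforward_prob (@std_normal R \x @std_normal R)%E measurable_cmx2)); last exact: mA.
move=> B mB; etransitivity; first exact: gauss_mx_box.
transitivity ((@std_normal R \x @std_normal R)%E (cmx2 @^-1` (mxbox B))); last by [].
rewrite (_ : _ @^-1` _ = B (lshift 1 ord0) ord0 `*` B (rshift 1 ord0) ord0).
  etransitivity; last by apply/esym; apply: product_measure1E.
  rewrite big_split_ord (big_ord1 _ (fun i => _)) (big_ord1 _ (fun i => _)).
  by rewrite !big_ord1.
apply/seteqP; split => [[x y] /= H|[x y] /= [Bx By] i j].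
  split.
    by have := H (lshift 1 ord0) ord0; rewrite /cmx2 col_mxEu mxE.
  by have := H (rshift 1 ord0) ord0; rewrite /cmx2 col_mxEd mxE.
rewrite /cmx2 (ord1 j); case: (split_ordP i) => k ->.
  by rewrite col_mxEu mxE (ord1 k).
by rewrite col_mxEd mxE (ord1 k).
Qed.

Lemma gauss_invN1 : gauss_inv ((-1)%:M : 'M[R]_1).
Proof.
apply: gauss_inv_col => A mA.
have mA' := measurable_mxpreimage (measurable_mulmxl (r := 1) ((-1)%:M : 'M[R]_1)) mA.
rewrite [LHS](gauss_mx11 mA') (gauss_mx11 mA) -[RHS]std_normalN; last first.
  exact: (measurable_mxpreimage measurable_cmx1 mA).
congr (std_normal _); have E (x : R) : (-1)%:M *m (const_mx x : 'M[R]_(1,1)) = const_mx (- x).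
  by apply/matrixP => i j; rewrite mul_scalar_mx !mxE mulN1r.
by apply/seteqP; split => x /=; rewrite /cmx1 E.
Qed.

Definition refl2_mx (c s : R) : 'M[R]_(1 + 1) :=
  block_mx c%:M s%:M s%:M (- c)%:M.

Lemma refl2_mxE c s (x : R * R) : refl2_mx c s *m cmx2 x = cmx2 (refl2 c s x).
Proof.
case: x => x y; rewrite /cmx2 mul_block_col !mul_scalar_mx.
by congr col_mx; apply/matrixP => i j; rewrite !mxE/= ?mulNr.
Qed.

Lemma gauss_inv_refl2 c s : c ^+ 2 + s ^+ 2 = 1 -> s != 0 -> gauss_inv (refl2_mx c s).
Proof.
move=> cs s0; apply: gauss_inv_col => A mA.
have mA' := measurable_mxpreimage (measurable_mulmxl (r := 1) (refl2_mx c s)) mA.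
rewrite [LHS](gauss_mx21 mA') (gauss_mx21 mA) -[RHS](std_normal_prod_refl2 cs s0); last first.
  exact: (measurable_mxpreimage measurable_cmx2 mA).
congr (product_measure1 _ _ _).
by apply/seteqP; split => x /=; rewrite refl2_mxE.
Qed.

Lemma refl2_mxK c s : c ^+ 2 + s ^+ 2 = 1 -> refl2_mx c s *m refl2_mx c s = 1%:M.
Proof.
move=> cs; rewrite /refl2_mx mulmx_block !mul_scalar_mx !scale_scalar_mx -!raddfD /=.
have -> : c * c + s * s = 1 by rewrite -cs; ring.
have -> : c * s + s * - c = 0 by ring.
have -> : s * c + - c * s = 0 by ring.
have -> : s * s + - c * - c = 1 by rewrite -cs; ring.
by rewrite (scalar_mx_block 1 1 1) raddf0.
Qed.

Lemma refl2_mx_tr c s : (refl2_mx c s)^T = refl2_mx c s.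
Proof. by rewrite /refl2_mx tr_block_mx !tr_scalar_mx. Qed.

(** Induction on the dimension: the tail of [u] is first turned onto its own axis, then a reflection
    of the first two coordinates absorbs the entry that is left. *)
Lemma gauss_inv_rotate_to_axis p (u : 'cV[R]_(1 + p)) : exists O : 'M[R]_(1 + p),
  [/\ gauss_inv O, O^T *m O = 1%:M, O *m O^T = 1%:M &
      exists c : R, O *m u = col_mx c%:M 0].
Proof.
elim: p u => [|p IH] u.
  exists 1%:M; split; rewrite ?trmx1 ?mulmx1//; first exact: gauss_inv1.
  exists (u ord0 ord0); rewrite mul1mx; apply/colP => i.
  case: (split_ordP i) => k -> ; last by case: k.
  by rewrite col_mxEu mxE (ord1 k)/=; congr (u _ _); exact/val_inj.
rewrite -(vsubmxK u); set a := usubmx u; set v := dsubmx u.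
have [Q [iQ OO1 OO2 [c' Oc]]] := IH v.
pose O1 : 'M[R]_(1 + (1 + p)) := block_mx 1%:M 0 0 Q.
have iO1 : gauss_inv O1 by apply: gauss_inv_block => //; exact: gauss_inv1.
have O11 : O1^T *m O1 = 1%:M.
  by rewrite /O1 tr_block_mx mulmx_block !trmx0 trmx1 OO1 !mul0mx !mulmx0 mulmx1 !addr0 add0r -scalar_mx_block.
have O12 : O1 *m O1^T = 1%:M.
  by rewrite /O1 tr_block_mx mulmx_block !trmx0 trmx1 OO2 !mul0mx !mulmx0 mulmx1 !addr0 add0r -scalar_mx_block.
have O1u : O1 *m col_mx a v = col_mx a (col_mx c'%:M 0).
  by rewrite /O1 mul_block_col !mul0mx mul1mx Oc addr0 add0r.
pose x := a ord0 ord0.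
have aE : a = x%:M by apply/matrixP => i j; rewrite (ord1 i) (ord1 j) [RHS]mxE eqxx mulr1n.
(* If [c' = 0] the vector already lies on the axis; this is also the case in which [gauss_inv_refl2]
   does not apply, its coefficient [c' / r] being zero. *)
have [c0|c0] := eqVneq c' 0.
  exists O1; split => //; exists x.
  by rewrite O1u c0 aE raddf0 col_mx0.
pose r := Num.sqrt (x ^+ 2 + c' ^+ 2).
have r2 : r ^+ 2 = x ^+ 2 + c' ^+ 2 by rewrite sqr_sqrtr// addr_ge0// sqr_ge0.
have r0 : r != 0.
  rewrite gt_eqF// sqrtr_gt0 ltr_wpDl ?sqr_ge0//.
  by rewrite lt_neqAle sqr_ge0 eq_sym sqrf_eq0 c0.
have cs : (x / r) ^+ 2 + (c' / r) ^+ 2 = 1.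
  by rewrite !expr_div_n -mulrDl -r2 divff// expf_neq0.
have s0 : c' / r != 0 by rewrite mulf_neq0// invr_neq0.
pose O2 : 'M[R]_((1 + 1) + p) := block_mx (refl2_mx (x / r) (c' / r)) 0 0 1%:M.
have iO2 : gauss_inv O2 by apply: gauss_inv_block; [exact: gauss_inv_refl2|exact: gauss_inv1].
have O2T : O2^T = O2 by rewrite /O2 tr_block_mx refl2_mx_tr !trmx0 trmx1.
have O2K : O2 *m O2 = 1%:M.
  by rewrite /O2 mulmx_block refl2_mxK// !mul0mx !mulmx0 mulmx1 !addr0 add0r -scalar_mx_block.
exists ((O2 : 'M[R]_(1 + (1 + p))) *m O1); split.
- exact: gauss_inv_mul.
- rewrite trmx_mul -mulmxA (mulmxA (O2^T)).
  by have -> : O2^T *m O2 = 1%:M; rewrite ?O2T// mul1mx.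
- rewrite trmx_mul mulmxA -(mulmxA _ O1) O12 mulmx1.
  by have -> : O2 *m O2^T = 1%:M by rewrite O2T.
exists r; rewrite -mulmxA O1u aE.
have assoc (X Y : 'cV[R]_1) (Z : 'cV[R]_p) :
    col_mx X (col_mx Y Z) = col_mx (col_mx X Y) Z :> 'cV[R]_(1 + 1 + p).
  by rewrite col_mxA castmx_id.
have EX (t : R) : const_mx t = t%:M :> 'M[R]_1.
  by apply/matrixP => i j; rewrite (ord1 i) (ord1 j) !mxE eqxx mulr1n.
transitivity (O2 *m col_mx (cmx2 (x, c')) 0 : 'cV[R]_(1 + 1 + p)).
  by congr (_ *m _); rewrite /cmx2 !EX -assoc.
rewrite mul_block_col !mul0mx !mulmx0 !addr0 refl2_mxE /refl2 /=.
have -> : x / r * x + c' / r * c' = r.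
  transitivity ((x ^+ 2 + c' ^+ 2) / r); first by rewrite /x; ring.
  by rewrite -r2 expr2 mulfK.
have -> : c' / r * x - x / r * c' = 0 by ring.
by rewrite /cmx2 /= !EX -assoc raddf0 col_mx0.
Qed.

(** Conjugation by a [Q] sending [u] to the first axis turns the reflection into a sign change of
    one coordinate, which preserves the law because the normal density is even. *)
Lemma gauss_inv_reflection n (u : 'cV[R]_n) : u^T *m u = 1%:M -> gauss_inv (1%:M - 2 *: (u *m u^T)).
Proof.
case: n u => [|n] u uu.
  rewrite (_ : 1%:M - _ = 1%:M); first exact: gauss_inv1.
  by apply/matrixP => -[].
have [Q [iQ Q1 Q2 [c Qu]]] := @gauss_inv_rotate_to_axis n u.
have c2 : c ^+ 2 = 1.
  have : (Q *m u)^T *m (Q *m u) = 1%:M.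
    by rewrite trmx_mul -mulmxA (mulmxA Q^T) Q1 mul1mx.
  rewrite Qu tr_col_mx mul_row_col trmx0 mulmx0 addr0 tr_scalar_mx mul_scalar_mx.
  by move/matrixP/(_ ord0 ord0); rewrite !mxE eqxx !mulr1n -expr2.
pose B : 'M[R]_(1 + n) := block_mx (-1)%:M 0 0 1%:M.
have iB : gauss_inv B by apply: gauss_inv_block; [exact: gauss_invN1|exact: gauss_inv1].
have QB : Q *m (1%:M - 2 *: (u *m u^T)) *m Q^T = B.
  rewrite mulmxBr mulmxBl mulmx1 Q2 -scalemxAr -scalemxAl.
  have -> : Q *m (u *m u^T) *m Q^T = (Q *m u) *m (Q *m u)^T by rewrite trmx_mul !mulmxA.
  rewrite Qu.
  rewrite tr_col_mx mul_col_row !trmx0 !mulmx0 !mul0mx tr_scalar_mx mul_scalar_mx.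
  rewrite scale_scalar_mx -expr2 c2 scale_block_mx !scaler0 scale_scalar_mx mulr1.
  rewrite (scalar_mx_block 1 n) opp_block_mx add_block_mx !oppr0 !addr0.
  by rewrite /B; congr block_mx; rewrite -raddfB /=; congr (_%:M); ring.
have -> : 1%:M - 2 *: (u *m u^T) = Q^T *m B *m Q.
  by rewrite -QB !mulmxA Q1 mul1mx -mulmxA Q1 mulmx1.
apply: gauss_inv_mul => //; apply: gauss_inv_mul => //.
exact: (gauss_inv_inverse Q1).
Qed.

End Orthogonal.

(** * Revealing a Gaussian matrix adaptively *)

Section Reveal.
Context {R : realType}.
Notation RM := (measurableTypeR R).
Notation mxMeas := (@mxMeas R).
Notation gauss_mx := (@gauss_mx R).

Lemma product_measureE d1 d2 (T1 : measurableType d1) (T2 : measurableType d2)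
  (P1 : probability T1 R) (P2 : probability T2 R) (E : set (T1 * T2)) :
  ((P1 \x P2) E = \int[P1]_x P2 [set y | E (x, y)])%E.
Proof.
rewrite /product_measure1; apply: eq_integral => x _ /=; congr (P2 _).
by apply/seteqP; split => y; rewrite /xsection/= inE.
Qed.

Lemma measurable_section d1 d2 (T1 : measurableType d1) (T2 : measurableType d2)
  (E : set (T1 * T2)) x : measurable E -> measurable [set y | E (x, y)].
Proof.
move=> mE; have := measurable_xsection x mE.
by congr measurable; apply/seteqP; split => y; rewrite /xsection/= inE.
Qed.

Lemma measurable_fun_section d1 d2 (T1 : measurableType d1) (T2 : measurableType d2)
  (P2 : probability T2 R) (E : set (T1 * T2)) : measurable E ->
  measurable_fun setT (fun x => P2 [set y | E (x, y)]).
Proof.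
move=> mE; have := measurable_fun_xsection P2 mE.
apply: eq_measurable_fun => x _ /=; congr (P2 _).
by apply/seteqP; split => y; rewrite /xsection/= inE.
Qed.

Lemma prob_integral_le d (T : measurableType d) (P : probability T R) (f : T -> \bar R) (c : \bar R) :
  measurable_fun setT f -> (forall x, 0 <= f x)%E -> (forall x, f x <= c)%E ->
  (\int[P]_x f x <= c)%E.
Proof.
move=> mf f0 fc.
have c0 : (0 <= c)%E by apply: le_trans (fc point); exact: f0.
rewrite -[leRHS]mule1 -(@probability_setT _ _ _ P) -integral_cst//.
by apply: ge0_le_integral.
Qed.

(* [0 | Pi] and [s | Pi - s s^T] differ by the reflection exchanging the first
   axis with s, so they send a standard Gaussian matrix to the same law. *)
Lemma gauss_mx_reveal_proj n m (Pi : 'M[R]_n) (s : 'cV[R]_n) (E : set (mxMeas n m)) :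
  Pi *m s = s -> s^T *m s = 1%:M -> measurable E ->
  gauss_mx n m [set G | E (Pi *m (G : 'M[R]_(n, m)))] =
  (\int[gauss_mx 1 m]_g gauss_mx n m
    [set G | E (s *m (g : 'rV[R]_m) + (Pi - s *m s^T) *m (G : 'M[R]_(n, m)))%R])%E.
Proof.
move=> Pis ss mE.
pose M1 : 'M[R]_(n, 1 + n) := row_mx 0 Pi.
pose M2 : 'M[R]_(n, 1 + n) := row_mx s (Pi - s *m s^T).
pose u : 'cV[R]_(1 + n) := (Num.sqrt 2)^-1 *: col_mx 1%:M (- s).
have sq2 : (Num.sqrt 2 : R)^-1 * (Num.sqrt 2)^-1 = 2^-1.
  by rewrite -invfM -expr2 sqr_sqrtr.
have uT : u^T = (Num.sqrt 2)^-1 *: row_mx 1%:M (- s^T).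
  by rewrite /u [LHS]linearZ /= tr_col_mx trmx1 raddfN.
have uu : u^T *m u = 1%:M.
  rewrite uT /u -scalemxAl -scalemxAr scalerA sq2 mul_row_col.
  rewrite mulmx1 mulNmx mulmxN opprK ss scalerDr -scalerDl.
  by rewrite (_ : 2^-1 + 2^-1 = 1 :> R) ?scale1r//; lra.
have M12 : M1 *m (1%:M - 2 *: (u *m u^T)) = M2.
  rewrite mulmxBr mulmx1 -scalemxAr mulmxA uT -scalemxAr {1}/u -scalemxAr -scalemxAl.
  rewrite !scalerA -mulrA sq2 divff ?pnatr_eq0// scale1r /M1 mul_row_col mul0mx add0r mulmxN Pis.
  rewrite mul_mx_row mulmx1 mulmxN mulNmx opprK.
  by rewrite opp_row_mx add_row_mx opprK add0r.
have mE1 := measurable_mxpreimage (measurable_mulmxl M1) mE.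
have mE2 := measurable_mxpreimage (measurable_mulmxl M2) mE.
have mEP := measurable_mxpreimage (measurable_mulmxl Pi) mE.
have H1 : gauss_mx (1 + n) m ((fun G => M1 *m (G : 'M[R]_(1 + n, m))) @^-1` E) =
          gauss_mx n m [set G | E (Pi *m (G : 'M[R]_(n, m)))].
  rewrite -gauss_mx_col_mx//.
  transitivity ((gauss_mx 1 m \x gauss_mx n m)%E (setT `*` ((fun G => Pi *m (G : 'M[R]_(n, m))) @^-1` E))).
    congr (product_measure1 _ _ _); apply/seteqP; split => -[g G] /=;
    by rewrite /M1 mul_row_col mul0mx add0r => // -[].
  rewrite [LHS]product_measure1E// -[RHS]mul1e; congr (_ * _)%E; exact: probability_setT.
rewrite -H1 -(gauss_inv_reflection uu mE1).
transitivity (gauss_mx (1 + n) m ((fun G => M2 *m (G : 'M[R]_(1 + n, m))) @^-1` E)).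
  by congr (gauss_mx _ _ _); apply/seteqP; split => G /=; rewrite mulmxA M12.
rewrite -[LHS](gauss_mx_col_mx mE2) product_measureE.
apply: eq_integral => g _; congr (gauss_mx n m _).
by apply/seteqP; split => G /=; rewrite /M2 mul_row_col.
Qed.

Lemma measurable_affine n m (B : 'M[R]_(n, m)) (Pi : 'M[R]_n) (Om : 'M[R]_m) :
  measurable_fun setT (fun G : mxMeas n m => B + Pi *m (G : 'M[R]_(n, m)) *m Om : mxMeas n m).
Proof.
apply: (@measurable_addmx _ _ _ n m (fun=> B)); first exact: measurable_cst_mx.
apply: (@measurable_mulmx _ _ _ n m m _ (fun=> Om)); last exact: measurable_cst_mx.
exact: measurable_mulmxl.
Qed.

(** [B + Pi G Om] is the general state of the game: [B] is what is known, while [Pi] and [Om]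
    project onto the directions not yet seen from the left and from the right. [B] and [Om] are
    absorbed into the event. *)
Lemma gauss_mx_reveal_row n m (B : 'M[R]_(n, m)) (Pi : 'M[R]_n) (Om : 'M[R]_m)
    (s : 'cV[R]_n) (E : set (mxMeas n m)) :
  Pi *m s = s -> s^T *m s = 1%:M -> measurable E ->
  gauss_mx n m [set G | E (B + Pi *m (G : 'M[R]_(n, m)) *m Om)] =
  (\int[gauss_mx 1 m]_g gauss_mx n m [set G |
     E ((B + s *m ((g : 'rV[R]_m) *m Om)) + (Pi - s *m s^T) *m (G : 'M[R]_(n, m)) *m Om)%R])%E.
Proof.
move=> Pis ss mE.
have mE' : measurable ([set H | E (B + (H : 'M[R]_(n, m)) *m Om)] : set (mxMeas n m)).
  have := measurable_mxpreimage (measurable_affine B 1%:M Om) mE.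
  by congr measurable; apply/seteqP; split => G /=; rewrite mul1mx.
rewrite [LHS](gauss_mx_reveal_proj Pis ss mE'); apply: eq_integral => g _.
by congr (gauss_mx n m _); apply/seteqP; split => G /=; rewrite mulmxDl addrA mulmxA.
Qed.

(** The transpose of the row case, with the average over the revealed column replaced by its worst
    value: the column is not charged to any fresh row. *)
Lemma gauss_mx_reveal_col n m (B : 'M[R]_(n, m)) (Pi : 'M[R]_n) (Om : 'M[R]_m)
    (s : 'cV[R]_m) (E : set (mxMeas n m)) (c : \bar R) :
  s^T *m Om = s^T -> s^T *m s = 1%:M -> measurable E ->
  (forall g : 'cV[R]_n, gauss_mx n m [set G |
     E ((B + Pi *m g *m s^T) + Pi *m (G : 'M[R]_(n, m)) *m (Om - s *m s^T))%R] <= c)%E ->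
  (gauss_mx n m [set G | E (B + Pi *m (G : 'M[R]_(n, m)) *m Om)%R] <= c)%E.
Proof.
move=> sOm ss mE H.
have mE' : measurable ([set H | E (B + Pi *m (H : 'M[R]_(m, n))^T)] : set (mxMeas m n)).
  have := measurable_mxpreimage (measurable_affine B Pi 1%:M) mE.
  move=> /(measurable_mxpreimage (measurable_trmx (@measurable_id _ (mxMeas m n) setT))).
  by congr measurable; apply/seteqP; split => G /=; rewrite mulmx1.
have sOm' : Om^T *m s = s by rewrite -[RHS]trmxK -sOm trmx_mul trmxK.
have mA := measurable_mxpreimage (measurable_mulmxl Om^T) mE'.
rewrite (_ : gauss_mx n m _ = gauss_mx m n ((fun G => Om^T *m (G : 'M[R]_(m, n))) @^-1`
    [set H | E (B + Pi *m (H : 'M[R]_(m, n))^T)])); last first.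
  rewrite -(gauss_mx_trmx mA); congr (gauss_mx n m _).
  by apply/seteqP; split => G /=; rewrite trmx_mul !trmxK mulmxA.
rewrite [leLHS](gauss_mx_reveal_proj sOm' ss mE').
have meas : measurable ([set x | E (B + Pi *m (s *m (x.1 : 'rV[R]_n) +
    (Om^T - s *m s^T) *m (x.2 : 'M[R]_(m, n)))^T)] : set (mxMeas 1 n * mxMeas m n)).
  have mf : measurable_fun setT (fun x : mxMeas 1 n * mxMeas m n =>
      s *m (x.1 : 'rV[R]_n) + (Om^T - s *m s^T) *m (x.2 : 'M[R]_(m, n)) : mxMeas m n).
    apply: measurable_addmx.
      exact: (measurableT_comp (measurable_mulmxl s) measurable_fst).
    exact: (measurableT_comp (measurable_mulmxl _) measurable_snd).
  exact: (measurable_mxpreimage mf mE').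
apply: prob_integral_le => [|g|g]; [|exact: measure_ge0|].
  exact: (measurable_fun_section (gauss_mx m n) meas).
apply: le_trans (H (g : 'rV[R]_n)^T).
rewrite -[leRHS](_ : gauss_mx m n [set G | E (B + Pi *m (s *m (g : 'rV[R]_n) +
    (Om^T - s *m s^T) *m (G : 'M[R]_(m, n)))^T)] = _)//.
rewrite -gauss_mx_trmx; last exact: (measurable_section g meas).
have tE (G : 'M[R]_(n, m)) : (s *m (g : 'rV[R]_n) + (Om^T - s *m s^T) *m G^T)^T =
    (g : 'rV[R]_n)^T *m s^T + G *m (Om - s *m s^T).
  rewrite [LHS]linearD /= !trmx_mul trmxK; congr (_ + _ *m _).
  by rewrite linearB /= trmx_mul !trmxK.
by congr (gauss_mx n m _); apply/seteqP; split => G /=; rewrite tE mulmxDr !mulmxA addrA.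
Qed.

End Reveal.

(** * The revealing game against an adaptive algorithm *)

Section Game.
Context {R : realType}.
Notation RM := (measurableTypeR R).
Notation mxMeas := (@mxMeas R).
Notation gauss_mx := (@gauss_mx R).

Definition is_proj n (Pi : 'M[R]_n) := Pi^T = Pi /\ Pi *m Pi = Pi.

Lemma mulmx_tr_self n (v : 'cV[R]_n) : v^T *m v = (\sum_i v i ord0 ^+ 2)%:M.
Proof.
apply/matrixP => i j; rewrite (ord1 i) (ord1 j) !mxE eqxx mulr1n.
by apply: eq_bigr => k _; rewrite mxE expr2.
Qed.

Lemma sum_sqr_eq0 n (v : 'cV[R]_n) : \sum_i v i ord0 ^+ 2 = 0 -> v = 0.
Proof.
move/eqP; rewrite psumr_eq0; last by move=> i _; exact: sqr_ge0.
move/allP => H; apply/colP => i; rewrite mxE.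
by have := H i (mem_index_enum i); rewrite sqrf_eq0 => /eqP.
Qed.

(* The scalar a is 0 when Pi *m x = 0. *)
Lemma proj_deflate n (Pi : 'M[R]_n) (x : 'cV[R]_n) : is_proj Pi ->
  exists a : R, let s := a *: (Pi *m x) in
  [/\ s = 0 \/ s^T *m s = 1%:M, Pi *m s = s, (Pi - s *m s^T) *m x = 0 &
      is_proj (Pi - s *m s^T)].
Proof.
move=> [PT PP].
have [w0|w0] := eqVneq (Pi *m x) 0.
  exists 0; rewrite /= scale0r; split; first by left.
  - by rewrite mulmx0.
  - by rewrite mul0mx subr0.
  - by rewrite mul0mx subr0; split.
pose nu : R := \sum_i (Pi *m x) i ord0 ^+ 2.
have nu0 : 0 < nu.
  rewrite lt_neqAle sumr_ge0 ?andbT; last by move=> i _; exact: sqr_ge0.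
  by apply: contra_neq w0 => nuE; apply: sum_sqr_eq0.
have sq : (Num.sqrt nu)^-1 * (Num.sqrt nu)^-1 = nu^-1.
  by rewrite -invfM -expr2 sqr_sqrtr// ltW.
exists (Num.sqrt nu)^-1 => s.
have sT : s^T = (Num.sqrt nu)^-1 *: (x^T *m Pi).
  by rewrite /s [LHS]linearZ /= trmx_mul PT.
have ss : s^T *m s = 1%:M.
  rewrite sT /s -scalemxAl -scalemxAr scalerA sq.
  have -> : x^T *m Pi *m (Pi *m x) = (Pi *m x)^T *m (Pi *m x) by rewrite trmx_mul PT.
  by rewrite mulmx_tr_self -/nu scale_scalar_mx mulVf// gt_eqF.
have Ps : Pi *m s = s by rewrite /s -scalemxAr mulmxA PP.
have sP : s^T *m Pi = s^T by rewrite sT -scalemxAl -mulmxA PP.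
split => //; first by right.
- have sx : s^T *m x = ((Num.sqrt nu)^-1 * nu)%:M.
    rewrite sT -scalemxAl -scale_scalar_mx; congr (_ *: _).
    by rewrite -mulmx_tr_self trmx_mul PT -[in RHS]mulmxA (mulmxA Pi Pi) PP mulmxA.
  rewrite mulmxBl -mulmxA sx mul_mx_scalar /s scalerA mulrAC sq mulVf ?scale1r ?subrr//.
  by rewrite gt_eqF.
- split; first by rewrite [LHS]linearB /= trmx_mul trmxK PT.
  rewrite mulmxBl !mulmxBr PP mulmxA Ps -!mulmxA sP (mulmxA _ s) ss mul1mx.
  by rewrite subrr subr0.
Qed.

(** Row spaces are encoded as square matrices. Each fresh row is added, then the space is enlarged
    once by its image under [T]: the row accounts for [x^T G], the image for the direction [T G^T x]
    along which the next column is revealed. *)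
Fixpoint krylov m (T : 'M[R]_m) j : 'M[R]_m -> 'M[R]_(j, m) -> 'M[R]_m :=
  match j with
  | 0 => fun S _ => S
  | j'.+1 => fun S Z =>
      let S1 := (S + usubmx (Z : 'M[R]_(1 + j', m)))%MS in
      krylov T (S1 + S1 *m T)%MS (dsubmx (Z : 'M[R]_(1 + j', m)))
  end.

(** One fresh row of the final event pays for one revealed row. When [s = 0] the query shows nothing
    new; a row is drawn all the same, so that the number of rows depends only on the number of
    queries. *)
Lemma gauss_mx_step n m j (B : 'M[R]_(n, m)) (Pi : 'M[R]_n) (Om : 'M[R]_m) (s : 'cV[R]_n)
    (E : set (mxMeas n m)) (F : set (mxMeas (1 + j) m)) :
  s = 0 \/ s^T *m s = 1%:M -> Pi *m s = s -> measurable E -> measurable F ->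
  (forall g : 'rV[R]_m,
    gauss_mx n m [set G | E ((B + s *m (g *m Om)) + (Pi - s *m s^T) *m (G : 'M[R]_(n, m)) *m Om)%R] <=
    gauss_mx j m [set Z | F (col_mx g (Z : 'M[R]_(j, m)))])%E ->
  (gauss_mx n m [set G | E (B + Pi *m (G : 'M[R]_(n, m)) *m Om)%R] <= gauss_mx (1 + j) m F)%E.
Proof.
move=> s01 Ps mE mF H.
have mcol := measurable_col_mx (@measurable_fst _ _ (mxMeas 1 m) (mxMeas j m))
  (@measurable_snd _ _ (mxMeas 1 m) (mxMeas j m)).
have mF' := measurable_mxpreimage mcol mF.
have -> : gauss_mx n m [set G | E (B + Pi *m (G : 'M[R]_(n, m)) *m Om)%R] =
  (\int[gauss_mx 1 m]_g gauss_mx n m [set G |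
     E ((B + s *m ((g : 'rV[R]_m) *m Om)) + (Pi - s *m s^T) *m (G : 'M[R]_(n, m)) *m Om)%R])%E.
  have [s0|ss] := s01; last exact: gauss_mx_reveal_row.
  rewrite s0; under eq_integral do rewrite mul0mx addr0 mul0mx subr0.
  by rewrite integral_cst// -[LHS]mule1; congr (_ * _)%E; apply/esym; exact: probability_setT.
rewrite -(gauss_mx_col_mx mF) product_measureE.
apply: ge0_le_integral => //.
- have mf : measurable_fun setT (fun x : mxMeas 1 m * mxMeas n m =>
      B + s *m ((x.1 : 'rV[R]_m) *m Om) + (Pi - s *m s^T) *m (x.2 : 'M[R]_(n, m)) *m Om : mxMeas n m).
    apply: measurable_addmx.
      apply: (@measurable_addmx _ _ _ n m (fun=> B)); first exact: measurable_cst_mx.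
      apply: (measurableT_comp (measurable_mulmxl s)).
      apply: (@measurable_mulmx _ _ _ 1 m m _ (fun=> Om)); last exact: measurable_cst_mx.
      exact: measurable_fst.
    apply: (@measurable_mulmx _ _ _ n m m _ (fun=> Om)); last exact: measurable_cst_mx.
    exact: (measurableT_comp (measurable_mulmxl _) measurable_snd).
  exact: (measurable_fun_section (gauss_mx n m) (measurable_mxpreimage mf mE)).
- exact: (measurable_fun_section (gauss_mx j m) mF').
Qed.

Lemma gauss_mx_step_col n m (B : 'M[R]_(n, m)) (Pi : 'M[R]_n) (Om : 'M[R]_m)
    (s : 'cV[R]_m) (E : set (mxMeas n m)) (c : \bar R) :
  s = 0 \/ s^T *m s = 1%:M -> s^T *m Om = s^T -> measurable E ->
  (forall g : 'cV[R]_n, gauss_mx n m [set G |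
     E ((B + Pi *m g *m s^T) + Pi *m (G : 'M[R]_(n, m)) *m (Om - s *m s^T))%R] <= c)%E ->
  (gauss_mx n m [set G | E (B + Pi *m (G : 'M[R]_(n, m)) *m Om)%R] <= c)%E.
Proof.
case=> [s0 _ _ /(_ 0)|ss sOm mE H]; last exact: gauss_mx_reveal_col H.
by rewrite s0 mulmx0 mul0mx addr0 mul0mx subr0.
Qed.

(** Invariant after [t] queries: [G = B + Pi G' Om], the rows of [B] and of [1 - Om] lie in [S], and
    on [E] the transcript is the constant list [rs]. Since [rs] is constant, the next query is a
    fixed vector and [q] and [out] may be arbitrary functions. The [1 + j] rows are one for each
    remaining query and one for the output, which is treated as a last query. *)
Lemma adaptive_reveal n m (T : 'M[R]_m) (E : set (mxMeas n m))
    (q out : seq 'cV[R]_n -> 'cV[R]_n) (k : nat) (Bad : set 'rV[R]_m) :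
  T^T = T -> measurable E ->
  (forall G : 'M[R]_(n, m), E G ->
     Bad ((out (responses q (G *m T *m G^T) k))^T *m G)) ->
  forall j t (B : 'M[R]_(n, m)) (Pi : 'M[R]_n) (Om S : 'M[R]_m) (rs : seq 'cV[R]_n)
    (F : set (mxMeas (1 + j) m)),
  (t + j = k)%N -> is_proj Pi -> is_proj Om -> (B <= S)%MS -> (1%:M - Om <= S)%MS ->
  (forall G' : 'M[R]_(n, m), let G := B + Pi *m G' *m Om in
     E G -> responses q (G *m T *m G^T) t = rs) ->
  measurable F ->
  (forall (Z : 'M[R]_(1 + j, m)) r, Bad r -> (r <= krylov T S Z)%MS -> F Z) ->
  (gauss_mx n m [set G | E (B + Pi *m (G : 'M[R]_(n, m)) *m Om)%R] <= gauss_mx (1 + j) m F)%E.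
Proof.
move=> TT mE HE.
have row_facts (B : 'M[R]_(n, m)) Pi (Om S : 'M[R]_m) (x : 'cV[R]_n) (s : 'cV[R]_n) (g : 'rV[R]_m) :
    (B <= S)%MS -> (1%:M - Om <= S)%MS -> is_proj Pi -> Pi *m s = s ->
    (Pi - s *m s^T) *m x = 0 -> is_proj (Pi - s *m s^T) ->
    [/\ ((B + s *m (g *m Om))%R <= S + g)%MS,
        forall G, exists G', B + s *m (g *m Om) + (Pi - s *m s^T) *m G *m Om =
                             B + Pi *m G' *m Om &
        x^T *m (Pi - s *m s^T) = 0].
  move=> BS OS [PT PP] Ps P1x [P1T _]; split.
  - apply: addmx_sub; first exact: submx_trans BS (addsmxSl _ _).
    apply: (submx_trans (submxMl _ _)).
    (* The row charged to the final event is the full standard Gaussian [g], whereas [G] only shows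
       [g Om]; the difference lies in [S]. *)
    rewrite (_ : g *m Om = g - g *m (1%:M - Om)); last by rewrite mulmxBr mulmx1 opprB addrC subrK.
    apply: addmx_sub; first exact: addsmxSr.
    rewrite -mulNmx; apply: (submx_trans (submxMl _ _)).
    exact: submx_trans OS (addsmxSl _ _).
  - move=> G; exists (s *m g + (Pi - s *m s^T) *m G).
    have PP1 : Pi *m (Pi - s *m s^T) = Pi - s *m s^T by rewrite mulmxBr PP mulmxA Ps.
    by rewrite mulmxDr !(mulmxA Pi) Ps PP1 mulmxDl addrA !mulmxA.
  - by rewrite -[LHS]trmxK trmx_mul trmxK P1T P1x trmx0.
elim=> [|j IH] t B Pi Om S rs F tj pPi pOm BS OS Hrs mF HF.
- rewrite addn0 in tj; subst t.
  pose x := out rs.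
  have [a [s01 Ps P1x pP1]] := proj_deflate x pPi.
  set s := a *: _ in s01 Ps P1x pP1.
  apply: (gauss_mx_step s01 Ps mE mF) => g.
  have [BS1 fwd xP1] := row_facts B Pi Om S x s g BS OS pPi Ps P1x pP1.
  set E1 := [set G | _].
  (* An empty event costs nothing. Otherwise a single point of it shows that [x^T (B + s g Om)],
     which no longer depends on [G] and lies in the span, is bad; hence [F] holds for every
     completion of [g] and the right-hand side is 1. *)
  have [->|[G EG]] : E1 = set0 \/ exists G, E1 G.
    have [->|/set0P[G EG]] := eqVneq E1 set0; [by left|by right; exists G].
    by rewrite measure0.
  rewrite (_ : [set Z | _] = setT); last first.
    apply/seteqP; split => // Z _ /=; apply: (HF _ (x^T *m (B + s *m (g *m Om)))).
    + have [G' GE] := fwd G.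
      have {}EG : E (B + Pi *m G' *m Om) by rewrite -GE.
      have := HE _ EG; rewrite (Hrs _ EG) -/x -GE.
      by rewrite mulmxDr !mulmxA xP1 !mul0mx addr0.
    + rewrite /= (@col_mxKu _ 1 0).
      apply: submx_trans (addsmxSl _ _).
      exact: submx_trans (submxMl _ _) BS1.
  apply: (@le_trans _ _ 1%E); last by rewrite -(@probability_setT _ _ _ (gauss_mx 0 m)).
  apply: probability_le1.
  exact: (measurable_mxpreimage (measurable_affine _ _ _) mE).
- pose x := q rs.
  have [a [s01 Ps P1x pP1]] := proj_deflate x pPi.
  set s := a *: _ in s01 Ps P1x pP1.
  apply: (gauss_mx_step s01 Ps mE mF) => g.
  have [BS1 fwd xP1] := row_facts B Pi Om S x s g BS OS pPi Ps P1x pP1.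
  set B1 := B + _ in BS1 fwd *; set P1 := Pi - _ in pP1 fwd xP1 *.
  set S1 := (S + g)%MS in BS1.
  (* Once the row is revealed, [x^T G = x^T B1], so [y = T G^T x] is known and the response is
     [G y]. Revealing the column along the unseen part of [y] makes this response a constant. *)
  pose y := T *m (x^T *m B1)^T.
  have [b [s01' Os O1y pO1]] := proj_deflate y pOm.
  set s' := b *: _ in s01' Os O1y pO1.
  have [OT OO] := pOm.
  have sO : s'^T *m Om = s'^T by rewrite -[in RHS]Os trmx_mul OT.
  apply: (gauss_mx_step_col s01' sO mE) => g'.
  pose S2 := (S1 + S1 *m T)%MS.
  have S12 : (S1 <= S2)%MS by exact: addsmxSl.
  have OS1 : (1%:M - Om <= S1)%MS by apply: submx_trans OS (addsmxSl _ _).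
  have yS2 : (y^T <= S2)%MS.
    rewrite /y trmx_mul trmxK TT; apply: submx_trans (addsmxSr _ _).
    by apply: submxMr; exact: submx_trans (submxMl _ _) BS1.
  have sS2 : (s'^T <= S2)%MS.
    rewrite /s' [X in (X <= _)%MS]linearZ /= trmx_mul OT; apply: scalemx_sub.
    rewrite (_ : y^T *m Om = y^T - y^T *m (1%:M - Om)); last by rewrite mulmxBr mulmx1 opprB addrC subrK.
    apply: addmx_sub => //; rewrite -mulNmx; apply: (submx_trans (submxMl _ _)).
    exact: submx_trans OS1 S12.
  have mcol g0 : measurable_fun setT (fun Z : mxMeas (1 + j) m => col_mx (g0 : 'rV[R]_m) (Z : 'M[R]_(1 + j, m)) : mxMeas (1 + (1 + j)) m).
    apply: (@measurable_col_mx _ _ _ 1 (1 + j) m (fun=> g0)); first exact: measurable_cst_mx.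
    exact: measurable_id.
  apply: (IH t.+1 (B1 + P1 *m g' *m s'^T) P1 (Om - s' *m s'^T) S2
    (rcons rs ((B1 + P1 *m g' *m s'^T) *m y))) => //.
  + by rewrite -tj addnS.
  + apply: addmx_sub; first exact: submx_trans BS1 S12.
    exact: submx_trans (submxMl _ _) sS2.
  + rewrite opprB addrCA; apply: addmx_sub; last exact: submx_trans OS1 S12.
    exact: submx_trans (submxMl _ _) sS2.
  + move=> G'' G EG.
    have GE : G = B1 + P1 *m (g' *m s'^T + G'' *m (Om - s' *m s'^T)) *m Om.
      have OO1 : (Om - s' *m s'^T) *m Om = Om - s' *m s'^T by rewrite mulmxBl OO -mulmxA sO.
      by rewrite /G mulmxDr mulmxDl addrA -!mulmxA sO OO1.
    have [G' GE'] := fwd (g' *m s'^T + G'' *m (Om - s' *m s'^T)).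
    have rsE : responses q (G *m T *m G^T) t = rs.
      by rewrite GE GE'; apply: Hrs; rewrite -GE' -GE.
    have xG : x^T *m G = x^T *m B1.
      by rewrite GE [LHS]mulmxDr !(mulmxA x^T) xP1 !mul0mx addr0.
    rewrite /= rsE; congr rcons; rewrite -/x.
    have -> : G *m T *m G^T *m x = G *m y.
      by rewrite /y -xG trmx_mul trmxK !mulmxA.
    by rewrite /G mulmxDl -[_ *m _ *m _ *m y]mulmxA O1y mulmx0 addr0.
  + exact: (measurable_mxpreimage (mcol g) mF).
  + move=> Z r Br rS; apply: (HF _ r) => //=.
    by rewrite (@col_mxKu _ 1 (1 + j)) (@col_mxKd _ 1 (1 + j)).
Qed.

End Game.

(** * Moments and Gram matrices *)

Section Moments1.
Context {R : realType}.
Notation RM := (measurableTypeR R).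
Notation mu := (@lebesgue_measure R).
Local Open Scope ereal_scope.

Lemma measurable_exprn_RM k : measurable_fun (setT : set RM) (fun x : RM => (x ^+ k)%R : R).
Proof. exact: (@exprn_measurable R setT k). Qed.

(** The integrand is dominated by a multiple of the density of deviation 2. Squaring [e^y >= 1 + y]
    at [y = 3 x^2 / 16] gives [e^(3 x^2 / 8) >= (9 / 256) x^4], and [256 / 9 < 29]. *)
Lemma std_normal_moment4_lty : \int[@std_normal R]_x ((x : R) ^+ 4)%:E < +oo.
Proof.
have m4 : measurable_fun (setT : set RM) (fun x : RM => ((x ^+ 4)%R : R)%:E).
  by apply/measurable_EFinP; exact: measurable_exprn_RM.
have p4 (x : R) : (0 <= x ^+ 4)%R by rewrite (exprM x 2 2) sqr_ge0.
rewrite ge0_integral_std_normal//.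
pose C : R := (29 * (normal_peak 1 / normal_peak (2 : R)))%R.
have pk2 : (0 < normal_peak (2 : R))%R by apply: normal_peak_gt0.
have pk1 : (0 < normal_peak (1 : R))%R by apply: normal_peak_gt0; rewrite oner_eq0.
have C0 : (0 <= C)%R by rewrite !mulr_ge0// ?invr_ge0// ltW.
apply: (@le_lt_trans _ _ (\int[mu]_x (C%:E * (normal_pdf 0%R 2%R x)%:E))).
  apply: ge0_le_integral => //.
  - by move=> x _; rewrite -EFinM lee_fin mulr_ge0// normal_pdf_ge0.
  - apply: emeasurable_funM => //.
    by apply/measurable_EFinP; exact: measurable_normal_pdf.
  - apply: emeasurable_funM => //.
    by apply/measurable_EFinP; exact: measurable_normal_pdf.
  move=> x _; rewrite -!EFinM lee_fin !normal_pdfE ?oner_eq0// /normal_fun !subr0.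
  set eA := expR _; set eB := expR _.
  suff H : (x ^+ 4 * eA <= 29 * eB)%R.
    have -> : (x ^+ 4 * (normal_peak 1 * eA) = normal_peak 1 * (x ^+ 4 * eA))%R by ring.
    have -> : (C * (normal_peak 2 * eB) = normal_peak 1 * (29 * eB))%R.
      by rewrite /C; field; rewrite gt_eqF.
    by rewrite ler_pM2l.
  rewrite {}/eA {}/eB.
  have -> : (- x ^+ 2 / (1 ^+ 2 *+ 2) = - x ^+ 2 / (2 ^+ 2 *+ 2) - (3 / 16 * x ^+ 2) *+ 2)%R.
    by rewrite !mulr2n expr1n; field.
  rewrite expRD mulrCA [leRHS]mulrC ler_pM2l ?expR_gt0//.
  rewrite expRN ler_pdivrMr ?expR_gt0// mulr2n expRD.
  have e1 := expR_ge1Dx (3 / 16 * x ^+ 2)%R.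
  have x2 : (0 <= x ^+ 2)%R by exact: sqr_ge0.
  rewrite (exprM x 2 2); nra.
rewrite ge0_integralZl//.
- by rewrite integral_normal_pdf mule1 ltry.
- by apply/measurable_EFinP; exact: measurable_normal_pdf.
- by move=> x _; rewrite lee_fin normal_pdf_ge0.
Qed.

Lemma std_normal_moment2_lty : \int[@std_normal R]_x ((x : R) ^+ 2)%:E < +oo.
Proof.
have m2 : measurable_fun (setT : set RM) (fun x : RM => ((x ^+ 2)%R : R)%:E).
  by apply/measurable_EFinP; exact: measurable_exprn_RM.
have m4 : measurable_fun (setT : set RM) (fun x : RM => ((x ^+ 4)%R : R)%:E).
  by apply/measurable_EFinP; exact: measurable_exprn_RM.
have p4 (x : R) : (0 <= x ^+ 4)%R by rewrite (exprM x 2 2) sqr_ge0.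
apply: (@le_lt_trans _ _ (\int[@std_normal R]_x (1 + ((x : R) ^+ 4)%:E))).
  apply: ge0_le_integral => //.
  - by move=> x _; rewrite lee_fin sqr_ge0.
  - exact: emeasurable_funD.
  - move=> x _; rewrite -EFinD lee_fin (exprM x 2 2).
    have := sqr_ge0 (x ^+ 2 - 1)%R; have := sqr_ge0 x; nra.
have one_lty : \int[@std_normal R]_x (cst 1 x) < +oo.
  rewrite integral_cst// mul1e (le_lt_trans (probability_le1 _ _))// ltry.
  by [].
have -> : \int[@std_normal R]_x (1 + ((x : R) ^+ 4)%:E) =
    \int[@std_normal R]_x (cst 1 x) + \int[@std_normal R]_x ((x : R) ^+ 4)%:E.
  by apply: ge0_integralD => // x _; rewrite lee_fin.
by apply: lte_add_pinfty => //; exact: std_normal_moment4_lty.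
Qed.

(** The variance of the standard normal law, carried as a symbol: it enters only as a positive
    scale. *)
Definition kappa : R := fine (\int[@std_normal R]_x ((x : R) ^+ 2)%:E).
Definition mom4 : R := fine (\int[@std_normal R]_x ((x : R) ^+ 4)%:E).

Lemma kappaE : \int[@std_normal R]_x ((x : R) ^+ 2)%:E = kappa%:E.
Proof.
rewrite fineK// ge0_fin_numE ?std_normal_moment2_lty//.
by apply: integral_ge0 => x _; rewrite lee_fin sqr_ge0.
Qed.

Lemma mom4E : \int[@std_normal R]_x ((x : R) ^+ 4)%:E = mom4%:E.
Proof.
rewrite fineK// ge0_fin_numE ?std_normal_moment4_lty//.
by apply: integral_ge0 => x _; rewrite lee_fin (exprM _ 2 2) sqr_ge0.
Qed.

Lemma mom4_ge0 : (0 <= mom4)%R.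
Proof.
rewrite -lee_fin -mom4E.
by apply: integral_ge0 => x _; rewrite lee_fin (exprM _ 2 2) sqr_ge0.
Qed.

(** A zero second moment would concentrate the law on the origin, which is Lebesgue-null and hence
    null for a law with a density. *)
Lemma kappa_gt0 : (0 < kappa)%R.
Proof.
have k0 : (0 <= kappa)%R.
  by rewrite -lee_fin -kappaE; apply: integral_ge0 => x _; rewrite lee_fin sqr_ge0.
rewrite lt_neqAle k0 andbT; apply/negP => /eqP k0'.
have m2 : measurable_fun (setT : set RM) (fun x : RM => ((x ^+ 2)%R : R)%:E).
  by apply/measurable_EFinP; exact: measurable_exprn_RM.
have : \int[@std_normal R]_x `|((x : R) ^+ 2)%:E| = 0.
  have kz : kappa%:E = 0 :> \bar R by rewrite -k0'.
  rewrite -[RHS]kz -kappaE.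
  by apply: eq_integral => x _; rewrite gee0_abs// lee_fin sqr_ge0.
move/(ae_eq_integral_abs _ measurableT m2).
move=> [N [mN N0 sub]].
have N1 : @std_normal R (~` [set (0 : R)%R : RM]) = 0.
  apply: (@subset_measure0 _ _ _ _ _ N) => //.
    exact: measurableC.
  move=> x /= x0; apply: sub => /= /(_ I) /eqP.
  by rewrite eqe sqrf_eq0 => /eqP.
have N2 : @std_normal R [set (0 : R)%R : RM] = 0.
  have := normal_prob_dominates (0 : R)%R 1%R.
  move/null_content_dominatesP; apply => //.
  exact: lebesgue_measure_set1.
have N3 : @std_normal R setT = 0.
  rewrite -(setvU [set (0 : R)%R : RM]) [LHS]measureU//.
  - by rewrite -[RHS]adde0; congr (_ + _); [exact: N1|exact: N2].
  - exact: measurableC.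
  - by rewrite setICl.
have := @probability_setT _ _ _ (@std_normal R); rewrite N3 => /eqP.
by rewrite eqe eq_sym oner_eq0.
Qed.

End Moments1.

Section Moments2.
Context {R : realType}.
Notation RM := (measurableTypeR R).
Notation mxMeas := (@mxMeas R).
Notation gauss_mx := (@gauss_mx R).
Notation kappa := (@kappa R).
Notation mom4 := (@mom4 R).
Local Open Scope ereal_scope.

Lemma gauss_mx_entry p q i j (B : set RM) : measurable B ->
  gauss_mx p q ((fun M => (M : 'M[R]_(p, q)) i j : RM) @^-1` B) = std_normal B.
Proof.
move=> mB.
pose C (i' : 'I_p) (j' : 'I_q) := if (i' == i) && (j' == j) then B else setT.
rewrite (_ : _ @^-1` _ = mxbox C); last first.
  apply/seteqP; split => [M MB i' j'|M /(_ i j)] /=; last by rewrite /C !eqxx.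
  by rewrite /C; case: ifP => // /andP[/eqP -> /eqP ->].
have sT : @std_normal R setT = 1 by exact: probability_setT.
rewrite gauss_mx_box; last by move=> i' j'; rewrite /C; case: ifP.
rewrite (bigD1 i)//= [X in _ * X]big1 ?mule1; last first.
  move=> i' i'i; rewrite big1// => j' _.
  by rewrite /C (negbTE i'i).
rewrite (bigD1 j)//= [X in _ * X]big1 ?mule1; last first.
  by move=> j' j'j; rewrite /C (negbTE j'j) andbF.
by rewrite /C !eqxx.
Qed.

Lemma ge0_integral_entry p q i j (f : RM -> \bar R) :
  measurable_fun setT f -> (forall x, 0 <= f x) ->
  \int[gauss_mx p q]_M f ((M : 'M[R]_(p, q)) i j) = \int[@std_normal R]_x f x.
Proof.
move=> mf f0.
have me := @measurable_entry R p q i j.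
transitivity (\int[pushforward_prob (gauss_mx p q) me]_x f x).
  by rewrite [RHS](ge0_integral_pushforward me).
apply: eq_measure_integral => A mA _.
exact: gauss_mx_entry.
Qed.

(** This sign change preserves the law and negates [g_a g_b] for [b != a], so the mixed second
    moments equal their opposites and vanish. *)
Definition flip_entry m (a : 'I_m) (g : mxMeas 1 m) : mxMeas 1 m :=
  \matrix_(i, j) (if j == a then - (g : 'rV[R]_m) i j else (g : 'rV[R]_m) i j)%R.

Lemma measurable_flip_entry m (a : 'I_m) : measurable_fun setT (flip_entry a).
Proof.
apply: measurable_to_mx => i j.
have -> : (fun g => (flip_entry a g : 'M[R]_(1, m)) i j) =
    (fun g : mxMeas 1 m => if j == a then - (g : 'rV[R]_m) i j else (g : 'rV[R]_m) i j)%R.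
  by apply/funext => g; rewrite mxE.
case: (j == a); last exact: measurable_entry.
by apply: measurable_funN; exact: measurable_entry.
Qed.

Lemma gauss_mx_flip_entry m (a : 'I_m) (A : set (mxMeas 1 m)) : measurable A ->
  gauss_mx 1 m (flip_entry a @^-1` A) = gauss_mx 1 m A.
Proof.
move=> mA; rewrite -(pushforward_probE _ (measurable_flip_entry a)).
apply: mxMeas_measure_unique; last exact: mA.
move=> B mB.
have mN i j : measurable ((-%R : R -> R) @^-1` B i j : set RM).
  rewrite -[X in measurable X]setTI.
  exact: (@oppr_measurable R setT measurableT _ (mB i j)).
rewrite [RHS]gauss_mx_box// pushforward_probE.
rewrite (_ : _ @^-1` _ = mxbox (fun i j => if j == a then -%R @^-1` B i j else B i j)).
  rewrite gauss_mx_box; last by move=> i j; case: ifP.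
  apply: eq_bigr => i _; apply: eq_bigr => j _; case: ifP => // _.
  exact: std_normalN.
by apply/seteqP; split => g /= H i j; have := H i j; rewrite mxE; case: ifP.
Qed.

Lemma measurable_mul_entries p q i j i' j' :
  measurable_fun setT (fun M : mxMeas p q =>
    ((M : 'M[R]_(p, q)) i j * (M : 'M[R]_(p, q)) i' j')%R : R).
Proof. by apply: measurable_funM; exact: measurable_entry. Qed.

Lemma integrable_mul_entries m (a b : 'I_m) :
  (gauss_mx 1 m).-integrable setT (fun g : mxMeas 1 m =>
    ((g : 'rV[R]_m) ord0 a * (g : 'rV[R]_m) ord0 b)%:E).
Proof.
have m2 a' : measurable_fun setT (fun g : mxMeas 1 m => (((g : 'rV[R]_m) ord0 a' ^+ 2)%R : R)%:E).
  by apply/measurable_EFinP; apply: measurable_funX; exact: measurable_entry.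
have mx2 : measurable_fun (setT : set RM) (fun x : RM => ((x ^+ 2)%R : R)%:E).
  by apply/measurable_EFinP; exact: measurable_exprn_RM.
apply/integrableP; split.
  by apply/measurable_EFinP; exact: measurable_mul_entries.
apply: (@le_lt_trans _ _ (\int[gauss_mx 1 m]_g (((g : 'rV[R]_m) ord0 a ^+ 2)%:E + ((g : 'rV[R]_m) ord0 b ^+ 2)%:E))).
  apply: ge0_le_integral => //.
  - apply: measurableT_comp => //; apply/measurable_EFinP; exact: measurable_mul_entries.
  - exact: emeasurable_funD.
  - move=> g _ /=; rewrite -EFinD lee_fin.
    set x := (g : 'rV[R]_m) ord0 a; set y := (g : 'rV[R]_m) ord0 b.
    rewrite ler_norml; have := sqr_ge0 (x - y)%R; have := sqr_ge0 (x + y)%R.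
    by have := sqr_ge0 x; have := sqr_ge0 y; move=> *; apply/andP; split; nra.
rewrite ge0_integralD//; last 2 first.
- by move=> g _; rewrite lee_fin sqr_ge0.
- by move=> g _; rewrite lee_fin sqr_ge0.
rewrite !(ge0_integral_entry _ _ mx2); last 2 first.
- by move=> x; rewrite lee_fin sqr_ge0.
- by move=> x; rewrite lee_fin sqr_ge0.
by rewrite kappaE -EFinD ltry.
Qed.

Lemma integral_mul_entries m (a b : 'I_m) :
  \int[gauss_mx 1 m]_g ((g : 'rV[R]_m) ord0 a * (g : 'rV[R]_m) ord0 b)%:E =
  (kappa *+ (a == b))%:E.
Proof.
have [<-|ab] := eqVneq a b.
  rewrite mulr1n -kappaE -(@ge0_integral_entry 1 m ord0 a (fun x => ((x : R) ^+ 2)%:E)).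
  - by apply: eq_integral => g _; rewrite expr2.
  - by apply/measurable_EFinP; exact: measurable_exprn_RM.
  - by move=> x; rewrite lee_fin sqr_ge0.
rewrite mulr0n.
pose f (g : mxMeas 1 m) := ((g : 'rV[R]_m) ord0 a * (g : 'rV[R]_m) ord0 b)%:E.
have fi := integrable_mul_entries a b.
have mf : measurable_fun setT f by exact: (measurable_int _ fi).
have flipE g : f (flip_entry a g) = (-1)%:E * f g.
  by rewrite /f !mxE eqxx eq_sym (negbTE ab) mulNr -EFinM mulN1r.
have E1 : \int[gauss_mx 1 m]_g f g = (-1)%:E * \int[gauss_mx 1 m]_g f g.
  rewrite -integralZl//.
  transitivity (\int[gauss_mx 1 m]_g (f \o flip_entry a) g).
    have fi' : (gauss_mx 1 m).-integrable (flip_entry a @^-1` setT) (f \o flip_entry a).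
      rewrite preimage_setT (_ : f \o flip_entry a = fun g => (-1)%:E * f g).
        exact: integrableZl.
      by apply/funext => g; rewrite /= flipE.
    rewrite -[RHS](integral_pushforward (measurable_flip_entry a) mf fi' measurableT).
    apply: eq_measure_integral; first exact: measurable_flip_entry.
    by move=> mfl A mA _; rewrite -[LHS](gauss_mx_flip_entry a mA).
  by apply: eq_integral => g _; rewrite /= flipE.
have ffin : \int[gauss_mx 1 m]_g f g \is a fin_num by exact: integrable_fin_num fi.
move: E1; rewrite -[\int[gauss_mx 1 m]_g ((g : 'rV[R]_m) ord0 a * _)%:E]/(\int[gauss_mx 1 m]_g f g).
move: ffin; case: (\int[gauss_mx 1 m]_g f g) => // r _ /eqP.
rewrite -EFinM eqe => /eqP rr; congr EFin; lra.
Qed.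

End Moments2.

(** * Second moments of Gram matrix entries *)

Section GramDeviation.
Context {R : realType}.
Notation RM := (measurableTypeR R).
Notation mxMeas := (@mxMeas R).
Notation gauss_mx := (@gauss_mx R).
Notation kappa := (@kappa R).
Notation mom4 := (@mom4 R).
Local Open Scope ereal_scope.

(** The cross term [2 S h] integrates to zero. This is the induction step in the additivity of
    variances, [S] being the sum over the other rows. *)
Lemma centered_shift_sqr d (T : measurableType d) (P : probability T R) (h : T -> R) (C S : R) :
  measurable_fun setT h -> P.-integrable setT (EFin \o h) ->
  \int[P]_x (h x)%:E = 0 -> \int[P]_x ((h x ^+ 2)%R)%:E <= C%:E ->
  \int[P]_x (((h x + S) ^+ 2)%R)%:E <= (C + S ^+ 2)%:E.
Proof.
move=> mh ih h0 hC.
have mh2 : measurable_fun setT (fun x => ((h x ^+ 2)%R)%:E).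
  by apply/measurable_EFinP; exact: measurable_funX.
have ih2 : P.-integrable setT (fun x => ((h x ^+ 2)%R)%:E).
  apply/integrableP; split => //.
  apply: (@le_lt_trans _ _ (C%:E)); last exact: ltry.
  apply: le_trans hC; rewrite le_eqVlt; apply/orP; left; apply/eqP.
  by apply: eq_integral => x _; rewrite gee0_abs// lee_fin sqr_ge0.
have ilin : P.-integrable setT (fun x => (2 * S)%:E * (h x)%:E) by exact: integrableZl.
have icst : P.-integrable setT (EFin \o cst (S ^+ 2)%R).
  exact: finite_measure_integrable_cst.
have icst' : P.-integrable setT (fun x => (S ^+ 2)%:E) by exact: icst.
have -> : \int[P]_x (((h x + S) ^+ 2)%R)%:E =
    \int[P]_x (((h x ^+ 2)%R)%:E + ((2 * S)%:E * (h x)%:E + (S ^+ 2)%:E)).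
  by apply: eq_integral => x _; rewrite -EFinM -!EFinD; congr EFin; ring.
rewrite integralD//; last exact: integrableD.
rewrite integralD// integralZl// h0 mule0 add0e EFinD.
rewrite integral_cst//; apply: leeD => //.
by rewrite -[leRHS]mule1 lee_wpmul2l// ?lee_fin ?sqr_ge0// probability_le1.
Qed.

(** Independent centred rows have additive variances, so the bound is linear in the number of rows.
    Against a mean Gram matrix whose square grows quadratically, this is what makes the relative
    deviation small. *)
Lemma row_sum_sqr m (h : mxMeas 1 m -> R) (C : R) :
  measurable_fun setT h -> (gauss_mx 1 m).-integrable setT (EFin \o h) ->
  \int[gauss_mx 1 m]_g (h g)%:E = 0 -> \int[gauss_mx 1 m]_g ((h g ^+ 2)%R)%:E <= C%:E ->
  forall n (P : pred 'I_n),
  \int[gauss_mx n m]_M (((\sum_(i | P i) h (row i (M : 'M[R]_(n, m)))) ^+ 2)%R)%:E <= (C *+ #|P|)%:E.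
Proof.
move=> mh ih h0 hC.
have C0 : (0 <= C)%R.
  rewrite -lee_fin; apply: le_trans hC; apply: integral_ge0 => g _.
  by rewrite lee_fin sqr_ge0.
elim=> [|n IH] P.
  apply: (@le_trans _ _ 0); last by rewrite lee_fin mulrn_wge0.
  rewrite le_eqVlt; apply/orP; left; apply/eqP; apply: integral0_eq => M _.
  by rewrite big1 ?expr0n// => -[].
pose P' (i : 'I_n) := P (lift ord0 i).
pose b := P ord0.
have cardP : #|P| = (b + #|P'|)%N.
  rewrite -!sum1_card big_mkcond big_ord_recl [in RHS]big_mkcond /=.
  by congr addn; rewrite unfold_in -/b; case: b.
have mrow k p (i : 'I_p) : measurable_fun setT (fun M : mxMeas p k => row i (M : 'M[R]_(p, k)) : mxMeas 1 k).
  apply: measurable_to_mx => i' j; under eq_fun do rewrite mxE.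
  exact: measurable_entry.
have msum p (Q : pred 'I_p) : measurable_fun setT
    (fun M : mxMeas p m => \sum_(i | Q i) h (row i (M : 'M[R]_(p, m))) : R)%R.
  by apply: measurable_sumR => i _; exact: (measurableT_comp mh (mrow _ _ _)).
have mcol := measurable_col_mx (@measurable_fst _ _ (mxMeas 1 m) (mxMeas n m))
  (@measurable_snd _ _ (mxMeas 1 m) (mxMeas n m)).
pose f (M : mxMeas n.+1 m) : \bar R := (((\sum_(i | P i) h (row i (M : 'M[R]_(n.+1, m)))) ^+ 2)%R)%:E.
have mf : measurable_fun setT f.
  by apply/measurable_EFinP; apply: measurable_funX; exact: msum.
have f0 M : 0 <= f M by rewrite lee_fin sqr_ge0.
pose F (x : mxMeas 1 m * mxMeas n m) := f (col_mx (x.1 : 'rV[R]_m) (x.2 : 'M[R]_(n, m))).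
have mF : measurable_fun setT F by exact: (measurableT_comp mf mcol).
have FE g G : F (g, G) = (((h g *+ b + \sum_(i | P' i) h (row i (G : 'M[R]_(n, m)))) ^+ 2)%R)%:E.
  rewrite /F /f /=; congr ((_ ^+ 2)%:E).
  rewrite big_mkcond big_ord_recl [in RHS]big_mkcond /=; congr (_ + _)%R.
    rewrite -/b; case: (b); rewrite ?mulr1n ?mulr0n//; congr h.
    apply/rowP => j; rewrite mxE (_ : ord0 = lshift n (ord0 : 'I_1)); last exact: val_inj.
    by rewrite (@col_mxEu _ 1 n).
  apply: eq_bigr => i _; rewrite -/(P' i); case: (P' i) => //.
  congr h; apply/rowP => j; rewrite [LHS]mxE [RHS]mxE (_ : lift ord0 i = rshift 1 i); last exact: val_inj.
  by rewrite (@col_mxEd _ 1 n).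
have -> : \int[gauss_mx n.+1 m]_M f M = \int[gauss_mx 1 m \x gauss_mx n m]_x F x.
  transitivity (\int[pushforward_prob (gauss_mx 1 m \x gauss_mx n m) mcol]_x f x).
    apply: eq_measure_integral => A mA _.
    exact/esym/(@gauss_mx_col_mx _ 1 n).
  by rewrite [LHS](ge0_integral_pushforward mcol).
have F0 x : 0 <= F x by exact: f0.
rewrite (fubini_tonelli2 (m1 := gauss_mx 1 m) (m2 := gauss_mx n m) F mF F0).
pose S (G : mxMeas n m) : R := (\sum_(i | P' i) h (row i (G : 'M[R]_(n, m))))%R.
have mS2 : measurable_fun setT (fun G => ((S G ^+ 2)%R)%:E).
  by apply/measurable_EFinP; apply: measurable_funX; exact: msum.
have mconst : measurable_fun (setT : set (mxMeas n m)) (fun=> (C *+ b)%:E : \bar R).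
  exact: measurable_cst.
apply: (@le_trans _ _ (\int[gauss_mx n m]_G ((C *+ b)%:E + ((S G ^+ 2)%R)%:E))).
  apply: ge0_le_integral => //.
  - by move=> G _; apply: integral_ge0.
  - exact: measurable_fun_fubini_tonelli_G.
  - exact: emeasurable_funD.
  move=> G _; rewrite /fubini_G -EFinD.
  rewrite (_ : \int[gauss_mx 1 m]_x F (x, G) = \int[gauss_mx 1 m]_x (((h x *+ b + S G) ^+ 2)%R)%:E); last first.
    by apply: eq_integral => g _; rewrite FE.
  case: (b); first exact: centered_shift_sqr.
  under eq_integral do rewrite mulr0n add0r.
  rewrite integral_cst// mulr0n add0r.
  by rewrite -[leRHS]mule1 lee_wpmul2l// ?lee_fin ?sqr_ge0// probability_le1.
rewrite ge0_integralD//; last 2 first.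
- by move=> G _; rewrite lee_fin mulrn_wge0.
- by move=> G _; rewrite lee_fin sqr_ge0.
rewrite cardP mulrnDr EFinD integral_cst//; apply: leeD; last exact: IH.
by rewrite -[leRHS]mule1 lee_wpmul2l// ?lee_fin ?mulrn_wge0// probability_le1.
Qed.

(** Bounds the variance of one summand [g_a g_b - z], where [z] is [kappa] or 0, through
    [(x y - z)^2 <= x^4 + y^4 + 2 z^2]. *)
Definition gram_const : R := (2 * mom4 + 2 * kappa ^+ 2)%R.

Lemma gram_const_ge0 : (0 <= gram_const)%R.
Proof. by rewrite addr_ge0// mulr_ge0// ?mom4_ge0// sqr_ge0. Qed.

Lemma gram_entry_dev n m (P : pred 'I_n) (a b : 'I_m) :
  \int[gauss_mx n m]_M (((\sum_(i | P i) ((M : 'M[R]_(n, m)) i a * (M : 'M[R]_(n, m)) i b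
     - kappa *+ (a == b))) ^+ 2)%R)%:E <= (gram_const *+ #|P|)%:E.
Proof.
pose h (g : mxMeas 1 m) : R := ((g : 'rV[R]_m) ord0 a * (g : 'rV[R]_m) ord0 b - kappa *+ (a == b))%R.
have mh : measurable_fun setT h.
  by apply: measurable_funB => //; exact: measurable_mul_entries.
have icst : (gauss_mx 1 m).-integrable setT (EFin \o cst (- (kappa *+ (a == b)))%R).
  exact: finite_measure_integrable_cst.
have hE : EFin \o h = (fun g : mxMeas 1 m => ((g : 'rV[R]_m) ord0 a * (g : 'rV[R]_m) ord0 b)%:E)
    \+ (EFin \o cst (- (kappa *+ (a == b)))%R).
  by apply/funext => g; rewrite /= -EFinD.
have ih : (gauss_mx 1 m).-integrable setT (EFin \o h).
  by rewrite hE; apply: integrableD => //; exact: integrable_mul_entries.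
have h0 : \int[gauss_mx 1 m]_g (h g)%:E = 0.
  have -> : \int[gauss_mx 1 m]_g (h g)%:E = \int[gauss_mx 1 m]_g
      (((g : 'rV[R]_m) ord0 a * (g : 'rV[R]_m) ord0 b)%:E + (EFin \o cst (- (kappa *+ (a == b)))%R) g).
    by apply: eq_integral => g _; rewrite /= -EFinD.
  rewrite integralD//; last exact: integrable_mul_entries.
  rewrite integral_mul_entries.
  have -> : \int[gauss_mx 1 m]_g (EFin \o cst (- (kappa *+ (a == b)))%R) g = (- (kappa *+ (a == b)))%:E.
    etransitivity; first exact: (integral_cst (gauss_mx 1 m) measurableT (- (kappa *+ (a == b)))%:E).
    rewrite -[RHS]mule1; congr (_ * _); exact: (@probability_setT _ _ _ (gauss_mx 1 m)).
  by rewrite -EFinD subrr.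
have m4 a' : measurable_fun setT (fun g : mxMeas 1 m => (((g : 'rV[R]_m) ord0 a' ^+ 4)%R : R)%:E).
  by apply/measurable_EFinP; apply: measurable_funX; exact: measurable_entry.
have mx4 : measurable_fun (setT : set RM) (fun x : RM => ((x ^+ 4)%R : R)%:E).
  by apply/measurable_EFinP; exact: measurable_exprn_RM.
have p4 (x : R) : (0 <= x ^+ 4)%R by rewrite (exprM x 2 2) sqr_ge0.
have hC : \int[gauss_mx 1 m]_g ((h g ^+ 2)%R)%:E <= gram_const%:E.
  have mcst : measurable_fun (setT : set (mxMeas 1 m)) (fun=> (2 * kappa ^+ 2)%:E : \bar R).
    exact: measurable_cst.
  apply: (@le_trans _ _ (\int[gauss_mx 1 m]_g (((g : 'rV[R]_m) ord0 a ^+ 4)%:E +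
      (((g : 'rV[R]_m) ord0 b ^+ 4)%:E + (2 * kappa ^+ 2)%:E)))).
    apply: ge0_le_integral => //.
    - by move=> g _; rewrite lee_fin sqr_ge0.
    - by apply/measurable_EFinP; exact: measurable_funX.
    - by apply: emeasurable_funD => //; exact: emeasurable_funD.
    move=> g _; rewrite -!EFinD lee_fin /h.
    set x := (g : 'rV[R]_m) ord0 a; set y := (g : 'rV[R]_m) ord0 b.
    have k0 := @kappa_gt0 R.
    have hk : ((kappa *+ (a == b)) ^+ 2 <= kappa ^+ 2)%R.
      by case: (a == b); rewrite ?mulr1n// mulr0n expr0n/= sqr_ge0.
    set z := (kappa *+ (a == b))%R in hk *.
    have e1 : ((x * y - z) ^+ 2 <= 2 * (x * y) ^+ 2 + 2 * z ^+ 2)%R.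
      have := sqr_ge0 (x * y + z)%R; nra.
    have e2 : (2 * (x * y) ^+ 2 <= x ^+ 4 + y ^+ 4)%R.
      rewrite (exprM x 2 2) (exprM y 2 2) exprMn.
      have := sqr_ge0 (x ^+ 2 - y ^+ 2)%R; nra.
    lra.
  rewrite ge0_integralD//; last 3 first.
  - by move=> g _; rewrite lee_fin.
  - by move=> g _; rewrite adde_ge0// lee_fin// mulr_ge0// sqr_ge0.
  - exact: emeasurable_funD.
  rewrite ge0_integralD//; last 2 first.
  - by move=> g _; rewrite lee_fin.
  - by move=> g _; rewrite lee_fin mulr_ge0// sqr_ge0.
  rewrite !(ge0_integral_entry _ _ mx4); last 2 first.
  - by move=> x; rewrite lee_fin.
  - by move=> x; rewrite lee_fin.
  rewrite mom4E integral_cst//.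
  rewrite [X in _ * X](@probability_setT _ _ _ (gauss_mx 1 m)) mule1 -!EFinD lee_fin /gram_const.
  lra.
have := row_sum_sqr mh ih h0 hC P.
congr (_ <= _); apply: eq_integral => M _; congr ((_ ^+ 2)%:E).
by apply: eq_bigr => i _; rewrite /h !mxE.
Qed.

End GramDeviation.

(** * Tail events from Markov's inequality *)

Section Events.
Context {R : realType}.
Notation RM := (measurableTypeR R).
Notation mxMeas := (@mxMeas R).
Notation gauss_mx := (@gauss_mx R).
Notation kappa := (@kappa R).
Local Open Scope ereal_scope.

Lemma markov_real d (T : measurableType d) (P : probability T R) (f : T -> R) (K t : R) :
  measurable_fun setT f -> (forall x, 0 <= f x)%R -> (0 < t)%R ->
  \int[P]_x (f x)%:E <= K%:E ->
  P [set x | (t <= f x)%R] <= (K / t)%:E.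
Proof.
move=> mf f0 t0 fK.
have mE : measurable [set x | (t <= f x)%R].
  rewrite (_ : [set x | _] = f @^-1` `[t, +oo[%classic); last first.
    by apply/seteqP; split => x /=; rewrite in_itv/= andbT.
  by rewrite -[X in measurable X]setTI; exact: mf.
have H : t%:E * P [set x | (t <= f x)%R] <= K%:E.
  apply: le_trans fK.
  rewrite -(integral_cst P mE t%:E) integral_mkcond.
  apply: ge0_le_integral => //.
  - by move=> x _; rewrite patchE; case: ifP => // _; rewrite lee_fin ltW.
  - apply/(measurable_restrictT _ mE); exact: measurable_cst.
  - exact/measurable_EFinP.
  - move=> x _; rewrite patchE; case: ifPn => [|_]; last by rewrite lee_fin.
    by rewrite inE /= lee_fin.
by rewrite EFinM lee_pdivlMr// muleC.
Qed.

(** Squared Frobenius distance from the Gram matrix of the rows in [P] to [kappa * #|P|] times the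
    identity. It controls the quadratic form in every direction, yet it is a polynomial in the
    entries, so it is measurable and its mean is easy to bound; the loss is polynomial in [m]. *)
Definition gram_dev n m (P : pred 'I_n) (M : 'M[R]_(n, m)) : R :=
  (\sum_(a < m) \sum_(b < m)
    (\sum_(i | P i) (M i a * M i b - kappa *+ (a == b))) ^+ 2)%R.

Lemma gram_dev_ge0 n m (P : pred 'I_n) (M : 'M[R]_(n, m)) : (0 <= gram_dev P M)%R.
Proof. by apply: sumr_ge0 => a _; apply: sumr_ge0 => b _; exact: sqr_ge0. Qed.

Lemma measurable_gram_dev n m (P : pred 'I_n) : measurable_fun setT (@gram_dev n m P : mxMeas n m -> R).
Proof.
apply: measurable_sumR => a _; apply: measurable_sumR => b _.
apply: measurable_funX; apply: measurable_sumR => i _.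
by apply: measurable_funB => //; exact: measurable_mul_entries.
Qed.

Lemma ge0_integral_sumR d (T : measurableType d) (P : probability T R) n
    (f : 'I_n -> T -> R) (C : R) :
  (forall i, measurable_fun setT (f i)) -> (forall i x, 0 <= f i x)%R ->
  (forall i, \int[P]_x (f i x)%:E <= C%:E) ->
  \int[P]_x (\sum_(i < n) f i x)%R%:E <= (C *+ n)%:E.
Proof.
move=> mf f0 fC.
have -> : \int[P]_x (\sum_(i < n) f i x)%R%:E = \int[P]_x \sum_(i < n) (f i x)%:E.
  by apply: eq_integral => x _; rewrite sumEFin.
rewrite ge0_integral_sum//; last 2 first.
- by move=> i; exact/measurable_EFinP.
- by move=> i x _; rewrite lee_fin.
apply: (@le_trans _ _ (\sum_(i < n) C%:E)); first by apply: lee_sum.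
by rewrite sumEFin sumr_const card_ord.
Qed.

Lemma integral_gram_dev_le n m (P : pred 'I_n) :
  \int[gauss_mx n m]_M (gram_dev P (M : 'M[R]_(n, m)))%:E <= (@gram_const R *+ #|P| *+ m *+ m)%:E.
Proof.
have mterm a b : measurable_fun setT (fun M : mxMeas n m =>
    (\sum_(i | P i) ((M : 'M[R]_(n, m)) i a * (M : 'M[R]_(n, m)) i b - kappa *+ (a == b))) ^+ 2 : R)%R.
  apply: measurable_funX; apply: measurable_sumR => i _.
  by apply: measurable_funB => //; exact: measurable_mul_entries.
apply: ge0_integral_sumR => [a|a M|a].
- by apply: measurable_sumR => b _; exact: mterm.
- by apply: sumr_ge0 => b _; exact: sqr_ge0.
apply: ge0_integral_sumR => [b|b M|b].
- exact: mterm.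
- exact: sqr_ge0.
exact: gram_entry_dev.
Qed.

Lemma measurable_ge_set d (T : measurableType d) (f : T -> R) (t : R) :
  measurable_fun setT f -> measurable [set x | (t <= f x)%R].
Proof.
move=> mf; rewrite (_ : [set x | _] = f @^-1` `[t, +oo[%classic); last first.
  by apply/seteqP; split => x /=; rewrite in_itv/= andbT.
by rewrite -[X in measurable X]setTI; exact: mf.
Qed.

Lemma gram_dev_tail n m (P : pred 'I_n) (t : R) : (0 < t)%R ->
  gauss_mx n m [set M | (t <= gram_dev P (M : 'M[R]_(n, m)))%R] <= ((@gram_const R *+ #|P| *+ m *+ m) / t)%:E.
Proof.
move=> t0; apply: markov_real => //; first exact: measurable_gram_dev.
  by move=> M; exact: gram_dev_ge0.
exact: integral_gram_dev_le.
Qed.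

(** All blocks are treated at once: the sum dominates each deviation, so one Markov bound replaces a
    union over the [s] blocks. *)
Lemma sum_gram_dev_tail n m s (P : 'I_s -> pred 'I_n) (b : nat) (t : R) : (0 < t)%R ->
  (forall l, #|P l| = b) ->
  gauss_mx n m [set M | (t <= \sum_(l < s) gram_dev (P l) (M : 'M[R]_(n, m)))%R] <=
    ((@gram_const R *+ b *+ m *+ m *+ s) / t)%:E.
Proof.
move=> t0 Pb; apply: markov_real => //.
- by apply: measurable_sumR => l _; exact: measurable_gram_dev.
- by move=> M; apply: sumr_ge0 => l _; exact: gram_dev_ge0.
apply: ge0_integral_sumR => [l|l M|l].
- exact: measurable_gram_dev.
- exact: gram_dev_ge0.
by rewrite -(Pb l); exact: integral_gram_dev_le.
Qed.

Lemma row_norm_tail n m (i : 'I_n) (t : R) : (0 < t)%R ->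
  gauss_mx n m [set M | (t <= \sum_(j < m) (M : 'M[R]_(n, m)) i j ^+ 2)%R] <= (kappa *+ m / t)%:E.
Proof.
move=> t0; apply: markov_real => //.
- by apply: measurable_sumR => j _; apply: measurable_funX; exact: measurable_entry.
- by move=> M; apply: sumr_ge0 => j _; exact: sqr_ge0.
apply: ge0_integral_sumR => [j|j M|j].
- by apply: measurable_funX; exact: measurable_entry.
- exact: sqr_ge0.
rewrite (@ge0_integral_entry _ n m i j (fun x => ((x : R) ^+ 2)%R%:E)).
- by rewrite kappaE.
- by apply/measurable_EFinP; exact: measurable_exprn_RM.
- by move=> x; rewrite lee_fin sqr_ge0.
Qed.

End Events.

(** * Chebyshev polynomials *)

Section Chebyshev.
Context {R : realType}.

Fixpoint cheb k : {poly R} :=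
  match k with
  | 0 => 1
  | k1.+1 => match k1 with
             | 0 => 'X
             | k2.+1 => 2 *: ('X * cheb k1) - cheb k2
             end
  end.

Lemma cheb_ind (Q : nat -> {poly R} -> Prop) :
  Q 0%N 1 -> Q 1%N 'X ->
  (forall k, Q k (cheb k) -> Q k.+1 (cheb k.+1) -> Q k.+2 (2 *: ('X * cheb k.+1) - cheb k)) ->
  forall k, Q k (cheb k).
Proof.
move=> Q0 Q1 QS k; suff: Q k (cheb k) /\ Q k.+1 (cheb k.+1) by case.
by elim: k => [|k [Qk QSk]]; split=> //; exact: QS.
Qed.

Lemma size_cheb k : (size (cheb k) <= k.+1)%N.
Proof.
apply: (@cheb_ind (fun k p => (size p <= k.+1)%N)) => [||j s0 s1].
- by rewrite size_poly1.
- by rewrite size_polyX.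
apply: (leq_trans (size_polyD _ _)); rewrite geq_max size_polyN; apply/andP; split.
  apply: (leq_trans (size_scale_leq _ _)).
  apply: (leq_trans (size_polyMleq _ _)); rewrite size_polyX /=.
  exact: s1.
by apply: (leq_trans s0); rewrite ltnS leqW.
Qed.

Lemma cheb_cos k t : (cheb k).[cos t] = cos (k%:R * t).
Proof.
apply: (@cheb_ind (fun k p => p.[cos t] = cos (k%:R * t))) => [||j e0 e1].
- by rewrite hornerC mul0r cos0.
- by rewrite hornerX mul1r.
rewrite hornerD hornerN hornerZ hornerM hornerX e0 e1.
have -> : j.+2%:R * t = j.+1%:R * t + t by rewrite -[j.+2]addn1 natrD mulrDl mul1r.
have -> : j%:R * t = j.+1%:R * t - t by rewrite -[j.+1]addn1 natrD mulrDl mul1r addrK.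
rewrite cosB cosD; ring.
Qed.

(** The Joukowski substitution solves the three-term recurrence by [z ^+ k + z ^- k], which
    describes the growth of the polynomial to the right of 1, where the cosine formula says
    nothing. *)
Lemma cheb_joukowski k (z : R) : z != 0 ->
  2 * (cheb k).[(z + z^-1) / 2] = z ^+ k + z ^- k.
Proof.
move=> z0.
apply: (@cheb_ind (fun k p => 2 * p.[(z + z^-1) / 2] = z ^+ k + z ^- k)) => [||j e0 e1].
- by rewrite hornerC expr0 invr1; ring.
- by rewrite hornerX expr1; field.
rewrite hornerD hornerN hornerZ hornerM hornerX mulrBr e0.
have -> : 2 * (2 * ((z + z^-1) / 2 * (cheb j.+1).[(z + z^-1) / 2])) =
  (z + z^-1) * (2 * (cheb j.+1).[(z + z^-1) / 2]) by field.
rewrite e1 !exprS; field.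
by rewrite z0 expf_neq0.
Qed.

(** Lagrange interpolation: [p] minus its interpolant has size at most [n] and vanishes at [n]
    distinct points. *)
Lemma lagrange_eval n (mu : 'I_n -> R) (p : {poly R}) x : injective mu ->
  (size p <= n)%N ->
  p.[x] = \sum_(l < n) p.[mu l] * \prod_(j < n | j != l) ((x - mu j) / (mu l - mu j)).
Proof.
move=> mu_inj sp.
pose ell l : {poly R} := \prod_(j < n | j != l) ((mu l - mu j)^-1 *: ('X - (mu j)%:P)).
have ellE l y : (ell l).[y] = \prod_(j < n | j != l) ((y - mu j) / (mu l - mu j)).
  rewrite /ell horner_prod; apply: eq_bigr => j _.
  by rewrite hornerZ hornerXsubC mulrC.
have size_ell l : (size (ell l) <= n)%N.
  rewrite /ell; apply: (leq_trans (size_poly_prod_leq _ _)).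
  rewrite leq_subLR; apply: (@leq_trans (\sum_(j < n | j != l) 2).+1).
    rewrite ltnS; apply: leq_sum => j _.
    by apply: (leq_trans (size_scale_leq _ _)); rewrite size_XsubC.
  rewrite sum_nat_const.
  have cardn : n = #|fun j : 'I_n => j != l|.+1.
    by rewrite -[in LHS](card_ord n) (cardD1 l) add1n; congr _.+1; apply: eq_card => j; rewrite !inE andbT.
  set c := #|_| in cardn *.
  by rewrite [X in (_ < _ + X)%N]cardn muln2 -addnn addnS ltnS.
pose q := p - \sum_(l < n) p.[mu l] *: ell l.
have q0 : q = 0.
  apply: (@roots_geq_poly_eq0 _ _ [seq mu i | i <- enum 'I_n]).
  - apply/allP => _ /mapP[i _ ->]; rewrite /root hornerD hornerN horner_sum.
    rewrite (bigD1 i)//= big1 ?addr0.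
      rewrite hornerZ ellE big1 ?mulr1 ?subrr// => j ji.
      by rewrite divff// subr_eq0 (inj_eq mu_inj) eq_sym.
    move=> l li; rewrite hornerZ ellE (bigD1 i) 1?eq_sym//=.
    by rewrite subrr mul0r mul0r mulr0.
  - by rewrite map_inj_uniq ?enum_uniq.
  - rewrite size_map size_enum_ord.
    apply: (leq_trans (size_polyD _ _)); rewrite geq_max sp size_polyN /=.
    apply: (leq_trans (size_sum _ _ _)); apply/bigmax_leqP => l _.
    exact: (leq_trans (size_scale_leq _ _)).
have -> : p.[x] = (\sum_(l < n) p.[mu l] *: ell l).[x].
  by congr horner; apply/eqP; rewrite -subr_eq0; apply/eqP.
rewrite horner_sum; apply: eq_bigr => l _; by rewrite hornerZ ellE.
Qed.

Definition chebnode L (l : nat) : R := cos (l%:R / L%:R * pi).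

Lemma chebnode_decr L (l j : 'I_L.+1) : (0 < L)%N -> (l < j)%N ->
  chebnode L j < chebnode L l.
Proof.
move=> L0 lj.
have L0' : 0 < L%:R :> R by rewrite ltr0n.
have bnd (i : 'I_L.+1) : (i%:R / L%:R * pi : R) \in `[0, pi].
  rewrite in_itv/=; apply/andP; split.
    by rewrite !mulr_ge0 ?invr_ge0 ?pi_ge0.
  rewrite ger_pMl ?pi_gt0// ler_pdivrMr// mul1r ler_nat.
  by rewrite -ltnS.
rewrite /chebnode ltr_cos// ltr_pM2r ?pi_gt0// ltr_pM2r ?invr_gt0//.
by rewrite ltr_nat.
Qed.

Lemma cheb_chebnode L (l : nat) : (0 < L)%N -> (cheb L).[chebnode L l] = (-1) ^+ l.
Proof.
move=> L0; rewrite cheb_cos.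
have -> : L%:R * (l%:R / L%:R * pi) = l%:R * pi :> R.
  by field; rewrite pnatr_eq0 -lt0n.
elim: l => [|l IH]; first by rewrite mul0r cos0.
by rewrite -[l.+1]addn1 natrD mulrDl mul1r cosDpi IH exprD expr1 mulrN1.
Qed.

(** At a point [x >= 1], no node exceeds [x], and the Lagrange weight [e l] has the sign
    [(-1) ^+ l], which is also the value of [cheb L] at the node. Hence [(cheb L).[x]] is the sum of
    the [|e l|], and a polynomial bounded by [M] at the nodes is at most [M] times it; here [M] is
    the Euclidean norm of the node values. *)
Lemma cheb_extremal L (p : {poly R}) (x : R) : (0 < L)%N -> 1 <= x ->
  (size p <= L.+1)%N ->
  p.[x] ^+ 2 <= (cheb L).[x] ^+ 2 * \sum_(l < L.+1) p.[chebnode L l] ^+ 2.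
Proof.
move=> L0 x1 sp.
pose mu (l : 'I_L.+1) := chebnode L l.
have mu_inj : injective mu.
  move=> l j mlj; have [lj|jl|/val_inj//] := ltngtP l j.
    by have := chebnode_decr L0 lj; rewrite -/(mu l) -/(mu j) mlj ltxx.
  by have := chebnode_decr L0 jl; rewrite -/(mu l) -/(mu j) mlj ltxx.
pose e (l : 'I_L.+1) := \prod_(j < L.+1 | j != l) ((x - mu j) / (mu l - mu j)).
have e_sign (l : 'I_L.+1) : 0 <= (-1) ^+ l * e l.
  (* The nodes decrease with the index, so [mu l - mu j] is negative exactly for the [l] indices
     [j < l]. *)
  have -> : (-1) ^+ l = \prod_(j < L.+1 | j != l) (if (j < l)%N then -1 else 1) :> R.
    rewrite -[RHS]big_mkcondr [RHS](eq_bigl (fun j : 'I_L.+1 => (j < l)%N)); last first.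
      by move=> j /=; case: eqVneq => [->|]; rewrite ?ltnn.
    rewrite prodr_const; congr (_ ^+ _).
    rewrite -sum1_card -(big_ord_widen _ (fun=> 1%N)) ?sum1_card ?card_ord//.
    exact: ltnW.
  rewrite -big_split /=; apply: prodr_ge0 => j jl.
  have xm : 0 <= x - mu j by rewrite subr_ge0 (le_trans _ x1)// cos_le1.
  have [jl'|lj] := ltnP j l.
    have := chebnode_decr L0 jl'; rewrite -/(mu j) -/(mu l) => d.
    by rewrite mulN1r -mulrN -invrN opprB divr_ge0// subr_ge0 ltW.
  have {}lj : (l < j)%N by rewrite ltn_neqAle lj andbT eq_sym.
  have := chebnode_decr L0 lj; rewrite -/(mu j) -/(mu l) => d.
  by rewrite mul1r divr_ge0// subr_ge0 ltW.
have TE : (cheb L).[x] = \sum_(l < L.+1) (-1) ^+ l * e l.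
  rewrite (lagrange_eval x mu_inj (size_cheb L)); apply: eq_bigr => l _.
  by rewrite cheb_chebnode.
have pE : p.[x] = \sum_(l < L.+1) p.[mu l] * e l by exact: lagrange_eval.
have T0 : 0 <= (cheb L).[x] by rewrite TE; apply: sumr_ge0 => l _; exact: e_sign.
set S := \sum_(l < L.+1) _.
have S0 : 0 <= S by apply: sumr_ge0 => l _; exact: sqr_ge0.
have pl l : `|p.[mu l]| <= Num.sqrt S.
  rewrite -sqrtr_sqr ler_wsqrtr// /S (bigD1 l)//= lerDl.
  by apply: sumr_ge0 => j _; exact: sqr_ge0.
have : `|p.[x]| <= Num.sqrt S * (cheb L).[x].
  rewrite pE (le_trans (ler_norm_sum _ _ _))// TE mulr_sumr; apply: ler_sum => l _.
  rewrite normrM; apply: ler_pM => //.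
  by rewrite -(ger0_norm (e_sign l)) normrM normrX normrN1 expr1n mul1r.
move=> H; rewrite -real_normK ?num_real// mulrC.
have -> : S * (cheb L).[x] ^+ 2 = (Num.sqrt S * (cheb L).[x]) ^+ 2 by rewrite exprMn sqr_sqrtr.
by rewrite ler_pXn2r// nnegrE// mulr_ge0// sqrtr_ge0.
Qed.

Lemma cheb_growth L (z : R) : 1 <= z -> (cheb L).[(z + z^-1) / 2] <= z ^+ L.
Proof.
move=> z1; have z0 : 0 < z by exact: lt_le_trans z1.
have := cheb_joukowski L (lt0r_neq0 z0).
have zL : 1 <= z ^+ L by exact: exprn_ege1.
have : z ^- L <= 1 by rewrite invf_le1// (lt_le_trans _ zL).
lra.
Qed.

End Chebyshev.

(** * Norms *)

Section Norms.
Context {R : realType}.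
Notation kappa := (@kappa R).

Lemma cauchy_schwarz (I : finType) (P : pred I) (x y : I -> R) :
  (\sum_(i | P i) x i * y i) ^+ 2 <= (\sum_(i | P i) x i ^+ 2) * (\sum_(i | P i) y i ^+ 2).
Proof.
set a := \sum_(i | P i) x i ^+ 2; set c := \sum_(i | P i) y i ^+ 2.
set b := \sum_(i | P i) _.
have a0 : 0 <= a by apply: sumr_ge0 => i _; exact: sqr_ge0.
have [a00|an0] := eqVneq a 0.
  have -> : b = 0.
    rewrite /b big1// => i Pi.
    move/eqP: a00; rewrite psumr_eq0; last by move=> j _; exact: sqr_ge0.
    move/allP/(_ i (mem_index_enum i)); rewrite Pi /= sqrf_eq0 => /eqP ->.
    by rewrite mul0r.
  by rewrite a00 mul0r expr0n.
have : 0 <= \sum_(i | P i) (a * y i - b * x i) ^+ 2 by apply: sumr_ge0 => i _; exact: sqr_ge0.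
have -> : \sum_(i | P i) (a * y i - b * x i) ^+ 2 = a * (a * c - b ^+ 2).
  rewrite (eq_bigr (fun i => a ^+ 2 * y i ^+ 2 - (2 * a * b) * (x i * y i) + b ^+ 2 * x i ^+ 2)).
    rewrite big_split sumrB /= -!mulr_sumr -/a -/b -/c; ring.
  by move=> i _; ring.
by rewrite pmulr_rge0 ?subr_ge0// lt_neqAle eq_sym an0.
Qed.

(** The difference pairs the matrix [c c^T] with the deviation matrix [D]. Cauchy-Schwarz over pairs
    of indices then gives the Frobenius norm of [D], that of [c c^T] being the squared norm of
    [c]. *)
Lemma gram_quadratic n m (P : pred 'I_n) (M : 'M[R]_(n, m)) (c : 'I_m -> R) :
  (\sum_(i | P i) (\sum_a M i a * c a) ^+ 2 - kappa * #|P|%:R * \sum_a c a ^+ 2) ^+ 2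
  <= (\sum_a c a ^+ 2) ^+ 2 * gram_dev P M.
Proof.
have sumP (x : R) : \sum_(i | P i) x = x *+ #|P| by exact: (sumr_const P).
pose D a b := \sum_(i | P i) (M i a * M i b - kappa *+ (a == b)).
have -> : \sum_(i | P i) (\sum_a M i a * c a) ^+ 2 - kappa * #|P|%:R * \sum_a c a ^+ 2 =
    \sum_(ab : 'I_m * 'I_m) (c ab.1 * c ab.2) * D ab.1 ab.2.
  have -> : \sum_(i | P i) (\sum_a M i a * c a) ^+ 2 =
      \sum_a \sum_b c a * c b * \sum_(i | P i) M i a * M i b.
    under eq_bigr do rewrite expr2 mulr_suml.
    rewrite exchange_big; apply: eq_bigr => a _ /=.
    under eq_bigr do rewrite mulr_sumr.
    rewrite exchange_big; apply: eq_bigr => b _ /=.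
    by rewrite mulr_sumr; apply: eq_bigr => i _; ring.
  have -> : kappa * #|P|%:R * \sum_a c a ^+ 2 =
      \sum_a \sum_b c a * c b * \sum_(i | P i) (kappa *+ (a == b)).
    rewrite mulr_sumr; apply: eq_bigr => a _.
    rewrite (bigD1 a)//= [X in _ + X]big1 ?addr0.
      by rewrite sumP ?eqxx ?mulr1n -[in RHS]mulr_natr; ring.
    move=> b ba; rewrite eq_sym (negbTE ba) sumP mulr0n mul0rn.
    by rewrite mulr0.
  rewrite -sumrB -(pair_bigA _ (fun a b => c a * c b * D a b)) /=; apply: eq_bigr => a _.
  rewrite -sumrB; apply: eq_bigr => b _.
  by rewrite -mulrBr /D sumrB.
apply: (le_trans (cauchy_schwarz _ _ _)).
rewrite -(pair_bigA _ (fun a b => (c a * c b) ^+ 2)) /=.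
rewrite -(pair_bigA _ (fun a b => D a b ^+ 2)) /= /gram_dev.
rewrite le_eqVlt; apply/orP; left; apply/eqP; congr (_ * _).
rewrite expr2 mulr_suml; apply: eq_bigr => a _.
by rewrite mulr_sumr; apply: eq_bigr => b _; rewrite exprMn.
Qed.

Lemma gram_quadratic_bounds n m (P : pred 'I_n) (M : 'M[R]_(n, m)) (t : R) (c : 'I_m -> R) :
  0 <= t -> gram_dev P M <= t ^+ 2 ->
  (kappa * #|P|%:R - t) * \sum_a c a ^+ 2 <= \sum_(i | P i) (\sum_a M i a * c a) ^+ 2
  <= (kappa * #|P|%:R + t) * \sum_a c a ^+ 2.
Proof.
move=> t0 Mt; have := gram_quadratic P M c.
set q := \sum_(i | P i) _; set S := \sum_a _; set N := kappa * _.
have S0 : 0 <= S by apply: sumr_ge0 => a _; exact: sqr_ge0.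
move=> H; have {}H : (q - N * S) ^+ 2 <= (t * S) ^+ 2.
  by rewrite (le_trans H)// exprMn mulrC ler_wpM2r// sqr_ge0.
have : `|q - N * S| <= t * S.
  by rewrite -(ler_pXn2r (n := 2))// ?nnegrE ?mulr_ge0// real_normK ?num_real.
rewrite ler_norml => /andP[h1 h2]; apply/andP; split; lra.
Qed.

Definition sqnorm n (x : 'cV[R]_n) : R := \sum_i x i ord0 ^+ 2.

Lemma sqnorm_ge0 n (x : 'cV[R]_n) : 0 <= sqnorm x.
Proof. by apply: sumr_ge0 => i _; exact: sqr_ge0. Qed.

Lemma vnorm2E n (x : 'cV[R]_n) : vnorm2 x = Num.sqrt (sqnorm x).
Proof. by []. Qed.

Lemma vnorm2_ge0 n (x : 'cV[R]_n) : 0 <= vnorm2 x.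
Proof. exact: sqrtr_ge0. Qed.

Lemma vnorm2_sqr n (x : 'cV[R]_n) : vnorm2 x ^+ 2 = sqnorm x.
Proof. by rewrite vnorm2E sqr_sqrtr// sqnorm_ge0. Qed.

Lemma sqnormE n (x : 'cV[R]_n) : (x^T *m x) ord0 ord0 = sqnorm x.
Proof. by rewrite mxE; apply: eq_bigr => i _; rewrite mxE expr2. Qed.

Lemma sqnormZ n a (x : 'cV[R]_n) : sqnorm (a *: x) = a ^+ 2 * sqnorm x.
Proof. by rewrite /sqnorm mulr_sumr; apply: eq_bigr => i _; rewrite mxE exprMn. Qed.

Lemma vnorm2Z n a (x : 'cV[R]_n) : vnorm2 (a *: x) = `|a| * vnorm2 x.
Proof. by rewrite !vnorm2E sqnormZ sqrtrM ?sqr_ge0// sqrtr_sqr. Qed.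

Lemma sqnorm_dot n (x y : 'cV[R]_n) : ((x^T *m y) ord0 ord0) ^+ 2 <= sqnorm x * sqnorm y.
Proof.
rewrite mxE; under eq_bigr do rewrite mxE; exact: cauchy_schwarz.
Qed.

Lemma vnorm2D n (x y : 'cV[R]_n) : vnorm2 (x + y) <= vnorm2 x + vnorm2 y.
Proof.
rewrite -(ler_pXn2r (n := 2))// ?nnegrE ?addr_ge0 ?vnorm2_ge0//.
have xy : \sum_i x i ord0 * y i ord0 <= vnorm2 x * vnorm2 y.
  rewrite !vnorm2E -sqrtrM ?sqnorm_ge0//; apply: (le_trans (ler_norm _)).
  by rewrite -sqrtr_sqr ler_wsqrtr// cauchy_schwarz.
have -> : vnorm2 (x + y) ^+ 2 = sqnorm x + sqnorm y + 2 * \sum_i x i ord0 * y i ord0.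
  rewrite vnorm2_sqr /sqnorm mulr_sumr -!big_split /=; apply: eq_bigr => i _.
  by rewrite mxE; ring.
rewrite sqrrD -!vnorm2_sqr -mulr_natl; lra.
Qed.

Lemma sqnorm_mul_frob n p (M : 'M[R]_(p, n)) (x : 'cV[R]_n) :
  sqnorm (M *m x) <= (\sum_i \sum_j M i j ^+ 2) * sqnorm x.
Proof.
rewrite /sqnorm mulr_suml; apply: ler_sum => i _.
rewrite mxE; exact: cauchy_schwarz.
Qed.

Lemma opnorm_ge n (M : 'M[R]_n) (x : 'cV[R]_n) : vnorm2 x = 1 -> vnorm2 (M *m x) <= opnorm M.
Proof.
move=> x1; apply: ub_le_sup; last by exists x.
exists (Num.sqrt (\sum_i \sum_j M i j ^+ 2)) => _ [y /= y1 <-].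
rewrite vnorm2E ler_wsqrtr//; apply: (le_trans (sqnorm_mul_frob _ _)).
by rewrite -vnorm2_sqr y1 expr1n mulr1.
Qed.

Lemma opnorm_vnorm2 n (M : 'M[R]_n) (y : 'cV[R]_n) : vnorm2 y != 0 ->
  vnorm2 (M *m y) <= opnorm M * vnorm2 y.
Proof.
move=> y0; have yp : 0 < vnorm2 y by rewrite lt_neqAle eq_sym y0 vnorm2_ge0.
have := @opnorm_ge _ M ((vnorm2 y)^-1 *: y).
rewrite -scalemxAr !vnorm2Z ger0_norm ?invr_ge0 ?vnorm2_ge0// mulVf// => /(_ erefl).
by rewrite mulrC ler_pdivrMr.
Qed.

Lemma opnorm_le n (M : 'M[R]_n) (c : R) (x0 : 'cV[R]_n) : vnorm2 x0 = 1 ->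
  (forall x, vnorm2 x = 1 -> vnorm2 (M *m x) <= c) -> opnorm M <= c.
Proof.
move=> x01 H; apply: ge_sup; first by exists (vnorm2 (M *m x0)), x0.
by move=> _ [x /= x1 <-]; exact: H.
Qed.

Lemma opt_err_le n (A : 'M[R]_n) (u : 'cV[R]_n) : vnorm2 u = 1 -> opt_err A <= proj_err A u.
Proof.
move=> u1; apply: ge_inf; last by exists u.
exists 0 => _ [v /= v1 <-].
exact: le_trans (vnorm2_ge0 _) (opnorm_ge _ u1).
Qed.

End Norms.

(** * Accurate outputs correlate with the planted eigenvector *)

Section Success.
Context {R : realType}.
Notation kappa := (@kappa R).

Lemma sqnormD n (x y : 'cV[R]_n) : sqnorm (x + y) = sqnorm x + sqnorm y + 2 * (x^T *m y) ord0 ord0.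
Proof.
rewrite mxE /sqnorm mulr_sumr -!big_split /=; apply: eq_bigr => i _.
by rewrite !mxE; ring.
Qed.

Lemma dotC n (x y : 'cV[R]_n) : (x^T *m y) ord0 ord0 = (y^T *m x) ord0 ord0.
Proof. by rewrite !mxE; apply: eq_bigr => i _; rewrite !mxE mulrC. Qed.

Lemma dotZr n a (x y : 'cV[R]_n) : (x^T *m (a *: y)) ord0 ord0 = a * (x^T *m y) ord0 ord0.
Proof. by rewrite -scalemxAr [LHS]mxE. Qed.

Lemma sqnorm_diag_le m (d : 'rV[R]_m) (c : 'cV[R]_m) (K : R) :
  (forall i, d ord0 i ^+ 2 * c i ord0 ^+ 2 <= K * c i ord0 ^+ 2) ->
  sqnorm (diag_mx d *m c) <= K * sqnorm c.
Proof.
move=> H; rewrite /sqnorm mulr_sumr; apply: ler_sum => i _.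
by rewrite mul_diag_mx mxE exprMn.
Qed.

(** The vector [w = G e_{i0}] is nearly an eigenvector for [lam * kappa * n]. Were [v] almost
    orthogonal to it, projecting out [v] would leave an error near [lam * kappa * n], whereas
    projecting out [w] shows the optimum to be about [kappa * n]. The gap [4 eps] exceeds the
    tolerance [eps], and the Gram precision [eps / 100] keeps all distortions below the
    difference. *)
Lemma success_correlates n m (G : 'M[R]_(n, m)) (d : 'rV[R]_m) (i0 : 'I_m) (eps : R)
    (v : 'cV[R]_n) :
  0 < eps < 1 -> (0 < n)%N ->
  gram_dev predT G <= (eps / 100 * (kappa * n%:R)) ^+ 2 ->
  1 + 4 * eps <= d ord0 i0 -> (forall i, i != i0 -> `|d ord0 i| <= 1) ->
  vnorm2 v = 1 ->
  let A := G *m diag_mx d *m G^T in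
  proj_err A v <= (1 + eps) * opt_err A ->
  (eps / 100) ^+ 2 * sqnorm (G^T *m v) < (G^T *m v) i0 ord0 ^+ 2.
Proof.
move=> /andP[e0 e1] n0 Gd lam1 d1 v1 A Av.
set lam := d ord0 i0 in lam1.
set N0 := kappa * n%:R in Gd.
have N00 : 0 < N0 by rewrite mulr_gt0 ?ltr0n// kappa_gt0.
set eta := eps / 100 in Gd *.
have eta0 : 0 < eta by rewrite divr_gt0.
have eta1 : eta < 1 / 100 by rewrite /eta; lra.
have B (c : 'cV[R]_m) : (1 - eta) * N0 * sqnorm c <= sqnorm (G *m c) <= (1 + eta) * N0 * sqnorm c.
  have t0 : 0 <= eta * N0 by rewrite mulr_ge0// ltW.
  have := gram_quadratic_bounds (fun a => c a ord0) t0 Gd.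
  rewrite (_ : #|predT| = n); last by rewrite card_ord.
  rewrite -/N0 -/(sqnorm c).
  rewrite (_ : \sum_(i | predT i) _ = sqnorm (G *m c)); last first.
    by apply: eq_bigr => i _; rewrite mxE.
  have -> : (1 - eta) * N0 = N0 - eta * N0 by ring.
  by have -> : (1 + eta) * N0 = N0 + eta * N0 by ring.
(* The bound on [G] passes to its transpose by duality: with [y = G^T x],
   [|y|^4 = (x . G y)^2 <= |x|^2 |G y|^2]. *)
have BT (x : 'cV[R]_n) : sqnorm (G^T *m x) <= (1 + eta) * N0 * sqnorm x.
  set y := G^T *m x.
  have h1 : sqnorm y ^+ 2 <= sqnorm x * sqnorm (G *m y).
    apply: le_trans (sqnorm_dot x (G *m y)).
    rewrite le_eqVlt; apply/orP; left; apply/eqP; congr (_ ^+ 2).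
    by rewrite -sqnormE /y trmx_mul trmxK !mulmxA.
  have /andP[_ h2] := B y.
  have [y0|y0] := eqVneq (sqnorm y) 0.
    by rewrite y0 mulr_ge0 ?sqnorm_ge0// mulr_ge0 ?(ltW N00)//; lra.
  have yp : 0 < sqnorm y by rewrite lt_neqAle eq_sym y0 sqnorm_ge0.
  rewrite -(ler_pM2r yp) -expr2; apply: (le_trans h1).
  by rewrite mulrC mulrAC ler_wpM2r// sqnorm_ge0.
rewrite ltNge; apply/negP => bad.
set s := 1 + eta in B BT; set u := 1 - eta in B.
have s0 : 0 < s by rewrite /s; lra.
have u0 : 0 < u by rewrite /u; lra.
have sN : 0 < s * N0 by rewrite mulr_gt0.
have uN : 0 < u * N0 by rewrite mulr_gt0.
have lam0 : 0 < lam by lra.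
pose e : 'cV[R]_m := delta_mx i0 ord0.
have ne : sqnorm e = 1.
  rewrite /sqnorm (bigD1 i0)//= big1 ?addr0; first by rewrite mxE !eqxx expr1n.
  by move=> i ii0; rewrite mxE (negbTE ii0) expr0n.
pose w := G *m e.
have /andP[w1 w2] := B e; rewrite ne !mulr1 -/w in w1 w2.
have wn0 : vnorm2 w != 0.
  by rewrite vnorm2E gt_eqF// sqrtr_gt0 (lt_le_trans _ w1).
have wE (x : 'cV[R]_n) : (w^T *m x) ord0 ord0 = (G^T *m x) i0 ord0.
  rewrite /w trmx_mul -mulmxA mxE (bigD1 i0)//= big1 ?addr0.
    by rewrite !mxE !eqxx mul1r.
  by move=> i ii0; rewrite !mxE (negbTE ii0) mul0r.
(* by projecting out G e_{i0} *)
have opt : opt_err A <= s * N0.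
  pose uw := (vnorm2 w)^-1 *: w.
  have uw1 : vnorm2 uw = 1.
    by rewrite vnorm2Z ger0_norm ?invr_ge0 ?vnorm2_ge0// mulVf.
  apply: le_trans (opt_err_le A uw1) _; apply: (opnorm_le v1) => x x1.
  rewrite -mulmxA; set x' := _ *m x.
  have x'E : x' = x - ((uw^T *m x) ord0 ord0) *: uw.
    rewrite /x' mulmxBl mul1mx -mulmxA; congr (_ - _).
    by apply/colP => i; rewrite mxE big_ord1 [RHS]mxE mulrC; congr (_ * uw _ _); rewrite ord1.
  have uwuw : (uw^T *m uw) ord0 ord0 = 1 by rewrite sqnormE -vnorm2_sqr uw1 expr1n.
  have ux' : (uw^T *m x') ord0 ord0 = 0.
    by rewrite x'E mulmxBr -scalemxAr [LHS]mxE [X in _ + X]mxE [X in _ + - X]mxE uwuw mulr1 subrr.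
  have nx' : sqnorm x' <= 1.
    have -> : 1 = sqnorm x' + ((uw^T *m x) ord0 ord0) ^+ 2.
      have xE : x = x' + ((uw^T *m x) ord0 ord0) *: uw by rewrite x'E subrK.
      have -> : 1 = sqnorm x by rewrite -vnorm2_sqr x1 expr1n.
      rewrite [in LHS]xE sqnormD sqnormZ -[sqnorm uw]vnorm2_sqr uw1 expr1n mulr1.
      by rewrite dotZr dotC ux' !mulr0 addr0.
    by rewrite lerDl sqr_ge0.
  have c0 : (G^T *m x') i0 ord0 = 0.
    rewrite -wE; apply/eqP.
    have : (uw^T *m x') ord0 ord0 = (vnorm2 w)^-1 * (w^T *m x') ord0 ord0.
      by rewrite dotC dotZr dotC.
    rewrite ux' => /esym/eqP; rewrite mulf_eq0 invr_eq0 (negbTE wn0).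
    by [].
  rewrite vnorm2E -(ger0_norm (ltW sN)) -sqrtr_sqr ler_wsqrtr// /A -!mulmxA.
  have /andP[_ q1] := B (diag_mx d *m (G^T *m x')).
  apply: (le_trans q1); rewrite expr2 ler_pM2l//.
  apply: (@le_trans _ _ (1 * sqnorm (G^T *m x'))).
    apply: sqnorm_diag_le => i; have [->|ii0] := eqVneq i i0.
      by rewrite c0 expr0n/= !mulr0.
    rewrite ler_wpM2r ?sqr_ge0// -real_normK ?num_real// exprn_ile1//.
    exact: d1.
  rewrite mul1r; apply: (le_trans (BT _)).
  by rewrite ler_piMr// ltW.
set r := G^T *m v in bad *.
have nr : sqnorm r <= s * N0.
  by have := BT v; rewrite -/r -[sqnorm v]vnorm2_sqr v1 expr1n mulr1.
(* the error is tested on G e_{i0} *)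
have lower : lam * (u * N0) * Num.sqrt (u * N0) <= vnorm2 (A *m w).
  have -> : lam * (u * N0) * Num.sqrt (u * N0) = Num.sqrt ((u * N0) * (lam * (u * N0)) ^+ 2).
    by rewrite [RHS](sqrtrM _ (ltW uN)) sqrtr_sqr [RHS]mulrC ger0_norm// mulr_ge0// ltW.
  rewrite vnorm2E ler_wsqrtr// /A -!mulmxA.
  have /andP[q1 _] := B (diag_mx d *m (G^T *m w)).
  apply: le_trans q1; rewrite ler_pM2l//.
  apply: (@le_trans _ _ ((diag_mx d *m (G^T *m w)) i0 ord0 ^+ 2)).
    rewrite mul_diag_mx mxE -wE sqnormE -/lam exprMn [leRHS]exprMn ler_wpM2l ?sqr_ge0//.
    by apply: lerXn2r; rewrite ?nnegrE ?sqnorm_ge0 ?(ltW uN).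
  rewrite /sqnorm (bigD1 i0)//= lerDl; apply: sumr_ge0 => i _; exact: sqr_ge0.
have upper : vnorm2 (A *m v) <= lam * (s * N0).
  rewrite vnorm2E -(ger0_norm (mulr_ge0 (ltW lam0) (ltW sN))) -sqrtr_sqr ler_wsqrtr// /A -!mulmxA.
  have /andP[_ q1] := B (diag_mx d *m (G^T *m v)).
  apply: (le_trans q1).
  have q2 : sqnorm (diag_mx d *m (G^T *m v)) <= lam ^+ 2 * sqnorm (G^T *m v).
    apply: sqnorm_diag_le => i; rewrite ler_wpM2r ?sqr_ge0//.
    have [->//|ii0] := eqVneq i i0.
    rewrite -real_normK ?num_real//.
    apply: lerXn2r; rewrite ?nnegrE ?normr_ge0 ?(ltW lam0)//.
    by have := d1 _ ii0; lra.
  have -> : (lam * (s * N0)) ^+ 2 = s * N0 * (lam ^+ 2 * (s * N0)) by ring.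
  rewrite ler_pM2l//; apply: (le_trans q2); rewrite ler_wpM2l ?sqr_ge0//.
have Mw : A *m (1%:M - v *m v^T) *m w = A *m w + (- r i0 ord0) *: (A *m v).
  rewrite -mulmxA mulmxBl mul1mx mulmxBr scaleNr; congr (_ - _).
  rewrite -[v *m v^T *m w]mulmxA scalemxAr; congr (_ *m _).
  have -> : r i0 ord0 = (v^T *m w) ord0 ord0.
    by rewrite -wE dotC.
  by apply/colP => i; rewrite mxE big_ord1 [RHS]mxE mulrC; congr (_ * v _ _); rewrite ord1.
have M1 := opnorm_vnorm2 (A *m (1%:M - v *m v^T)) wn0.
have tri : vnorm2 (A *m w) <= vnorm2 (A *m (1%:M - v *m v^T) *m w) + `|r i0 ord0| * vnorm2 (A *m v).
  have -> : A *m w = A *m (1%:M - v *m v^T) *m w + r i0 ord0 *: (A *m v).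
    by rewrite Mw -addrA -scalerDl addNr scale0r addr0.
  by apply: (le_trans (vnorm2D _ _)); rewrite vnorm2Z.
set a := Num.sqrt (u * N0) in lower; set b := Num.sqrt (s * N0).
have b0 : 0 < b by rewrite sqrtr_gt0.
have a0 : 0 < a by rewrite sqrtr_gt0.
have wb : vnorm2 w <= b by rewrite vnorm2E ler_wsqrtr.
have rb : `|r i0 ord0| <= eta * b.
  have eb0 : 0 <= eta * b by rewrite mulr_ge0// ltW.
  rewrite -(ler_pXn2r (n := 2))// ?nnegrE// real_normK ?num_real//.
  rewrite exprMn sqr_sqrtr ?(ltW sN)//; apply: (le_trans bad).
  by rewrite ler_wpM2l ?sqr_ge0.
have op : opnorm (A *m (1%:M - v *m v^T)) <= (1 + eps) * (s * N0).
  by apply: (le_trans Av); rewrite ler_wpM2l//; lra.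
have main : lam * (u * N0) * a <= (1 + eps) * (s * N0) * b + eta * b * (lam * (s * N0)).
  apply: (le_trans lower); apply: (le_trans tri); apply: lerD.
    rewrite -mulmxA in M1 *; apply: (le_trans M1).
    apply: ler_pM => //; rewrite ?vnorm2_ge0//.
    by apply: le_trans (opnorm_ge _ v1); exact: vnorm2_ge0.
  by apply: ler_pM => //; exact: vnorm2_ge0.
(* [a] and [b] are the square roots of the lower and upper Gram bounds; this comparison removes them
   from [main]. *)
have ab : u * b <= s * a.
  rewrite -(ler_pXn2r (n := 2))// ?nnegrE; [|by rewrite mulr_ge0 ?(ltW u0) ?(ltW b0)|by rewrite mulr_ge0 ?(ltW s0) ?(ltW a0)].
  rewrite !exprMn !sqr_sqrtr ?(ltW sN) ?(ltW uN)//.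
  have -> : u ^+ 2 * (s * N0) = (u * s * N0) * u by ring.
  have -> : s ^+ 2 * (u * N0) = (u * s * N0) * s by ring.
  have us : u <= s by rewrite /u /s; lra.
  by rewrite (ler_pM2l (mulr_gt0 (mulr_gt0 u0 s0) N00)).
have main2 : lam * u ^+ 2 <= (1 + eps) * s ^+ 2 + eta * lam * s ^+ 2.
  have bN : 0 < b * N0 by rewrite mulr_gt0.
  rewrite -(ler_pM2r bN).
  have h1 : lam * u ^+ 2 * (b * N0) <= s * (lam * (u * N0) * a).
    have -> : lam * u ^+ 2 * (b * N0) = (lam * u * N0) * (u * b) by ring.
    have -> : s * (lam * (u * N0) * a) = (lam * u * N0) * (s * a) by ring.
    by rewrite (ler_pM2l (mulr_gt0 (mulr_gt0 lam0 u0) N00)).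
  have h2 := ler_wpM2l (ltW s0) main.
  apply: (le_trans h1); apply: (le_trans h2).
  by rewrite le_eqVlt; apply/orP; left; apply/eqP; ring.
have s2 : s ^+ 2 <= 1 + 3 * eta by rewrite /s; nra.
have u2 : 1 - 2 * eta <= u ^+ 2 by rewrite /u; nra.
have h3 : lam * (1 - 2 * eta) <= (1 + eps + eta * lam) * (1 + 3 * eta).
  have l1 : lam * (1 - 2 * eta) <= lam * u ^+ 2 by rewrite ler_pM2l.
  have el : 0 < eta * lam by rewrite mulr_gt0.
  have l2 : (1 + eps + eta * lam) * s ^+ 2 <= (1 + eps + eta * lam) * (1 + 3 * eta).
    by rewrite ler_wpM2l//; lra.
  have : (1 + eps + eta * lam) * s ^+ 2 = (1 + eps) * s ^+ 2 + eta * lam * s ^+ 2 by ring.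
  lra.
have h4 : lam * (1 - 4 * eta) <= (1 + eps) * (1 + 3 * eta).
  have : 0 <= lam * eta * (1 - 3 * eta).
    by rewrite !mulr_ge0 ?ltW//; lra.
  have : (1 + eps + eta * lam) * (1 + 3 * eta) =
    (1 + eps) * (1 + 3 * eta) + lam * eta * (1 + 3 * eta) by ring.
  have : lam * eta * (1 - 3 * eta) = lam * (1 - 2 * eta) - lam * (1 - 4 * eta)
    + lam * eta * (1 + 3 * eta) - lam * eta * 2 - lam * eta * 6 * eta by ring.
  lra.
have h5 : (1 + 4 * eps) * (1 - 4 * eta) <= (1 + eps) * (1 + 3 * eta).
  apply: le_trans h4; rewrite ler_pM2r//; lra.
have epsE : eps = 100 * eta by rewrite /eta; field.
(* After substitution [h5] amounts to [293 eta <= 1900 eta^2], impossible for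
   [0 < eta < 1 / 100]. *)
rewrite epsE in h5.
have : 0 < eta * (1 / 100 - eta) by rewrite mulr_gt0// subr_gt0.
nra.
Qed.

End Success.

(** * Krylov spaces of Gaussian vectors *)

Section Krylov.
Context {R : realType}.
Notation kappa := (@kappa R).

Section PolySpan.
Context (K m : nat) (d : 'rV[R]_m) (Z0 : 'M[R]_(K, m)).

Definition poly_span e (r : 'rV[R]_m) := exists p : 'I_K -> {poly R},
  (forall j, (size (p j) <= e)%N) /\
  forall i, r ord0 i = \sum_j (p j).[d ord0 i] * Z0 j i.

Lemma poly_span_le e e' r : (e <= e')%N -> poly_span e r -> poly_span e' r.
Proof.
by move=> ee [p [sp pE]]; exists p; split => // j; apply: leq_trans ee.
Qed.

Lemma poly_span0 e : poly_span e 0.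
Proof.
exists (fun=> 0); split => [j|i]; first by rewrite size_poly0.
by rewrite mxE big1// => j _; rewrite horner0 mul0r.
Qed.

Lemma poly_spanD e r1 r2 : poly_span e r1 -> poly_span e r2 -> poly_span e (r1 + r2).
Proof.
move=> [p [sp pE]] [q [sq qE]]; exists (fun j => p j + q j); split => [j|i].
  by rewrite (leq_trans (size_polyD _ _))// geq_max sp sq.
rewrite mxE pE qE -big_split; apply: eq_bigr => j _ /=.
by rewrite hornerD mulrDl.
Qed.

Lemma poly_spanZ e a r : poly_span e r -> poly_span e (a *: r).
Proof.
move=> [p [sp pE]]; exists (fun j => a *: p j); split => [j|i].
  by rewrite (leq_trans (size_scale_leq _ _)).
rewrite mxE pE mulr_sumr; apply: eq_bigr => j _.
by rewrite hornerZ mulrA.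
Qed.

Lemma poly_span_diag e r : poly_span e r -> poly_span e.+1 (r *m diag_mx d).
Proof.
move=> [p [sp pE]]; exists (fun j => p j * 'X); split => [j|i].
  by rewrite (leq_trans (size_polyMleq _ _))// size_polyX addn2 /= ltnS.
rewrite mul_mx_diag mxE pE mulr_suml; apply: eq_bigr => j _.
by rewrite hornerMX mulrAC.
Qed.

Lemma poly_span_submx n e (S : 'M[R]_(n, m)) r : (forall i, poly_span e (row i S)) ->
  (r <= S)%MS -> poly_span e r.
Proof.
move=> H /submxP[u ->]; rewrite mulmx_sum_row.
apply: (big_ind (poly_span e)); [exact: poly_span0|exact: poly_spanD|].
by move=> i _; apply: poly_spanZ; exact: H.
Qed.

(** A fresh row enters with constant coefficients, and the single image under [diag_mx d] taken
    after it multiplies coefficients by ['X]; the size bound thus grows by one per row. *)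
Lemma krylov_poly_span j : forall (S : 'M[R]_m) (Z : 'M[R]_(j, m)) e r,
  (0 < e)%N -> (forall i, poly_span e (row i S)) -> (forall i, poly_span 1 (row i Z)) ->
  (r <= krylov (diag_mx d) S Z)%MS -> poly_span (e + j) r.
Proof.
elim: j => [|j IH] S Z e r e0 HS HZ /=; first by rewrite addn0; exact: poly_span_submx.
move=> rK; rewrite addnS -addSn.
pose S1 := (S + usubmx (Z : 'M[R]_(1 + j, m)))%MS.
have H1 x : (x <= S1)%MS -> poly_span e x.
  move=> /sub_addsmxP[[u1 u2] ->] /=; apply: poly_spanD.
    by apply: (poly_span_submx HS); exact: submxMl.
  apply: (poly_span_le e0).
  apply: (@poly_span_submx 1 1 (usubmx (Z : 'M[R]_(1 + j, m)))); last exact: submxMl.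
  by move=> i; rewrite row_usubmx; exact: HZ.
apply: (IH _ _ e.+1 _ _ _ _ rK) => // [i|i].
  have /sub_addsmxP[[u1 u2] ->] /= := row_sub i (S1 + S1 *m diag_mx d)%MS.
  apply: poly_spanD; first by apply: (poly_span_le (leqnSn e)); apply: H1; exact: submxMl.
  by rewrite mulmxA; apply: poly_span_diag; apply: H1; exact: submxMl.
by rewrite row_dsubmx; exact: HZ.
Qed.

End PolySpan.

Lemma krylov_poly_coeffs K m (d : 'rV[R]_m) (Z : 'M[R]_(K, m)) r :
  (r <= krylov (diag_mx d) 0 Z)%MS -> poly_span d Z K.+1 r.
Proof.
move=> rK; rewrite -add1n; apply: (krylov_poly_span _ _ _ rK) => // i.
  by rewrite row0; exact: poly_span0.
exists (fun j => (j == i)%:R%:P); split => [j|k].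
  exact: size_polyC_leq1.
rewrite (bigD1 i)//= big1 ?addr0; first by rewrite hornerC eqxx mul1r mxE.
by move=> j ji; rewrite hornerC (negbTE ji) mul0r.
Qed.

Definition blk_row m s L (blk : 'I_m -> option 'I_s) (lam : R) : 'rV[R]_m :=
  \row_i (if blk i is Some l then chebnode L l else lam).

(** All coordinates of block [l] share the coefficients [(p j).[chebnode L l]], so the block
    contributes a quadratic form in them given by the Gram matrix of [b] rows of [Z^T]. The allowed
    deviation is half the mean [b * kappa], which is where the factor 2 comes from. [K <= L] keeps
    every degree at most [L], as [cheb_extremal] requires. *)
Lemma krylov_small K m L (b : nat) (blk : 'I_m -> option 'I_L.+1) (lam T0 : R) (i0 : 'I_m)
    (Z : 'M[R]_(K, m)) (r : 'rV[R]_m) :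
  (0 < L)%N -> (K <= L)%N -> (0 < b)%N -> 1 <= lam -> blk i0 = None ->
  (forall l, #|[pred i | blk i == Some l]| = b) ->
  \sum_(l < L.+1) gram_dev [pred i | blk i == Some l] Z^T <= (b%:R * kappa / 2) ^+ 2 ->
  \sum_(j < K) Z^T i0 j ^+ 2 <= T0 ->
  (r <= krylov (diag_mx (blk_row L blk lam)) 0 Z)%MS ->
  r ord0 i0 ^+ 2 <= (2 * T0 * (cheb L).[lam] ^+ 2 / (b%:R * kappa)) * \sum_i r ord0 i ^+ 2.
Proof.
move=> L0 KL b0 lam1 bi0 cardb gd top /krylov_poly_coeffs[p [sp pE]].
pose q l := \sum_j (p j).[chebnode L l] ^+ 2.
have kap0 := @kappa_gt0 R.
have bk : 0 < b%:R * kappa by rewrite mulr_gt0 ?ltr0n.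
have T00 : 0 <= T0 by apply: le_trans top; apply: sumr_ge0 => j _; exact: sqr_ge0.
have h1 : r ord0 i0 ^+ 2 <= (cheb L).[lam] ^+ 2 * (\sum_(l < L.+1) q l) * T0.
  rewrite pE mxE bi0; apply: (le_trans (cauchy_schwarz _ _ _)).
  apply: ler_pM => //; try by apply: sumr_ge0 => j _; exact: sqr_ge0.
    rewrite /q exchange_big mulr_sumr; apply: ler_sum => j _.
    apply: cheb_extremal => //; exact: leq_trans (sp j) _.
  by apply: le_trans top; apply: ler_sum => j _; rewrite mxE.
have h2 (l : 'I_L.+1) : (b%:R * kappa / 2) * q l <= \sum_(i | blk i == Some l) r ord0 i ^+ 2.
  have gl : gram_dev [pred i | blk i == Some l] Z^T <= (b%:R * kappa / 2) ^+ 2.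
    apply: le_trans gd; rewrite (bigD1 l)//= lerDl.
    by apply: sumr_ge0 => l' _; exact: gram_dev_ge0.
  have t0 : 0 <= b%:R * kappa / 2 by rewrite divr_ge0// ltW.
  have /andP[+ _] := gram_quadratic_bounds (fun j => (p j).[chebnode L l]) t0 gl.
  rewrite cardb => H.
  have -> : \sum_(i | blk i == Some l) r ord0 i ^+ 2 =
    \sum_(i | [pred i | blk i == Some l] i) (\sum_a Z^T i a * (p a).[chebnode L l]) ^+ 2.
    apply: eq_bigr => i /eqP bi; rewrite pE; congr (_ ^+ 2); apply: eq_bigr => j _.
    by rewrite !mxE bi mulrC.
  apply: le_trans H; rewrite -/(q l) le_eqVlt; apply/orP; left; apply/eqP; by field.
have h3 : (b%:R * kappa / 2) * \sum_(l < L.+1) q l <= \sum_i r ord0 i ^+ 2.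
  rewrite mulr_sumr; apply: (@le_trans _ _ (\sum_(l < L.+1) \sum_(i | blk i == Some l) r ord0 i ^+ 2)).
    by apply: ler_sum => l _; exact: h2.
  rewrite (eq_bigr (fun l : 'I_L.+1 => \sum_i if blk i == Some l then r ord0 i ^+ 2 else 0)); last first.
    by move=> l _; rewrite big_mkcond.
  rewrite exchange_big; apply: ler_sum => i _ /=; rewrite -big_mkcond.
  case: (blk i) => [l0|]; last by rewrite big_pred0// sqr_ge0.
  by rewrite (big_pred1 l0).
apply: (le_trans h1).
have -> : 2 * T0 * (cheb L).[lam] ^+ 2 / (b%:R * kappa) * \sum_i r ord0 i ^+ 2 =
   (cheb L).[lam] ^+ 2 * T0 * (2 / (b%:R * kappa) * \sum_i r ord0 i ^+ 2) by ring.
have gT : 0 <= (cheb L).[lam] ^+ 2 * T0 by rewrite mulr_ge0// sqr_ge0.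
rewrite [leLHS]mulrAC; apply: ler_wpM2l => //.
rewrite [leRHS]mulrAC ler_pdivlMr//.
have -> : (\sum_(l < L.+1) q l) * (b%:R * kappa) = 2 * (b%:R * kappa / 2 * \sum_(l < L.+1) q l).
  by field.
by rewrite ler_pM2l.
Qed.

Lemma blk_exists s b : exists blk : 'I_(1 + s * b) -> option 'I_s,
  (forall i, (blk i == None) = (i == lshift (s * b) ord0)) /\
  (forall l, #|[pred i | blk i == Some l]| = b).
Proof.
pose C (k : 'I_(s * b)) : 'I_s * 'I_b := enum_val (cast_ord (esym (mxvec_cast s b)) k).
have CK i j : C (mxvec_index i j) = (i, j).
  by rewrite /C /mxvec_index cast_ordK enum_rankK.
pose blk (i : 'I_(1 + s * b)) := if fintype.split i is inr k then Some (C k).1 else None.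
have bl k : blk (lshift (s * b) k) = None by rewrite /blk (unsplitK (inl k)).
have br k : blk (rshift 1 k) = Some (C k).1 by rewrite /blk (unsplitK (inr k)).
exists blk; split => [i|l].
  case: (split_ordP i) => k ->; first by rewrite bl (ord1 k) !eqxx.
  by rewrite br; apply/esym/negbTE; rewrite eq_rlshift.
rewrite -sum1_card big_mkcond big_split_ord /= big1 ?add0n; last first.
  by move=> k _; rewrite inE bl.
rewrite (reindex (uncurry (@mxvec_index s b))) /=; last exact: curry_mxvec_bij.
rewrite (eq_bigr (fun x : 'I_s * 'I_b => (x.1 == l) : nat)); last first.
  by move=> [i j] _ /=; rewrite inE br CK /=; case: eqP => [[->]|]; case: eqP => // ->.
rewrite -(pair_bigA _ (fun i j => (i == l : nat))) /=.
rewrite (bigD1 l)//= [X in (_ + X)%N]big1 ?addn0; first by rewrite eqxx sum_nat_const card_ord muln1.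
by move=> i il; rewrite (negbTE il) sum_nat_const muln0.
Qed.

End Krylov.

(** * The hard distribution *)

Section Core.
Context {R : realType}.
Notation RM := (measurableTypeR R).
Notation mxMeas := (@mxMeas R).
Notation gauss_mx := (@gauss_mx R).
Notation kappa := (@kappa R).

(** The easy direction of Yao's principle: with the seed integrated last, it suffices to defeat each
    deterministic algorithm. *)
Lemma product_le_of_sections d1 d2 (T1 : measurableType d1) (T2 : measurableType d2)
  (P1 : probability T1 R) (P2 : probability T2 R) (E : set (T1 * T2)) (c : \bar R) :
  measurable E -> (forall y, P1 [set x | E (x, y)] <= c)%E -> ((P1 \x P2) E <= c)%E.
Proof.
move=> mE H.
rewrite (product_measure_unique (m' := (P1 \x^ P2)%E))//; last first.
  by move=> A B mA mB; exact: product_measure2E.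
have yE y : ysection E y = [set x | E (x, y)].
  by apply/seteqP; split => x; rewrite /ysection/= inE.
apply: prob_integral_le => [|y|y].
- exact: (measurable_fun_ysection P1 mE).
- exact: measure_ge0.
- by rewrite /= yE; exact: H.
Qed.

Definition conj_diag n m (d : 'rV[R]_m) (G : mxMeas n m) : mxSpace R n :=
  (G : 'M[R]_(n, m)) *m diag_mx d *m (G : 'M[R]_(n, m))^T.

Lemma measurable_conj_diag n m (d : 'rV[R]_m) : measurable_fun setT (@conj_diag n m d).
Proof.
have mG := @measurable_id _ (mxMeas n m) setT.
have := measurable_mulmx (measurable_mulmx mG (measurable_cst_mx (diag_mx d)))
  (measurable_trmx mG).
exact.
Qed.

(** Where the Gram matrix of [G] is nearly scalar, success forces [v^T G] to be correlated with the
    planted axis. The game is then run from its initial state: nothing known, both projections the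
    identity, empty transcript. *)
Lemma algorithm_failure n m k (d : 'rV[R]_m) (eps : R) (i0 : 'I_m)
    (q out : seq 'cV[R]_n -> 'cV[R]_n) (X : set (mxSpace R n)) (F : set (mxMeas (1 + k) m)) :
  0 < eps < 1 -> (0 < n)%N -> 1 + 4 * eps <= d ord0 i0 ->
  (forall i, i != i0 -> `|d ord0 i| <= 1) ->
  measurable X ->
  (forall A : 'M[R]_n, X A -> let v := out (responses q A k) in
     vnorm2 v = 1 /\ proj_err A v <= (1 + eps) * opt_err A) ->
  measurable F ->
  (forall (Z : 'M[R]_(1 + k, m)) (r : 'rV[R]_m), (r <= krylov (diag_mx d) 0 Z)%MS ->
     (eps / 100) ^+ 2 * \sum_i r ord0 i ^+ 2 < r ord0 i0 ^+ 2 -> F Z) ->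
  (gauss_mx n m [set G | X (conj_diag d G)] <=
    gauss_mx (1 + k) m F + gauss_mx n m [set G | ((eps / 100 * (kappa * n%:R)) ^+ 2 <= gram_dev predT (G : 'M[R]_(n, m)))%R])%E.
Proof.
move=> e01 n0 lam1 d1 mX HX mF HF.
set Y := [set G | X _]; set W0 := [set G | _ <= _]%R.
pose W : set (mxMeas n m) := W0.
rewrite -/W.
have mY : measurable Y.
  by rewrite -[X in measurable X]setTI; exact: (measurable_conj_diag (n := n) d).
have mW : measurable W by apply: measurable_ge_set; exact: measurable_gram_dev.
pose E := Y `\` W.
have mE : measurable E by exact: measurableD.
apply: (@le_trans _ _ (gauss_mx n m E + gauss_mx n m W)%E).
  apply: (@le_trans _ _ (gauss_mx n m (E `|` W))); last exact: measureU2.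
  apply: le_measure; rewrite ?inE//; first exact: measurableU.
  by move=> G YG; have [WG|WG] := pselect (W G); [right|left].
rewrite leeD2r//.
pose Bad (r : 'rV[R]_m) := (eps / 100) ^+ 2 * \sum_i r ord0 i ^+ 2 < r ord0 i0 ^+ 2.
have HE (G : 'M[R]_(n, m)) : E G ->
    Bad ((out (responses q (G *m diag_mx d *m G^T) k))^T *m G).
  move=> [YG WG]; have [v1 Av] := HX _ YG.
  set v := out _ in v1 Av *.
  have Gd : gram_dev predT G <= (eps / 100 * (kappa * n%:R)) ^+ 2.
    by move/negP: WG; rewrite -ltNge => /ltW.
  have := success_correlates e01 n0 Gd lam1 d1 v1 Av.
  have vE i : (v^T *m G) ord0 i = (G^T *m v) i ord0.
    by rewrite -[v^T *m G]trmxK trmx_mul trmxK mxE.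
  rewrite /Bad vE /sqnorm; congr (_ * _ < _); apply: eq_bigr => i _; by rewrite vE.
have proj1 p : is_proj (1%:M : 'M[R]_p) by split; rewrite ?trmx1 ?mulmx1.
have := @adaptive_reveal R n m (diag_mx d) E q out k Bad (tr_diag_mx d) mE HE
  k 0%N 0 1%:M 1%:M 0 [::] F erefl (proj1 n) (proj1 m) (sub0mx _ _).
rewrite subrr => /(_ (sub0mx _ _) (fun _ _ => erefl) mF (fun Z r Br rK => HF Z r rK Br)).
congr (_ <= _)%E; congr (gauss_mx n m _).
by apply/seteqP; split => G /=; rewrite add0r mul1mx mulmx1.
Qed.

(** [F] says that the fresh rows are atypical: some block has a distorted Gram matrix ([W2]), or the
    entries on the planted axis are too large ([W3]), each with probability at most 1/9. Off [F], no
    vector of the Krylov space is correlated enough. *)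
Lemma krylov_event k L b (lam : R) (blk : 'I_(1 + L.+1 * b) -> option 'I_L.+1) (eta : R) :
  let m := (1 + L.+1 * b)%N in let i0 : 'I_m := lshift (L.+1 * b) ord0 in
  (k < L)%N -> (0 < b)%N -> 1 <= lam -> 0 < eta ->
  (forall i, (blk i == None) = (i == i0)) ->
  (forall l, #|[pred i | blk i == Some l]| = b) ->
  @gram_const R *+ b *+ L *+ L *+ L.+1 / (b%:R * kappa / 2) ^+ 2 <= 9^-1 ->
  18 * L%:R * (cheb L).[lam] ^+ 2 / b%:R <= eta ^+ 2 ->
  exists F : set (mxMeas (1 + k) m), [/\ measurable F,
    (gauss_mx (1 + k) m F <= (2 / 9)%:E)%E &
    forall (Z : 'M[R]_(1 + k, m)) (r : 'rV[R]_m), (r <= krylov (diag_mx (blk_row L blk lam)) 0 Z)%MS ->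
     eta ^+ 2 * \sum_i r ord0 i ^+ 2 < r ord0 i0 ^+ 2 -> F Z].
Proof.
move=> m i0 kL b0 lam1 eta0 blkN blkS C2 C3.
have L0 : (0 < L)%N by exact: leq_ltn_trans kL.
have kap0 := @kappa_gt0 R.
have b0' : 0 < b%:R :> R by rewrite ltr0n.
pose K := (1 + k)%N.
(* Nine times the mean of the sum of squares in [W3], so that Markov's inequality gives 1/9. *)
pose T0 : R := 9 * (K%:R * kappa).
have K0 : 0 < K%:R :> R by rewrite ltr0n.
have T00 : 0 < T0 by rewrite !mulr_gt0.
pose t2 : R := (b%:R * kappa / 2) ^+ 2.
have t20 : 0 < t2 by rewrite exprn_gt0// divr_gt0// mulr_gt0.
pose W2 : set (mxMeas m K) := [set M | t2 <= \sum_(l < L.+1) gram_dev [pred i | blk i == Some l] (M : 'M[R]_(m, K))].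
pose W3 : set (mxMeas m K) := [set M | T0 <= \sum_(j < K) (M : 'M[R]_(m, K)) i0 j ^+ 2].
have mW2 : measurable W2.
  by apply: measurable_ge_set; apply: measurable_sumR => l _; exact: measurable_gram_dev.
have mW3 : measurable W3.
  by apply: measurable_ge_set; apply: measurable_sumR => j _; apply: measurable_funX; exact: measurable_entry.
have mW : measurable (W2 `|` W3) by exact: measurableU.
have mtr := measurable_trmx (@measurable_id _ (mxMeas K m) setT).
exists ((fun Z => (Z : 'M[R]_(K, m))^T) @^-1` (W2 `|` W3)); split.
- exact: (measurable_mxpreimage mtr mW).
- rewrite [leLHS](gauss_mx_trmx mW).
  apply: (@le_trans _ _ (gauss_mx m K W2 + gauss_mx m K W3)%E); first exact: measureU2.
  have -> : (2 / 9 : R) = 9^-1 + 9^-1 by field.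
  rewrite EFinD; apply: leeD.
    have h := sum_gram_dev_tail K (P := fun l => [pred i | blk i == Some l]) t20 blkS.
    apply: (le_trans h); rewrite lee_fin; apply: le_trans C2.
    rewrite ler_pM2r ?invr_gt0// -/t2.
    have g0 := @gram_const_ge0 R.
    have KL : (K <= L)%N by rewrite /K add1n.
    apply: ler_wMn2r; apply: (@le_trans _ _ (@gram_const R *+ b *+ K *+ L)).
      by apply: ler_wpMn2l => //; rewrite !mulrn_wge0.
    by apply: ler_wMn2r; apply: ler_wpMn2l => //; rewrite mulrn_wge0.
  have h := row_norm_tail K i0 T00.
  apply: (le_trans h); rewrite lee_fin /T0 -mulr_natl.
  by rewrite le_eqVlt; apply/orP; left; apply/eqP; field; rewrite !gt_eqF.
move=> Z r rK bad /=; apply: contrapT => /not_orP[nW2 nW3].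
have h2 : \sum_(l < L.+1) gram_dev [pred i | blk i == Some l] Z^T <= t2.
  by move/negP: nW2; rewrite -ltNge => /ltW.
have h3 : \sum_(j < K) Z^T i0 j ^+ 2 <= T0.
  by move/negP: nW3; rewrite -ltNge => /ltW.
have bi0 : blk i0 = None by apply/eqP; rewrite blkN.
have KL : (K <= L)%N by rewrite /K add1n.
have := krylov_small L0 KL b0 lam1 bi0 blkS h2 h3 rK.
apply/negP; rewrite -ltNge; apply: le_lt_trans bad.
apply: ler_wpM2r; first by apply: sumr_ge0 => i _; exact: sqr_ge0.
apply: le_trans C3.
have -> : 2 * T0 * (cheb L).[lam] ^+ 2 / (b%:R * kappa) = 18 * K%:R * (cheb L).[lam] ^+ 2 / b%:R.
  by rewrite /T0; field; rewrite !gt_eqF.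
rewrite ler_pM2r ?invr_gt0// ler_wpM2r ?sqr_ge0// ler_pM2l//.
by rewrite ler_nat.
Qed.

(** The three numerical conditions ask, in order, that the Gram matrix of [G] be accurate up to
    [eps / 100], that the blocks of the fresh rows be accurate up to one half, and that the
    correlation reachable in the Krylov space stay below the one that success requires. *)
Lemma hard_instance (eps lam : R) (n L b : nat) :
  let m := (1 + L.+1 * b)%N in
  0 < eps < 1 -> (0 < n)%N -> (0 < b)%N -> 1 + 4 * eps <= lam ->
  @gram_const R *+ n *+ m *+ m / (eps / 100 * (kappa * n%:R)) ^+ 2 <= 9^-1 ->
  @gram_const R *+ b *+ L *+ L *+ L.+1 / (b%:R * kappa / 2) ^+ 2 <= 9^-1 ->
  18 * L%:R * (cheb L).[lam] ^+ 2 / b%:R <= (eps / 100) ^+ 2 ->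
  exists D : probability (mxSpace R n) R,
    D (@sym_set R n) = 1%E /\
    forall (d : measure_display) (Om : measurableType d) (P : probability Om R)
      (k : nat) (query : Om -> seq 'cV[R]_n -> 'cV[R]_n)
      (out : Om -> seq 'cV[R]_n -> 'cV[R]_n),
      (k < L)%N -> ~ succeeds D P query out k eps.
Proof.
move=> m e01 n0 b0 lam1 C1 C2 C3.
have /andP[e0 e1] := e01.
have [blk [blkN blkS]] := blk_exists L.+1 b.
pose i0 : 'I_m := lshift (L.+1 * b) ord0.
pose d := blk_row L blk lam.
exists (pushforward_prob (gauss_mx n m) (measurable_conj_diag (n := n) d)); split.
  rewrite pushforward_probE (_ : _ @^-1` _ = setT); first exact: probability_setT.
  apply/seteqP; split => // G _; rewrite /sym_set /= /conj_diag.
  by rewrite !trmx_mul trmxK tr_diag_mx mulmxA.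
move=> dd Om P k query out kL [E [mE [EG]]].
apply/negP; rewrite -ltNge.
(* [1 / 3] is [2 / 9] for the fresh rows plus [1 / 9] for the Gram matrix of [G], against the
   [2 / 3] demanded by [succeeds]. *)
apply: (@le_lt_trans _ _ (1 / 3 : R)%:E); last first.
  by rewrite lte_fin ltr_pM2r// ltr1n.
apply: product_le_of_sections => // w.
rewrite pushforward_probE.
have lam1' : 1 <= lam by lra.
have eta0 : 0 < eps / 100 by rewrite divr_gt0.
have [F [mF Fle HF]] := krylov_event kL b0 lam1' eta0 blkN blkS C2 C3.
have di0 : 1 + 4 * eps <= d ord0 i0.
  have bi0 : blk i0 = None by apply/eqP; rewrite blkN.
  by rewrite /d mxE bi0.
have d1 i : i != i0 -> `|d ord0 i| <= 1.
  rewrite -blkN /d mxE; case: (blk i) => // l _; exact: cos_max.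
have mEw : measurable ([set A | E (A, w)] : set (mxSpace R n)).
  have := measurable_ysection w mE.
  by congr measurable; apply/seteqP; split => x; rewrite /ysection/= inE.
have HX (A : 'M[R]_n) : [set A | E (A, w)] A -> let v := out w (responses (query w) A k) in
     vnorm2 v = 1 /\ proj_err A v <= (1 + eps) * opt_err A.
  by move=> EA; exact: (EG (A, w) EA).
have H := algorithm_failure e01 n0 di0 d1 mEw HX mF HF.
apply: (le_trans H).
have -> : (1 / 3 : R) = 2 / 9 + 9^-1 by field.
rewrite EFinD; apply: leeD => //.
have t0 : 0 < (eps / 100 * (kappa * n%:R)) ^+ 2.
  by rewrite exprn_gt0// !mulr_gt0 ?kappa_gt0 ?ltr0n.
apply: (le_trans (gram_dev_tail m predT t0)); rewrite lee_fin.
by apply: le_trans C1; rewrite card_ord.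
Qed.

End Core.

(** * Choice of the parameters *)

Section Asymptotics.
Context {R : realType}.
Notation kappa := (@kappa R).

(** The integer part of the root lets all parameters be powers of one natural number, so that no
    real exponents occur. *)
Lemma integer_root (p n a0 : nat) : (0 < p)%N -> (a0 ^ p <= n)%N ->
  exists a, [/\ (a0 <= a)%N, (a ^ p <= n)%N & (n < a.+1 ^ p)%N].
Proof.
move=> p0 a0n.
have ex : exists a, (a ^ p <= n)%N by exists a0.
have ub a : (a ^ p <= n)%N -> (a <= n)%N.
  by apply: leq_trans; case: a => // a; rewrite -{1}(expn1 a.+1) leq_pexp2l.
case: (ex_maxnP ex ub) => a an amax; exists a; split => //.
  exact: amax.
by rewrite ltnNge; apply/negP => /amax; rewrite ltnn.
Qed.

Lemma cheb_growth_expR (sg : R) L : 0 <= sg ->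
  (cheb L).[((1 + 9 * sg) + (1 + 9 * sg)^-1) / 2] ^+ 2 <= expR (18 * sg * L%:R).
Proof.
move=> s0; set z := 1 + 9 * sg.
have z1 : 1 <= z by rewrite /z lerDl mulr_ge0.
have z0 : 0 < z by apply: lt_le_trans z1.
have T0 : 0 <= (cheb L).[(z + z^-1) / 2].
  have := cheb_joukowski L (lt0r_neq0 z0).
  have : 0 <= z ^+ L by rewrite exprn_ge0// ltW.
  have : 0 <= z ^- L by rewrite invr_ge0 exprn_ge0// ltW.
  lra.
have h1 := cheb_growth L z1.
have h2 : z ^+ L <= expR (9 * sg * L%:R).
  rewrite mulrC expRM_natl; apply: lerXn2r; rewrite ?nnegrE ?expR_ge0 ?(ltW z0)//.
  exact: expR_ge1Dx.
have -> : expR (18 * sg * L%:R) = expR (9 * sg * L%:R) ^+ 2.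
  by rewrite -expRM_natl; congr expR; ring.
by apply: lerXn2r; rewrite ?nnegrE ?expR_ge0//; exact: le_trans h2.
Qed.

(** [(z + z^-1) / 2 - 1 = (z - 1)^2 / (2 z)], so the claim reduces to [81 >= 8 (1 + 9 sg)]. The 9 is
    the least integer coefficient that works for all [sg < 1]. *)
Lemma joukowski_gap (sg : R) : 0 < sg < 1 ->
  1 + 4 * sg ^+ 2 <= ((1 + 9 * sg) + (1 + 9 * sg)^-1) / 2.
Proof.
move=> /andP[s0 s1]; set z := 1 + 9 * sg.
have z0 : 0 < z by rewrite /z; lra.
rewrite -subr_ge0.
have -> : (z + z^-1) / 2 - (1 + 4 * sg ^+ 2) = sg ^+ 2 * (73 - 72 * sg) / (2 * z).
  by rewrite /z; field; rewrite gt_eqF// -/z.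
by rewrite divr_ge0 ?mulr_ge0 ?sqr_ge0 ?(ltW z0)//; lra.
Qed.

Lemma parameters_exist (eps : R) : 0 < eps < 1 -> exists N : nat, forall n, (N <= n)%N ->
  exists L b (lam : R), let m := (1 + L.+1 * b)%N in
  [/\ (0 < n)%N, (0 < b)%N & 1 + 4 * eps <= lam] /\
  [/\ @gram_const R *+ n *+ m *+ m / (eps / 100 * (kappa * n%:R)) ^+ 2 <= 9^-1,
      @gram_const R *+ b *+ L *+ L *+ L.+1 / (b%:R * kappa / 2) ^+ 2 <= 9^-1,
      18 * L%:R * (cheb L).[lam] ^+ 2 / b%:R <= (eps / 100) ^+ 2 &
      forall k, k%:R < 216^-1 * ln n%:R / Num.sqrt eps -> (k < L)%N].
Proof.
move=> /andP[e0 e1].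
pose sg := Num.sqrt eps.
have sg2 : sg ^+ 2 = eps by rewrite sqr_sqrtr// ltW.
have s0 : 0 < sg by rewrite sqrtr_gt0.
have s1 : sg < 1 by rewrite -(ltr_pXn2r (n := 2)) ?nnegrE ?(ltW s0)// sg2 expr1n.
pose q := sg^-1.
have q1 : 1 <= q by rewrite invf_ge1// ltW.
have q0 : 0 < q by exact: lt_le_trans q1.
have eq2 : eps * q ^+ 2 = 1 by rewrite -sg2 -exprMn divff ?expr1n// gt_eqF.
have kap0 := @kappa_gt0 R.
have g0 := @gram_const_ge0 R.
pose C := @gram_const R / kappa ^+ 2.
have C0 : 0 <= C by rewrite divr_ge0// sqr_ge0.
have gC : @gram_const R = C * kappa ^+ 2 by rewrite /C divfK// expf_neq0// gt_eqF.
(* [A1], [A2], [A3] collect the constants and the powers of [q = eps^(-1/2)] from the three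
   conditions; the threshold on [n] serves to make [a] at least their sum. *)
pose A1 : R := 9 * 100 ^+ 2 * 25 * C * q ^+ 6.
pose A2 : R := 36 * 64 * C * q ^+ 3.
pose A3 : R := 144 * 100 ^+ 2 * expR 36 * q ^+ 5.
have qn k : 0 <= q ^+ k by rewrite exprn_ge0// ltW.
have A10 : 0 <= A1 by rewrite /A1 mulr_ge0// mulr_ge0.
have A20 : 0 <= A2 by rewrite /A2 mulr_ge0// mulr_ge0.
have A30 : 0 <= A3 by rewrite /A3 mulr_ge0// mulr_ge0// expR_ge0.
pose a0 := (Num.truncn (A1 + A2 + A3)).+1.
exists (a0 ^ 12)%N => n /(integer_root (p := 12) isT)[a [a0a an na]].
have a1 : (0 < a)%N by exact: leq_trans a0a.
pose al : R := a%:R.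
have al1 : 1 <= al by rewrite ler1n.
have al0 : 0 < al by rewrite ltr0n.
have alA : A1 + A2 + A3 <= al.
  apply: (@le_trans _ _ a0%:R); last by rewrite ler_nat.
  by apply: ltW; exact: truncnS_gt.
have n0 : (0 < n)%N by apply: leq_trans an; rewrite expn_gt0 a1.
have n0' : 0 < n%:R :> R by rewrite ltr0n.
have nal : al ^+ 12 <= n%:R by rewrite -natrX ler_nat.
have lnn0 : 0 <= ln (n%:R : R) by rewrite ln_ge0// ler1n.
have lnn : ln (n%:R : R) <= 12 * ln (1 + al).
  have al1' : 0 < 1 + al by rewrite addr_gt0.
  rewrite mulr_natl -lnXn// ler_ln ?posrE ?exprn_gt0//.
  have -> : 1 + al = a.+1%:R by rewrite /al -natr1 addrC.
  by rewrite -natrX ler_nat ltnW.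
have lnal : ln (1 + al) <= al by apply: le_ln1Dx; lra.
(* Since [216 = 18 * 12], [18 * sg * x] is [ln n / 12], at most [ln (1 + al)]; this is what keeps
   the squared Chebyshev value linear in [a]. *)
pose x : R := 216^-1 * ln n%:R / sg.
have x0 : 0 <= x.
  by apply: divr_ge0; [apply: mulr_ge0; [rewrite invr_ge0|exact: lnn0]|exact: ltW].
(* Rounding up gives the strict [k < L]; the excess of at most 2 over [x] costs the factor
   [expR 36], as [18 * sg * 2 <= 36]. *)
pose L := (Num.truncn x).+2.
have Lx : L%:R <= x + 2.
  by rewrite /L -addn2 natrD lerD2r truncn_le.
have kL k : k%:R < x -> (k < L)%N.
  by move=> /ltW kx; rewrite /L ltnS leqW// truncn_ge_nat.
clearbody L.
have sgx : sg * x = 216^-1 * ln n%:R by rewrite /x mulrC divfK// gt_eqF.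
have sLle : 18 * sg * L%:R <= ln (1 + al) + 36.
  have h : sg * L%:R <= sg * x + sg * 2 by rewrite -mulrDr ler_wpM2l// ltW.
  have -> : 18 * sg * L%:R = 18 * (sg * L%:R) by ring.
  lra.
have alq1 : 1 <= al * q by rewrite mulr_ege1.
have xq : x <= al * q / 18.
  have -> : x = (216^-1 * ln n%:R) * q by [].
  have h : 216^-1 * ln n%:R <= al / 18 by lra.
  have := ler_wpM2r (ltW q0) h; lra.
have Lam : L.+1%:R <= 4 * (al * q).
  rewrite -natr1; lra.
have ell : L%:R <= 4 * (al * q) by apply: le_trans Lam; rewrite ler_nat.
have [L0 Lam0] : 0 <= (L%:R : R) /\ 0 <= (L.+1%:R : R) by [].
pose lam : R := ((1 + 9 * sg) + (1 + 9 * sg)^-1) / 2.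
have cheb2 : (cheb L).[lam] ^+ 2 <= 2 * al * expR 36.
  apply: (le_trans (cheb_growth_expR L (ltW s0))).
  apply: (@le_trans _ _ (expR (ln (1 + al) + 36))); first by rewrite ler_expR.
  rewrite expRD lnK ?posrE; last by lra.
  by rewrite ler_wpM2r ?expR_ge0//; lra.
pose b := (a ^ 4)%N.
have bE : b%:R = al ^+ 4 :> R by rewrite natrX.
have b0 : (0 < b)%N by rewrite expn_gt0 a1.
have aln k : 0 < al ^+ k by rewrite exprn_gt0.
have lam4 : 1 + 4 * eps <= lam by rewrite -sg2; apply: joukowski_gap; rewrite s0.
clearbody b lam.
exists L, b, lam; split; first by split; [exact: n0|exact: b0|exact: lam4].
split.
- set m := (1 + L.+1 * b)%N; pose mu : R := m%:R.
  have -> : @gram_const R *+ n *+ m *+ m = C * kappa ^+ 2 * n%:R * mu * mu by rewrite -gC !mulr_natr.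
  have mu0 : 0 <= mu by [].
  have mu5 : mu <= 5 * q * al ^+ 5.
    rewrite /mu /m natrD natrM bE.
    have h1 : L.+1%:R * al ^+ 4 <= 4 * (al * q) * al ^+ 4 by rewrite ler_wpM2r// ltW.
    have h2 : 1 <= q * al ^+ 5 by rewrite mulr_ege1// exprn_ege1.
    have h3 : 4 * (al * q) * al ^+ 4 = 4 * (q * al ^+ 5) by ring.
    have h4 : 5 * q * al ^+ 5 = 5 * (q * al ^+ 5) by ring.
    rewrite h4; rewrite h3 in h1; lra.
  have H1 : 9 * 100 ^+ 2 * C * mu ^+ 2 * q ^+ 4 <= n%:R.
    apply: (@le_trans _ _ (A1 * al ^+ 10)).
      have -> : A1 * al ^+ 10 = 9 * 100 ^+ 2 * C * (5 * q * al ^+ 5) ^+ 2 * q ^+ 4 by rewrite /A1; ring.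
      apply: ler_wpM2r => //; apply: ler_wpM2l; first by rewrite mulr_ge0.
      by apply: lerXn2r; rewrite ?nnegrE//; exact: le_trans mu5.
    apply: le_trans nal.
    have -> : al ^+ 12 = al * al * al ^+ 10 by ring.
    rewrite ler_pM2r//.
    have : al <= al * al by rewrite ler_peMr// ltW.
    lra.
  have D0 : 0 < eps / 100 * (kappa * n%:R) by rewrite mulr_gt0 ?divr_gt0// mulr_gt0.
  rewrite ler_pdivrMr ?exprn_gt0//.
  have -> : C * kappa ^+ 2 * n%:R * mu * mu =
      (kappa ^+ 2 * n%:R * eps ^+ 2 / (9 * 100 ^+ 2)) * (9 * 100 ^+ 2 * C * mu ^+ 2 * q ^+ 4).
    transitivity (C * kappa ^+ 2 * n%:R * mu * mu * (eps * q ^+ 2) ^+ 2); first by rewrite eq2 expr1n mulr1.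
    by field.
  have -> : 9^-1 * (eps / 100 * (kappa * n%:R)) ^+ 2 =
      (kappa ^+ 2 * n%:R * eps ^+ 2 / (9 * 100 ^+ 2)) * n%:R by field.
  apply: ler_wpM2l => //.
  by apply: divr_ge0 => //; apply: mulr_ge0; rewrite ?sqr_ge0// mulr_ge0 ?sqr_ge0// ltW.
- have -> : @gram_const R *+ b *+ L *+ L *+ L.+1 = C * kappa ^+ 2 * b%:R * L%:R * L%:R * L.+1%:R.
    by rewrite -gC !mulr_natr.
  have H2 : 36 * C * (L%:R * L%:R * L.+1%:R) <= b%:R.
    apply: (@le_trans _ _ (A2 * al ^+ 3)).
      have -> : A2 * al ^+ 3 = 36 * C * (4 * (al * q) * (4 * (al * q)) * (4 * (al * q))).
        by rewrite /A2; ring.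
      apply: ler_wpM2l; first by rewrite mulr_ge0.
      by apply: ler_pM => //; apply: ler_pM.
    rewrite bE; have -> : al ^+ 4 = al * al ^+ 3 by ring.
    rewrite ler_pM2r//; lra.
  have b0' : 0 < b%:R :> R by rewrite ltr0n.
  have D0 : 0 < b%:R * kappa / 2 by rewrite divr_gt0// mulr_gt0.
  rewrite ler_pdivrMr ?exprn_gt0//.
  have -> : C * kappa ^+ 2 * b%:R * L%:R * L%:R * L.+1%:R =
     (kappa ^+ 2 * b%:R / 36) * (36 * C * (L%:R * L%:R * L.+1%:R)) by field.
  have -> : 9^-1 * (b%:R * kappa / 2) ^+ 2 = (kappa ^+ 2 * b%:R / 36) * b%:R by field.
  apply: ler_wpM2l => //.
  by apply: divr_ge0 => //; rewrite mulr_ge0 ?sqr_ge0// ltW.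
- have b0' : 0 < b%:R :> R by rewrite ltr0n.
  rewrite ler_pdivrMr//.
  have H3 : 18 * L%:R * (cheb L).[lam] ^+ 2 <= 144 * expR 36 * q * al ^+ 2.
    have -> : 144 * expR 36 * q * al ^+ 2 = 18 * (4 * (al * q)) * (2 * al * expR 36) by ring.
    apply: ler_pM; [by rewrite mulr_ge0|exact: sqr_ge0| |exact: cheb2].
    by rewrite ler_pM2l.
  apply: (le_trans H3).
  have -> : 144 * expR 36 * q * al ^+ 2 = (eps ^+ 2 / 100 ^+ 2) * (A3 * al ^+ 2).
    transitivity (144 * expR 36 * q * al ^+ 2 * (eps * q ^+ 2) ^+ 2); first by rewrite eq2 expr1n mulr1.
    by rewrite /A3; field.
  rewrite expr_div_n; apply: ler_wpM2l.
    by apply: divr_ge0; exact: sqr_ge0.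
  rewrite bE; have -> : al ^+ 4 = al * al * al ^+ 2 by ring.
  rewrite ler_pM2r//.
  have : al <= al * al by rewrite ler_peMr// ltW.
  lra.
exact: kL.
Qed.

End Asymptotics.

Theorem theorem1p1 (R : realType) :
  exists c : R, 0 < c /\
  exists N : R -> nat,
  forall eps : R, 0 < eps < 1 ->
  forall n : nat, (N eps <= n)%N ->
  exists D : probability (mxSpace R n) R,
    D (@sym_set R n) = 1%E /\
    forall (d : measure_display) (Om : measurableType d) (P : probability Om R)
      (k : nat) (query : Om -> seq 'cV[R]_n -> 'cV[R]_n)
      (out : Om -> seq 'cV[R]_n -> 'cV[R]_n),
      succeeds D P query out k eps ->
      c * ln (n%:R) / Num.sqrt eps <= k%:R.
Proof.
exists 216^-1; split; first by rewrite invr_gt0.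
pose Q (eps : R) (N : nat) := 0 < eps < 1 -> forall n, (N <= n)%N ->
  exists L b (lam : R), let m := (1 + L.+1 * b)%N in
  [/\ (0 < n)%N, (0 < b)%N & 1 + 4 * eps <= lam] /\
  [/\ @gram_const R *+ n *+ m *+ m / (eps / 100 * (@kappa R * n%:R)) ^+ 2 <= 9^-1,
      @gram_const R *+ b *+ L *+ L *+ L.+1 / (b%:R * @kappa R / 2) ^+ 2 <= 9^-1,
      18 * L%:R * (cheb L).[lam] ^+ 2 / b%:R <= (eps / 100) ^+ 2 &
      forall k, k%:R < 216^-1 * ln n%:R / Num.sqrt eps -> (k < L)%N].
have HQ eps : exists N, Q eps N.
  (* The threshold has to be a total function of [eps]; outside the unit interval it takes the dummy
     value 0. *)
  have [e01|ne] := pselect (0 < eps < 1); last by exists 0%N => /ne.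
  by have [N HN] := parameters_exist e01; exists N => _.
have [N HN] := boolp.choice HQ.
exists N => eps e01 n Nn.
have [L [b [lam [[n0 b0 lam1] [C1 C2 C3 kL]]]]] := HN eps e01 n Nn.
have [D [Dsym DP]] := hard_instance e01 n0 b0 lam1 C1 C2 C3.
exists D; split=> // d Om P k query out succ.
rewrite leNgt; apply/negP => /kL kL'.
exact: DP kL' succ.
Qed.
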